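(* Let $\psi\in\Psi$. Then $\Gamma_{\rm i}(\Lambda(\psi))\neq\{1\}$ if and only if there exist integers $k,l\ge2$ such that $$\limsup_{u\rightarrow0}\frac{\psi(ku)}{\psi(u)}<k\quad\text{and}\quad\limsup_{u\rightarrow0}\frac{\psi(u^l)}{\psi(u)}<1.$$
   Context: $\Psi$ is the set of all increasing continuous concave functions $\psi$ on $[0,1]$ with $\psi(0)=0$. For measurable $x$ on $[0,1]$ with Lebesgue measure $m$, $x^*(t)=\inf\{s\ge0:m(|x|>s)\le t\}$. The Lorentz space $\Lambda(\psi)$ on $[0,1]$ has norm $\|x\|_{\Lambda(\psi)}=\int_0^1x^*(t)\,d\psi(t)$. For a Banach function space $E$ on $[0,1]$ and $p\ge1$, a bounded sequence $\{x_n\}\subset E$ is a $p$-BS-sequence if for every subsequence $\{y_k\}\subset\{x_n\}$ one has $\sup_{j\in\mathbb N}j^{-1/p}\|\sum_{k=1}^jy_k\|_E<\infty$. $\Gamma_{\rm i}(E)$ is the set of all $p\ge1$ such that every weakly null sequence in $E$ of independent random variables contains a subsequence which is a $p$-BS-sequence. *)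

(* Defs.v *)
(* MathComp-Analysis *)
From HB Require Import structures.
From mathcomp Require Import all_boot all_order all_algebra.
From mathcomp Require Import all_classical all_reals all_analysis.

Set Implicit Arguments.
Unset Strict Implicit.
Unset Printing Implicit Defensive.

Import Order.TTheory GRing.Theory Num.Theory.
Import numFieldTopology.Exports numFieldNormedType.Exports.

Local Open Scope classical_set_scope.
Local Open Scope ring_scope.

(* "Increasing" is taken in the wide sense, as is usual for Lorentz spaces; the
   zero function, for which the Lorentz "norm" vanishes identically, is then
   excluded by the last field (automatic if psi is strictly increasing).
   Only the values of psi on [0, 1] matter. *)
Record Psi (R : realType) := MkPsi {
  Psi_fun :> R -> R ;
  Psi_nondecreasing : {in `[0, 1] &, {homo Psi_fun : s t / s <= t}} ;
  Psi_continuous : {within `[0, 1], continuous Psi_fun} ;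
  Psi_concave :
    convex_function (`[0, 1]%classic : set R^o) (fun t => - Psi_fun t) ;
  Psi0 : Psi_fun 0 = 0 ;
  Psi_neq0 : exists2 t, t \in `[0, 1] & Psi_fun t != 0 }.

(* Extension of psi to the line by constants, used only to form the
   Stieltjes measure d psi, which is therefore carried by [0, 1]. *)
Definition Psi_ext (R : realType) (psi : Psi R) (t : R) : R :=
  psi (Order.max 0 (Order.min t 1)).

Section Psi_ext_cumulative.
Variables (R : realType) (psi : Psi R).

Let clamp (t : R) : R := Order.max 0 (Order.min t 1).

Let clamp01 t : clamp t \in `[0, 1].
Proof. by rewrite in_itv/= /clamp le_max lexx ge_max ler01 ge_min lexx orbT. Qed.

Let Psi_ext_nd : {homo Psi_ext psi : s t / s <= t}.
Proof.
move=> s t st; apply: Psi_nondecreasing; [exact: clamp01|exact: clamp01|].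
by rewrite le_max2// le_min2.
Qed.

Let Psi_ext_rc : right_continuous (Psi_ext psi).
Proof.
apply: right_continuousW => x.
have cc : {for x, continuous clamp}.
  apply: (@continuous_max R R (cst 0) (fun t => Order.min t 1)).
    exact: cvg_cst.
  by apply: (@continuous_min R R id (cst 1)); [exact: cvg_id|exact: cvg_cst].
have /subspace_continuousP/(_ (clamp x) (clamp01 x)) cp := @Psi_continuous R psi.
apply: (@cvg_comp _ _ _ clamp psi _ _ _ _ cp) => A /= wA.
have wA' : \forall y \near x, clamp y \in `[0, 1] -> A (clamp y) := cc _ wA.
by near=> y; apply: (near wA' y) => //; exact: clamp01.
Unshelve. all: by end_near. Qed.

HB.instance Definition _ :=
  isCumulative.Build R _ R (Psi_ext psi) Psi_ext_nd Psi_ext_rc.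

End Psi_ext_cumulative.

Section function_spaces.
Variable R : realType.
Implicit Types (x y : R -> R) (N : (R -> R) -> \bar R).

(* Functions on [0, 1] are functions R -> R of which only the restriction to
   [0, 1] is considered. *)
Local Notation I01 := (`[0%R, 1%R]%classic : set R).
Local Notation m := (@lebesgue_measure R).

Definition rearrangement x (t : R) : \bar R :=
  ereal_inf [set s%:E | s in
    [set s : R | 0 <= s /\ (m (I01 `&` [set r | (s < `|x r|)%R]) <= t%:E)%E]].

Definition Lorentz_norm (psi : Psi R) x : \bar R :=
  (\int[lebesgue_stieltjes_measure (Psi_ext psi)]_(t in I01)
     rearrangement x t)%E.

(* A Banach function space on [0, 1] is represented by its norm N, set to +oo
   off the space; elements are functions rather than classes modulo a.e.
   equality, and measurable means Borel, which loses no class. *)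
Definition function_space N : set (R -> R) :=
  [set x | measurable_fun I01 x /\ (N x < +oo)%E].

(* Boundedness makes such an F factor through the quotient of the space by
   the functions of norm 0. *)
Definition bounded_linear_functional N (F : (R -> R) -> R) :=
  (forall (a : R) x y, function_space N x -> function_space N y ->
     F (fun t => a * x t + y t) = a * F x + F y) /\
  (exists C : R, forall x, function_space N x -> (`|F x|%R%:E <= C%:E * N x)%E).

Definition weakly_null N (x : nat -> R -> R) :=
  (forall n, function_space N (x n)) /\
  (forall F, bounded_linear_functional N F -> (F \o x) @ \oo --> (0 : R)).

(* Mutual independence on the probability space ([0, 1], m). *)
Definition independent (x : nat -> R -> R) :=
  forall (s : seq nat) (B : nat -> set R), uniq s ->
    (forall i, measurable (B i)) ->
    m (I01 `&` \bigcap_(i in [set` s]) (x i @^-1` B i)) =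
    (\prod_(i <- s) m (I01 `&` (x i @^-1` B i)))%E.

Definition subsequence (x y : nat -> R -> R) :=
  exists2 f : nat -> nat, {homo f : i j / (i < j)%N} & y = x \o f.

Definition bounded_sequence N (x : nat -> R -> R) :=
  (forall n, function_space N (x n)) /\ (ereal_sup (range (N \o x)) < +oo)%E.

Definition BS_sequence N (p : R) (x : nat -> R -> R) :=
  bounded_sequence N x /\
  forall y : nat -> R -> R, subsequence x y ->
    (ereal_sup [set ((j%:R `^ (- p^-1))%R%:E *
                     N (fun t => (\sum_(k < j) y k t)%R))%E
               | j in [set j : nat | (0 < j)%N]] < +oo)%E.

Definition Gamma_i N : set R :=
  [set p | 1 <= p /\
    forall x : nat -> R -> R, weakly_null N x -> independent x ->
      exists2 y : nat -> R -> R, subsequence x y & BS_sequence N p y].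

End function_spaces.

(* Main.v *)
Require Import Defs.
From mathcomp Require Import all_boot all_order all_algebra.
From mathcomp Require Import all_classical all_reals all_analysis.
From mathcomp Require Import measurable_realfun.
From mathcomp Require Import ring lra zify.
Set Implicit Arguments.
Unset Strict Implicit.
Unset Printing Implicit Defensive.
Import Order.TTheory GRing.Theory Num.Theory.
Import numFieldTopology.Exports numFieldNormedType.Exports.
Local Open Scope classical_set_scope.
Local Open Scope ring_scope.

(** Write N for the norm of the Lorentz space of psi, and tail x s for the
    measure of the set where |x| > s. The norm is only used through its layers:
    for a step d, the sum of d * psi (tail x (i * d)) over i >= 1 is at most
    N x and misses it by at most d * psi 1 (grid_le_norm, norm_le_grid). On the
    dual side, a weight g >= 0 of integral at most psi (|A|) over every set A
    integrates |x| to at most N x (int_weight_le_norm), and on a chain of level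
    sets of x a weight can attain all the bounds psi (|A|) at once
    (chain_weight); this gives the triangle inequality, functionals norming a
    chosen part of a function, and, through a gliding hump, necessary
    conditions for weak nullity. In particular a weakly null sequence is
    bounded, so that 1 always belongs to Gamma_i, and the theorem asks when
    some p > 1 does.

    Necessity. If the first condition fails for every k, then for each K there
    are arbitrarily small u with psi (K u) >= (K / 2) psi u. The union of K
    independent events of probability u has probability about K u, so the sum
    of their K indicators has norm of order K * psi u, as large as the triangle
    inequality allows (saturated_of_dilation). If the second condition fails for
    every l, then psi (u ^ K) >= psi u / 2 for arbitrarily small u, and the same
    conclusion holds, because the sum equals K on the intersection of the
    events (saturated_of_power). Now let the n-th term of a sequence be the sum over
    i <= n of c_i (1_B(n,i) - u_i), where the events B(n,i), of probability u_i,
    depend only on the n-th digit of a mixed radix expansion, and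
    c_i * psi u_i = 2 ^ - i. These terms are independent, and they are weakly
    null since their Cesaro means tend to 0 (example_weakly_null). Yet, along any
    subsequence, K_i successive terms have a sum of norm at least a multiple of
    K_i * 2 ^ - i; choosing K_i with K_i ^ (1 - 1/p) >= 4 ^ i excludes p
    (saturated_notin_Gamma).

    Sufficiency. Near 0 the two conditions say that psi (k u) <= r k psi u and
    psi (u ^ l) <= r psi u with a common r < 1. Let A_0, A_1, ... be
    independent events of probability at most t, at most B ^ n in number. The
    triangle inequality bounds the norm of their centred sum by a multiple of
    B ^ n * psi t; for a suitable B, this is improved to a multiple of
    (r B) ^ n * psi t (block_estimate). When the events are rare, one counts
    how many occur: the first condition handles the values up to a threshold,
    and the second one the values above it, whose probability is at most a high
    power of t (centred_rare). When they are not, Chernoff's bound and the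
    second condition are enough (centred_common).

    The general case reduces to this one by layers. The first condition makes
    psi u / u tend to infinity at 0, and then a weakly null sequence has
    uniformly small tails: the sum over i >= T of psi (tail (x n) i) tends to 0
    uniformly in n as T grows. Otherwise, highly concentrated functionals, each
    seeing the tail of one term, would form a gliding hump
    (heavy_tails_not_weakly_null). Consequently, along a subsequence, the
    sequences psi (tail (x n) i) have a common summable majorant in i
    (dominated_tails). Cut j terms of the subsequence into layers of thickness
    1/j. Up to a bounded error, their sum is a combination of centred sums of
    independent events, one for each layer and each sign, and these centred
    sums are controlled by block_estimate and by the majorant (layered_norm).
    The outcome is a bound by a multiple of (r B) ^ n for j close to B ^ n, which
    is at most a multiple of j ^ (1/p) for some p > 1. *)

(** * Geometric sums and increasing maps of the integers *)

Section real_sequences.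
Context {R : realType}.

Lemma geometric_sum_le (q : R) (a J : nat) : 0 <= q < 1 ->
  \sum_(a <= i < J) q ^+ i <= q ^+ a / (1 - q).
Proof.
move=> /andP[q0 q1]; have q1' : 0 < 1 - q by rewrite subr_gt0.
have [aJ|aJ] := leqP a J; last first.
  by rewrite big_geq ?(ltnW aJ)// divr_ge0 ?exprn_ge0// ltW.
suff -> : \sum_(a <= i < J) q ^+ i = q ^+ a / (1 - q) - q ^+ J / (1 - q).
  by rewrite gerBl divr_ge0 ?exprn_ge0// ltW.
elim: J aJ => [|J IH]; first by rewrite leqn0 => /eqP ->; rewrite big_geq// subrr.
rewrite leq_eqVlt => /orP[/eqP <-|aJ]; first by rewrite big_geq// subrr.
by rewrite big_nat_recr//= IH// [q ^+ J.+1]exprS; field; rewrite gt_eqF.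
Qed.

Lemma geo2_le (a J : nat) : \sum_(a <= i < J) (2^-1 : R) ^+ i <= 2 * 2^-1 ^+ a.
Proof.
have h : 0 <= (2^-1 : R) < 1 by lra.
apply: (le_trans (geometric_sum_le a J h)); rewrite le_eqVlt; apply/orP; left.
by apply/eqP; field.
Qed.

Lemma geo3_le (a J : nat) : \sum_(a <= i < J) (3^-1 : R) ^+ i <= 3 / 2 * 3^-1 ^+ a.
Proof.
have h : 0 <= (3^-1 : R) < 1 by lra.
apply: (le_trans (geometric_sum_le a J h)); rewrite le_eqVlt; apply/orP; left.
by apply/eqP; field.
Qed.

Lemma expr_small (q e : R) : 0 < q < 1 -> 0 < e -> exists n, (0 < n)%N /\ q ^+ n <= e.
Proof.
move=> /andP[q0 q1] e0; have q1' : `|q| < 1 by rewrite gtr0_norm.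
have /cvgrPdist_le/(_ _ e0)[n _ nP] := cvg_expr q1'.
exists n.+1; split => //; have := nP n.+1 (leqnSn n).
by rewrite /= sub0r normrN ger0_norm// exprn_ge0// ltW.
Qed.

Lemma increasing_inj (f : nat -> nat) : {homo f : i j / (i < j)%N} -> injective f.
Proof.
by move=> fm a b fab; have [ab|ab|//] := ltngtP a b; have := fm _ _ ab;
  rewrite fab ltnn.
Qed.

Lemma increasing_geq (f : nat -> nat) : {homo f : i j / (i < j)%N} ->
  forall k, (k <= f k)%N.
Proof. by move=> hf; elim=> // k IH; apply: (leq_ltn_trans IH); exact: hf. Qed.

End real_sequences.

(** * Concave functions vanishing at 0 *)

Section concave_facts.
Context {R : realType} (psi : Psi R).

Lemma psi_concave (a u v : R) : 0 <= a <= 1 -> 0 <= u <= 1 -> 0 <= v <= 1 ->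
  a * psi u + (1 - a) * psi v <= psi (a * u + (1 - a) * v).
Proof.
move=> a01 u01 v01.
have ta : Itv.spec (@Itv.num_sem R) (Itv.Real `[0%Z, 1%Z]) a.
  rewrite /Itv.num_sem/= realE; case/andP: a01 => a0 a1.
  by rewrite a0 /= in_itv/= a0 a1.
have := @Psi_concave R psi (Itv.mk ta : {i01 R}) u v.
rewrite !inE/= !in_itv/= => /(_ u01 v01).
rewrite !convRE/= !mulrN -opprD lerN2 => h; exact: h.
Qed.

Lemma psi_mono (u v : R) : 0 <= u -> u <= v -> v <= 1 -> psi u <= psi v.
Proof.
move=> u0 uv v1; apply: Psi_nondecreasing => //; rewrite in_itv/=.
  by rewrite u0 (le_trans uv).
by rewrite v1 (le_trans u0).
Qed.

Lemma psi_ge0 (u : R) : 0 <= u <= 1 -> 0 <= psi u.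
Proof. by case/andP => u0 u1; rewrite -(Psi0 psi) psi_mono. Qed.

Lemma psi_star (a u : R) : 0 <= a <= 1 -> 0 <= u <= 1 ->
  a * psi u <= psi (a * u).
Proof.
move=> a01 u01; have := @psi_concave a u 0 a01 u01.
by rewrite lexx ler01 Psi0 !mulr0 !addr0; exact.
Qed.

Lemma psi1_gt0 : 0 < psi 1.
Proof.
have [t] := Psi_neq0 psi; rewrite in_itv/= => t01 pt.
have t0 : psi t > 0 by rewrite lt_neqAle eq_sym pt psi_ge0.
apply: (lt_le_trans t0); apply: psi_mono => //; by case/andP: t01.
Qed.

(** The layer sums of step d are off by d * psi 1, so this is the step to take
    for an error e. *)
Lemma grid_step (e : R) : 0 < e -> exists2 d : R, 0 < d & d * psi 1 = e.
Proof.
move=> e0; exists (e / psi 1); first by rewrite divr_gt0// psi1_gt0.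
by rewrite divfK// gt_eqF// psi1_gt0.
Qed.

Lemma psi_ge_lin (u : R) : 0 <= u <= 1 -> u * psi 1 <= psi u.
Proof. by move=> u01; have := @psi_star u 1 u01; rewrite mulr1 ler01 lexx; exact. Qed.

Lemma psi_gt0 (u : R) : 0 < u <= 1 -> 0 < psi u.
Proof.
move=> /andP[u0 u1]; apply: (@lt_le_trans _ _ (u * psi 1)).
  by rewrite mulr_gt0// psi1_gt0.
by rewrite psi_ge_lin// ltW.
Qed.

Lemma psi_le1 (u : R) : 0 <= u <= 1 -> psi u <= psi 1.
Proof. by case/andP => u0 u1; apply: psi_mono. Qed.

(** For u <= w by monotonicity, for u >= w by concavity; adding the two bounds
    spares later comparisons of u with w. *)
Lemma psi_le_scale (u w : R) : 0 <= u <= 1 -> 0 < w <= 1 ->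
  psi u <= (1 + u / w) * psi w.
Proof.
move=> u01 /andP[w0 w1]; have [uw|wu] := leP u w.
  apply: (@le_trans _ _ (psi w)).
    by apply: psi_mono => //; case/andP: u01.
  rewrite mulrDl mul1r lerDl mulr_ge0 ?psi_ge0 ?w1 ?(ltW w0)//.
  by rewrite divr_ge0 ?(ltW w0)//; case/andP: u01.
case/andP: u01 => u0 u1; have u0' := lt_trans w0 wu.
have := @psi_star (w / u) u.
rewrite u0 u1 divr_ge0 ?(ltW w0)//= ler_pdivrMr// mul1r (ltW wu).
rewrite divfK ?gt_eqF// => /(_ isT isT) h.
have : psi u <= u / w * psi w.
  by rewrite -ler_pdivrMl ?divr_gt0// invf_div.
move=> /le_trans; apply; rewrite mulrDl lerDr mul1r psi_ge0// ltW//=.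
Qed.

(** Concavity in the form that extends a weight along a chain of sets
    (chain_weight): the increments start at different points and have different
    lengths. *)
Lemma psi_slope (al e a b : R) : 0 <= al <= e -> 0 <= a <= b -> e + b <= 1 ->
  (psi (e + b) - psi e) * a <= (psi (al + a) - psi al) * b.
Proof.
move=> /andP[al0 ale] /andP[a0 ab] eb1.
have [b0|b0] := eqVneq b 0.
  have -> : a = 0 by apply/eqP; rewrite eq_le a0 -b0 ab.
  by rewrite b0 !mulr0.
have {}b0 : 0 < b by rewrite lt_neqAle eq_sym b0 (le_trans a0).
(* both inner points of the interval [al, e + b] are compared with its chord *)
set L := e + b - al; have L0 : 0 < L by rewrite /L; lra.
have c1 : (1 - a / L) * psi al + (a / L) * psi (e + b) <= psi (al + a).
  have h : 0 <= 1 - a / L <= 1.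
    rewrite subr_ge0 ler_pdivrMr// mul1r gerBl divr_ge0 ?(ltW L0)// andbT /L; lra.
  have := @psi_concave (1 - a / L) al (e + b) h.
  have -> : 1 - (1 - a / L) = a / L by ring.
  have -> : (1 - a / L) * al + a / L * (e + b) = al + a.
    by rewrite /L; field; rewrite -/L gt_eqF.
  apply; apply/andP; split; lra.
have c2 : (b / L) * psi al + (1 - b / L) * psi (e + b) <= psi e.
  have h : 0 <= b / L <= 1.
    rewrite divr_ge0 ?(ltW L0) ?(ltW b0)//= ler_pdivrMr// mul1r /L; lra.
  have := @psi_concave (b / L) al (e + b) h.
  have -> : b / L * al + (1 - b / L) * (e + b) = e.
    by rewrite /L; field; rewrite -/L gt_eqF.
  apply; apply/andP; split; lra.
have c1' : (psi (e + b) - psi al) * (a / L) <= psi (al + a) - psi al.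
  move: c1; set q := a / L; lra.
have c2' : psi (e + b) - psi e <= (psi (e + b) - psi al) * (b / L).
  move: c2; set q := b / L; lra.
apply: (@le_trans _ _ ((psi (e + b) - psi al) * (b / L) * a)).
  by rewrite ler_wpM2r.
have -> : (psi (e + b) - psi al) * (b / L) * a = (psi (e + b) - psi al) * (a / L) * b.
  by ring.
by rewrite ler_wpM2r// ltW.
Qed.

Lemma psi_small (eta : R) : 0 < eta ->
  exists2 ka, 0 < ka <= 1 & forall u, 0 <= u <= ka -> psi u <= eta.
Proof.
move=> eta0.
have c0 := @Psi_continuous R psi.
have /subspace_continuousP/(_ 0) := c0.
rewrite /= in_itv/= lexx ler01 => /(_ isT).
move=> /cvgrPdist_le/(_ _ eta0). rewrite /from_subspace Psi0.
move=> [d /= d0 dP].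
exists (Num.min (d / 2) 1); first by rewrite lt_min ltr01 andbT divr_gt0//= ge_min lexx orbT.
move=> u /andP[u0]; rewrite le_min => /andP[ud u1].
have := dP u; rewrite /ball_ /= sub0r normrN ger0_norm//.
move=> /(_ (le_lt_trans ud _)); rewrite ltr_pdivrMr// ltr_pMr// ltr1n => /(_ isT).
rewrite in_itv/= u0 u1 => /(_ isT).
by rewrite sub0r normrN ger0_norm// psi_ge0// u0.
Qed.

End concave_facts.

(** * Distribution functions and the norm as a sum over layers *)

Section distribution.
Context {R : realType}.
Implicit Types (x y : R -> R) (A B : set R).

Local Notation I01 := (`[0%R, 1%R]%classic : set R).
Local Notation m := (@lebesgue_measure R).

(** Sets and functions live on the whole line and only their traces on [0, 1]
    matter, hence the intersections with I01 here and in all measurability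
    hypotheses. *)
Definition pr A : R := fine (m (I01 `&` A)).

Definition tail x (s : R) : R := pr [set t | s < `|x t|].

Lemma mI01 : measurable I01. Proof. exact: measurable_itv. Qed.

Lemma measure_I01 : m I01 = 1%E.
Proof. by rewrite lebesgue_measure_itv/= lte_fin ltr01 -EFinB subr0. Qed.

Lemma measureI01_fin A : measurable (I01 `&` A) -> m (I01 `&` A) \is a fin_num.
Proof.
move=> mA; rewrite ge0_fin_numE//; apply: le_lt_trans (ltry 1).
by rewrite -measure_I01 le_measure ?inE//; exact: mI01.
Qed.

Lemma prE A : measurable (I01 `&` A) -> (pr A)%:E = m (I01 `&` A).
Proof. by move=> mA; rewrite fineK// measureI01_fin. Qed.

Lemma pr_ge0 A : 0 <= pr A. Proof. exact: fine_ge0. Qed.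

Lemma pr_le1 A : measurable (I01 `&` A) -> pr A <= 1.
Proof.
move=> mA; rewrite -lee_fin prE// -measure_I01 le_measure ?inE//; exact: mI01.
Qed.

Lemma pr01 A : measurable (I01 `&` A) -> 0 <= pr A <= 1.
Proof. by move=> mA; rewrite pr_ge0 pr_le1. Qed.

Lemma le_pr A B : measurable (I01 `&` A) -> measurable (I01 `&` B) ->
  I01 `&` A `<=` I01 `&` B -> pr A <= pr B.
Proof. by move=> mA mB AB; rewrite -lee_fin !prE// le_measure ?inE. Qed.

Lemma prT : pr setT = 1.
Proof. by rewrite /pr setIT measure_I01. Qed.

Lemma pr0 : pr set0 = 0.
Proof. by rewrite /pr setI0 measure0. Qed.

Lemma mtail x s : measurable_fun I01 x -> measurable (I01 `&` [set t | s < `|x t|]).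
Proof.
move=> mx; have := measurableT_comp (@normr_measurable R setT) mx => /(_ mI01).
move=> /(_ `]s, +oo[%classic (measurable_itv _)).
by congr (measurable (_ `&` _)); apply/seteqP; split => t /=;
   rewrite in_itv/= andbT.
Qed.

Lemma measurable_abs x : measurable_fun I01 x -> measurable_fun I01 (fun t => `|x t|).
Proof. exact: (measurableT_comp (@normr_measurable R setT)). Qed.

Lemma tailE x s : measurable_fun I01 x ->
  (tail x s)%:E = m (I01 `&` [set t | s < `|x t|]).
Proof. by move=> mx; rewrite /tail prE//; exact: mtail. Qed.

Lemma tail01 x s : measurable_fun I01 x -> 0 <= tail x s <= 1.
Proof. by move=> mx; apply: pr01; exact: mtail. Qed.

Lemma le_tail x s s' : measurable_fun I01 x -> s <= s' -> tail x s' <= tail x s.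
Proof.
move=> mx ss'; apply: le_pr; try exact: mtail.
by move=> t [It /= /(le_lt_trans ss')]; split.
Qed.

Lemma rearrangement_ge0 x t : (0 <= rearrangement x t)%E.
Proof. by apply: le_ereal_inf_tmp => _ [s [s0 _] <-]; rewrite lee_fin. Qed.

Lemma rearrangement_le x s t : measurable_fun I01 x -> 0 <= s ->
  tail x s <= t -> (rearrangement x t <= s%:E)%E.
Proof.
move=> mx s0 st; apply: ereal_inf_lbound; exists s => //; split => //.
by rewrite -tailE// lee_fin.
Qed.

Lemma rearrangement_ge x s t : measurable_fun I01 x ->
  t < tail x s -> (s%:E <= rearrangement x t)%E.
Proof.
move=> mx st; apply: le_ereal_inf_tmp => _ [r [r0 rt] <-]; rewrite lee_fin leNgt.
apply/negP => rs; move: rt; rewrite -tailE// lee_fin leNgt => /negP; apply.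
by apply: (lt_le_trans st); apply: le_tail => //; exact: ltW.
Qed.

Lemma measurable_rearrangement x : measurable_fun I01 (rearrangement x).
Proof.
have ni t u : t <= u -> (rearrangement x u <= rearrangement x t)%E.
  move=> tu; apply: ereal_inf_le_tmp => _ [s [s0 st] <-].
  by exists s => //; split => //; apply: (le_trans st); rewrite lee_fin.
apply: (measurability (@ErealGenCInfty.G R)) => [|/= _ [_] [r] -> <-].
  exact: ErealGenCInfty.measurableE.
apply: measurableI => //.
have /is_intervalP -> : is_interval (rearrangement x @^-1` `[r%:E, +oo[%classic).
  move=> s t/=; rewrite !in_itv/= !andbT => fs ft u /andP[su ut].
  by rewrite in_itv/= andbT (le_trans ft)// ni.
exact: measurable_itv.
Qed.

End distribution.

Section grid_norm.
Context {R : realType} (psi : Psi R).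
Local Notation I01 := (`[0%R, 1%R]%classic : set R).
Local Notation ls := (lebesgue_stieltjes_measure (Psi_ext psi)).

Lemma ls_ocitv (a b : R) : a <= b ->
  ls `]a, b]%classic = (Psi_ext psi b - Psi_ext psi a)%:E.
Proof.
move=> ab; rewrite /lebesgue_stieltjes_measure /measure_extension/=.
by rewrite measurable_mu_extE/= ?wlength_itv_bnd//; exact: is_ocitv.
Qed.

Lemma Psi_extE (u : R) : 0 <= u <= 1 -> Psi_ext psi u = psi u.
Proof. by move=> /andP[u0 u1]; rewrite /Psi_ext min_l// max_r. Qed.

Lemma Psi_ext0 (u : R) : u <= 0 -> Psi_ext psi u = 0.
Proof.
by move=> u0; rewrite /Psi_ext min_l ?(le_trans u0)// max_l// Psi0.
Qed.

Lemma ls_I01 : ls I01 = (psi 1)%:E.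
Proof.
have N11 : (-1 : R) <= 1 by rewrite (le_trans (lerN10 _)).
have p1E : Psi_ext psi 1 = psi 1 by rewrite Psi_extE// ler01 lexx.
apply/eqP; rewrite eq_le; apply/andP; split.
  have -> : psi 1 = Psi_ext psi 1 - Psi_ext psi (-1).
    by rewrite p1E Psi_ext0 ?lerN10// subr0.
  rewrite -(ls_ocitv N11) le_measure ?inE//.
  by apply: subset_itvr; rewrite bnd_simp ltrN10.
have -> : psi 1 = Psi_ext psi 1 - Psi_ext psi 0.
  by rewrite p1E Psi_ext0// subr0.
by rewrite -(ls_ocitv ler01) le_measure ?inE//; apply: subset_itvr; rewrite bnd_simp.
Qed.

(** The missing right end d costs nothing: by concavity psi ((1 - e) d) is at
    least (1 - e) psi d, so the interval ]0, (1 - e) d] already has almost all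
    of the mass. *)
Lemma ls_co (d : R) : 0 <= d <= 1 -> ls (I01 `&` [set t | t < d]) = (psi d)%:E.
Proof.
move=> d01; have /andP[d0 d1] := d01.
have -> : I01 `&` [set t | t < d] = `[0, d[%classic.
  apply/seteqP; split => t /=; rewrite !in_itv/=.
    by move=> [/andP[-> _] ->].
  by move=> /andP[-> td]; split => //; rewrite ltW// (lt_le_trans td).
apply/eqP; rewrite eq_le; apply/andP; split.
  have N1d : -1 <= d by rewrite (le_trans (lerN10 _)).
  have -> : psi d = Psi_ext psi d - Psi_ext psi (-1).
    by rewrite Psi_extE// Psi_ext0 ?lerN10// subr0.
  rewrite -(ls_ocitv N1d) le_measure ?inE//.
  by apply: subset_itv; rewrite bnd_simp// ltrN10.
apply/lee_addgt0Pr => e e0.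
have [e1|e1] := leP 1 (e / psi 1).
  apply: (@le_trans _ _ e%:E); last by rewrite leeDr// measure_ge0.
  rewrite lee_fin (le_trans (psi_le1 psi d01))//.
  by move: e1; rewrite ler_pdivlMr ?psi1_gt0// mul1r.
have q0 : 0 <= e / psi 1 by rewrite divr_ge0 ?ltW// psi1_gt0.
have h : 0 <= (1 - e / psi 1) <= 1 by rewrite subr_ge0 ltW//= gerBl.
have h' : 0 <= (1 - e / psi 1) * d <= 1.
  by case/andP: h => h0 h1; rewrite mulr_ge0//= mulr_ile1.
have [d00|dn0] := eqVneq d 0.
  by rewrite d00 Psi0 adde_ge0 ?measure_ge0// lee_fin ltW.
have dp : 0 < d by rewrite lt_neqAle eq_sym dn0.
set r := (1 - e / psi 1) * d in h'.
apply: (@le_trans _ _ (ls `]0%R, r]%classic + e%:E)%E).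
  rewrite ls_ocitv; last by case/andP: h'.
  rewrite (Psi_ext0 (lexx 0)) subr0 Psi_extE// -EFinD lee_fin /r.
  have := psi_star psi h d01; rewrite mulrBl mul1r lerBlDr => /le_trans; apply.
  rewrite lerD2l mulrAC -mulrA ler_piMr ?(ltW e0)//.
  by rewrite ler_pdivrMr ?psi1_gt0// mul1r psi_le1.
rewrite leeD2r// le_measure ?inE//; apply: subset_itv; rewrite bnd_simp// /r.
by rewrite gtr_pMl// gtrBl divr_gt0// psi1_gt0.
Qed.

(** The norm of the function obtained from |x| by passing to the largest multiple
    of d strictly below it and truncating at n * d. *)
Definition grid x (d : R) (n : nat) : R :=
  d * \sum_(i < n) psi (tail x (d * i.+1%:R)).

Let step x (d : R) (i : nat) (t : R) : \bar R :=
  (d * \1_[set t | t < tail x (d * i.+1%:R)] t)%:E.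

Let mstep x d i : measurable_fun I01 (step x d i).
Proof.
apply/measurable_EFinP/measurable_funM => //; apply: measurable_indic.
by rewrite [X in measurable X](_ : _ = `]-oo, (tail x (d * i.+1%:R))[%classic);
  [exact: measurable_itv|apply/seteqP; split => t /=; rewrite in_itv].
Qed.

Let step_ge0 x d i t : 0 <= d -> (0 <= step x d i t)%E.
Proof. by move=> d0; rewrite lee_fin mulr_ge0// indicE. Qed.

Let int_step x d i : measurable_fun I01 x -> 0 <= d ->
  (\int[ls]_(t in I01) step x d i t)%E = (d * psi (tail x (d * i.+1%:R)))%:E.
Proof.
move=> mx d0.
have mS : measurable [set t : R | t < tail x (d * i.+1%:R)].
  by rewrite [X in measurable X](_ : _ = `]-oo, (tail x (d * i.+1%:R))[%classic);
  [exact: measurable_itv|apply/seteqP; split => t /=; rewrite in_itv].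
rewrite /step; under eq_integral do rewrite EFinM.
rewrite ge0_integralZl_EFin//; last first.
  by apply/measurable_EFinP; exact: measurable_indic.
rewrite integral_indic// setIC EFinM; congr (_ * _)%E.
by apply: ls_co; exact: tail01.
Qed.

(** The steps d * 1_[0, tail x (d (i + 1))[ add up to a minorant of the
    decreasing rearrangement of x. *)
Lemma grid_le_norm x d n : measurable_fun I01 x -> 0 <= d ->
  ((grid x d n)%:E <= Lorentz_norm psi x)%E.
Proof.
move=> mx d0; rewrite /grid mulr_sumr -sumEFin.
rewrite (eq_bigr (fun i : 'I_n => \int[ls]_(t in I01) step x d i t)%E); last first.
  by move=> i _; rewrite int_step.
rewrite -(@ge0_integral_sum _ _ _ ls _ mI01 _ (fun i : 'I_n => step x d i)); last 2 first.
- by move=> i; exact: mstep.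
- by move=> i t _; exact: step_ge0.
apply: ge0_le_integral => //.
- by move=> t _; apply: sume_ge0 => i _; exact: step_ge0.
- by apply: emeasurable_sum => i; exact: (@mstep x d i).
- exact: measurable_rearrangement.
move=> t It; rewrite sumEFin -mulr_sumr.
elim: n => [|n IH]; first by rewrite big_ord0 mulr0 rearrangement_ge0.
rewrite big_ord_recr/= [X in _ + X]indicE; case: (boolP (t \in _)) => /=; last first.
  by move=> _; rewrite addr0.
rewrite inE/= => tn; apply: le_trans (rearrangement_ge mx tn).
rewrite lee_fin ler_wpM2l// -[leRHS]natr1 lerD//.
rewrite -[in leRHS](card_ord n) -sum1_card natr_sum; apply: ler_sum => i _.
by rewrite indicE; case: (_ \in _).
Qed.

(** Conversely the rearrangement is at most d plus the sum of all the steps;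
    the summand d * psi 1 is the integral of d over the whole interval. *)
Lemma norm_le_grid x d M : measurable_fun I01 x -> 0 < d ->
  (forall n, grid x d n <= M) ->
  (Lorentz_norm psi x <= (d * psi 1 + M)%:E)%E.
Proof.
move=> mx d0 gM; have dge := ltW d0.
apply: (@le_trans _ _ (\int[ls]_(t in I01)
    (d%:E + \sum_(0 <= i <oo) step x d i t))%E).
  apply: ge0_le_integral => //.
  - by move=> t _; exact: rearrangement_ge0.
  - exact: measurable_rearrangement.
  - apply: emeasurable_funD => //; apply: ge0_emeasurable_sum => *; by
      [exact: step_ge0|exact: mstep].
  move=> t; rewrite /= in_itv/= => /andP[t0 t1].
  have [[k tk]|no] := pselect (exists k, tail x (d * k.+1%:R) <= t); last first.
    (* then every step contributes d, and the series is infinite *)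
    rewrite [X in (_ + X)%E](_ : _ = +oo%E); first by rewrite addey// leey.
    apply/eqyP => A A0.
    apply: le_trans (nneseries_lim_ge (Num.truncn (A / d)).+1 _); last first.
      by move=> i _ _; exact: step_ge0.
    rewrite (eq_bigr (fun=> d%:E)); last first.
      move=> i _; rewrite /step indicE mem_set ?mulr1//=.
      by rewrite ltNge; apply/negP => h; apply: no; exists i.
    rewrite big_mkord sumEFin lee_fin sumr_const card_ord.
    by rewrite -mulr_natr -ler_pdivrMl// mulrC ltW// truncnS_gt.
  have exk : exists k, tail x (d * k.+1%:R) <= t by exists k.
  case: (ex_minnP exk) => {}k {}tk kmin.
  apply: (le_trans (rearrangement_le mx _ tk)); first by rewrite mulr_ge0.
  rewrite -addn1 natrD mulrDr mulr1 addrC EFinD leeD2l//.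
  apply: le_trans (nneseries_lim_ge k _); last by move=> i _ _; exact: step_ge0.
  rewrite big_mkord (eq_bigr (fun=> d%:E)).
    by rewrite sumEFin lee_fin sumr_const card_ord mulr_natr.
  move=> i _; rewrite /step indicE mem_set ?mulr1//=.
  by rewrite ltNge; apply/negP => /kmin; rewrite leqNgt ltn_ord.
rewrite ge0_integralD//; last 2 first.
- by move=> t _; apply: nneseries_ge0 => i _ _; exact: step_ge0.
- by apply: ge0_emeasurable_sum => *; by [exact: step_ge0|exact: mstep].
rewrite integral_cst// [X in (_ * X)%E]ls_I01 EFinD -EFinM leeD2l//.
rewrite integral_nneseries; [|exact: mI01|by move=> i; exact: mstep|by
  move=> i t _; exact: step_ge0].
apply: lime_le.
  apply: is_cvg_nneseries => i _ _; apply: integral_ge0 => t _; exact: step_ge0.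
apply: nearW => n; rewrite (eq_bigr (fun i => (d * psi (tail x (d * i.+1%:R)))%:E)); last first.
  by move=> i _; rewrite int_step.
by rewrite sumEFin lee_fin -mulr_sumr big_mkord; exact: gM.
Qed.

End grid_norm.

(** * The unit ball of the dual *)

Section dual_ball.
Context {R : realType} (psi : Psi R).
Implicit Types (x y g : R -> R) (A B : set R).

Local Notation I01 := (`[0%R, 1%R]%classic : set R).
Local Notation m := (@lebesgue_measure R).
Local Notation N := (Lorentz_norm psi).

(** The nonnegative elements of the unit ball of the dual, which is a
    Marcinkiewicz space: testing on sets is enough. *)
Definition unit_weight g := [/\ measurable_fun I01 g, forall t, 0 <= g t &
  forall A, measurable (I01 `&` A) ->
    (\int[m]_(t in I01) (g t * \1_A t)%:E <= (psi (pr A))%:E)%E].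

Lemma measurable_indicI A : measurable (I01 `&` A) ->
  measurable_fun I01 (\1_A : R -> R).
Proof.
move=> mA; apply: (@eq_measurable_fun _ _ _ _ _ (\1_(I01 `&` A) : R -> R)).
  by move=> t It; rewrite !indicE in_setI It.
exact: measurable_indic.
Qed.

Lemma prU A B : measurable (I01 `&` A) -> measurable (I01 `&` B) ->
  A `&` B = set0 -> pr (A `|` B) = pr A + pr B.
Proof.
move=> mA mB AB; apply: (@EFin_inj R); rewrite EFinD !prE// setIUr ?measureU//.
  by rewrite setIACA setIid AB setI0.
exact: measurableU.
Qed.

Lemma int_scale (c : R) (f : R -> R) : 0 <= c -> measurable_fun I01 f ->
  (forall t, 0 <= f t) ->
  (\int[m]_(t in I01) (c * f t)%:E = c%:E * \int[m]_(t in I01) (f t)%:E)%E.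
Proof.
move=> c0 mf f0; under eq_integral do rewrite EFinM.
rewrite ge0_integralZl_EFin//.
- by move=> t _; rewrite lee_fin.
- exact/measurable_EFinP.
Qed.

Lemma int_sum n (f : 'I_n -> R -> R) :
  (forall i, measurable_fun I01 (f i)) -> (forall i t, 0 <= f i t) ->
  (\int[m]_(t in I01) (\sum_(i < n) f i t)%:E =
   \sum_(i < n) \int[m]_(t in I01) (f i t)%:E)%E.
Proof.
move=> mf f0; rewrite -(@ge0_integral_sum _ _ _ m _ mI01 _ (fun i t => (f i t)%:E)).
- by apply: eq_integral => t _; rewrite sumEFin.
- by move=> i; apply/measurable_EFinP; exact: mf.
- by move=> i t _; rewrite lee_fin.
Qed.

Lemma int_indicI A (c : R) : 0 <= c -> measurable (I01 `&` A) ->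
  (\int[m]_(t in I01) (c * \1_A t)%:E = (c * pr A)%:E)%E.
Proof.
move=> c0 mA; rewrite int_scale//; last exact: measurable_indicI.
rewrite EFinM prE//; congr (_ * _)%E.
transitivity (\int[m]_(t in I01) (\1_(I01 `&` A) t)%:E)%E.
  by apply: eq_integral => t It; rewrite !indicE in_setI It.
by rewrite integral_indic//; rewrite setIC setIA setIid.
Qed.

Lemma int_weightD g g' A : measurable_fun I01 g -> (forall t, 0 <= g t) ->
  measurable_fun I01 g' -> (forall t, 0 <= g' t) -> measurable (I01 `&` A) ->
  (\int[m]_(t in I01) ((g t + g' t) * \1_A t)%:E =
   \int[m]_(t in I01) (g t * \1_A t)%:E + \int[m]_(t in I01) (g' t * \1_A t)%:E)%E.
Proof.
move=> mg g0 mg' g'0 mA; rewrite -ge0_integralD//; first last.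
- by apply/measurable_EFinP/measurable_funM => //; exact: measurable_indicI.
- by move=> t _; rewrite lee_fin mulr_ge0.
- by apply/measurable_EFinP/measurable_funM => //; exact: measurable_indicI.
- by move=> t _; rewrite lee_fin mulr_ge0.
by apply: eq_integral => t _; rewrite -EFinD mulrDl.
Qed.

(** By induction on the chain, from the inside: on the difference D of the two
    outermost sets the new weight is the constant that gives the right integral
    over E 0. As this constant is the slope of psi between the measures of the
    two sets, concavity keeps the bound for all other sets. *)
Lemma chain_weight n (E : nat -> set R) :
  (forall i, measurable (I01 `&` E i)) -> (forall i, E i.+1 `<=` E i) ->
  E n = set0 ->
  exists g, [/\ unit_weight g, exists b : R, forall t, g t <= b,
    forall t, ~ E 0%N t -> g t = 0 &
    forall i, (i <= n)%N ->
      (\int[m]_(t in I01) (g t * \1_(E i) t)%:E = (psi (pr (E i)))%:E)%E].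
Proof.
elim: n E => [|n IH] E mE sE En.
  exists (fun=> 0); split => //.
  - split => // A mA.
    by rewrite integral0_eq ?lee_fin ?psi_ge0 ?pr01// => t _; rewrite mul0r.
  - by exists 0.
  - move=> i; rewrite leqn0 => /eqP ->; rewrite En pr0 Psi0.
    by rewrite integral0_eq// => t _; rewrite mul0r.
have [g [[mg g0 gA] [b gB] gs gE]] :=
  IH (fun i => E i.+1) (fun i => mE i.+1) (fun i => sE i.+1) En.
set D := E 0%N `\` E 1%N.
have mD : measurable (I01 `&` D).
  have -> : I01 `&` D = (I01 `&` E 0%N) `\` (I01 `&` E 1%N).
    apply/seteqP; split => t /=.
      by move=> [It [E0 E1]]; split => // -[].
    by move=> [[It E0] nE1]; split => //; split => // E1; apply: nE1.
  exact: measurableD.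
set e0 := pr (E 0%N); set e1 := pr (E 1%N).
have e0D : e0 = e1 + pr D.
  rewrite /e0 /e1 -prU//.
    congr pr; apply/seteqP; split => t /=.
      by move=> E0; have [E1|E1] := pselect (E 1%N t); [left|right].
    by move=> [/sE//|[]].
  by apply/seteqP; split => t //= -[E1 []].
have D0 := pr_ge0 D.
pose sg := (psi e0 - psi e1) / pr D.
have e001 : 0 <= e0 <= 1 by exact: pr01.
have e101 : 0 <= e1 <= 1 by exact: pr01.
have sg0 : 0 <= sg.
  rewrite /sg divr_ge0// subr_ge0 psi_mono//; [by case/andP: e101| |by case/andP: e001].
  by rewrite e0D lerDl.
have mD' : measurable_fun I01 (fun t => sg * \1_D t).
  by apply: measurable_funM => //; exact: measurable_indicI.
have D'0 t : 0 <= sg * (\1_D t : R) by rewrite mulr_ge0//.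
have intD A : measurable (I01 `&` A) ->
    (\int[m]_(t in I01) (sg * \1_D t * \1_A t)%:E = (sg * pr (A `&` D))%:E)%E.
  move=> mA; rewrite -int_indicI//; last first.
    by rewrite -(setIid I01) setIACA; exact: measurableI.
  by apply: eq_integral => t _; rewrite !indicE in_setI -mulrA -natrM mulnb andbC.
have restr A : (\int[m]_(t in I01) (g t * \1_A t)%:E =
    \int[m]_(t in I01) (g t * \1_(A `&` E 1%N) t)%:E)%E.
  apply: eq_integral => t _; rewrite !indicE in_setI.
  have [/mem_set ->|E1] := pselect (E 1%N t); first by rewrite andbT.
  by rewrite gs// !mul0r.
have mI A i : measurable (I01 `&` A) -> measurable (I01 `&` (A `&` E i)).
  by move=> mA; rewrite -(setIid I01) setIACA; exact: measurableI.
exists (fun t => g t + sg * \1_D t); split.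
- split.
  + exact: measurable_funD.
  + by move=> t; rewrite addr_ge0.
  + move=> A mA; rewrite int_weightD// intD// restr.
    set al := pr (A `&` E 1%N); set a := pr (A `&` D).
    have mAD : measurable (I01 `&` (A `&` D)).
      by rewrite -(setIid I01) setIACA; exact: measurableI.
    have al0 : 0 <= al by exact: pr_ge0.
    have a0 : 0 <= a by exact: pr_ge0.
    have ale : al <= e1 by apply: le_pr => //; [exact: mI|move=> t [It []]; split].
    have aD : a <= pr D by apply: le_pr => // t [It []]; split.
    have alaA : al + a <= pr A.
      rewrite /al /a -prU//; [|exact: mI|]; last first.
        by apply/seteqP; split => t //= -[[_ E1] [_ []]].
      apply: le_pr => //; first by rewrite setIUr; apply: measurableU => //; exact: mI.
      by move=> t [It [] []]; split.
    apply: (@le_trans _ _ (psi (al + a))%:E); last first.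
      by rewrite lee_fin psi_mono ?addr_ge0// pr_le1.
    apply: (@le_trans _ _ ((psi al)%:E + (sg * a)%:E)%E).
      by apply: leeD2r; apply: gA; exact: mI.
    rewrite -EFinD lee_fin -lerBrDl /sg.
    have [Dn|Dn] := eqVneq (pr D) 0.
      have -> : a = 0 by apply/eqP; rewrite eq_le a0 -Dn aD.
      by rewrite mulr0 addr0 subrr.
    (* al <= e1 and a <= pr D: psi grows more slowly beyond e1 than beyond al *)
    rewrite mulrAC ler_pdivrMr; last by rewrite lt_neqAle eq_sym Dn.
    rewrite e0D.
    by apply: psi_slope; rewrite ?al0 ?a0 ?aD// -e0D; case/andP: e001.
- exists (b + sg) => t; rewrite lerD//.
  by rewrite ler_piMr// indicE; case: (_ \in _).
- move=> t E0; rewrite gs//; last by move=> /sE.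
  by rewrite indicE memNset ?mulr0 ?addr0// => -[].
- move=> [|i] ilen; rewrite int_weightD// intD//.
  + rewrite restr (_ : E 0%N `&` E 1%N = E 1%N); last by apply/setIidPr.
    rewrite (gE 0%N)// -EFinD; congr EFin.
    rewrite (_ : E 0%N `&` D = D); last by apply/setIidPr => t [].
    rewrite -/e0 -/e1 /sg; have [Dn|Dn] := eqVneq (pr D) 0.
      by rewrite e0D Dn mulr0 !addr0.
    by rewrite divfK// addrC subrK.
  + rewrite gE// (_ : E i.+1 `&` D = set0) ?pr0 ?mulr0 ?adde0//.
    apply/seteqP; split => t //= -[Ei [_ nE1]]; apply: nE1.
    by elim: i {ilen} Ei => // i IHi /sE.
Qed.

Lemma level_weight x (s : nat -> R) n : measurable_fun I01 x ->
  {homo s : i j / (i <= j)%N >-> i <= j} ->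
  exists g, [/\ unit_weight g, exists b : R, forall t, g t <= b,
    forall t, `|x t| <= s 0%N -> g t = 0 &
    forall i, (i < n)%N -> (\int[m]_(t in I01)
      (g t * \1_[set t | s i < `|x t|] t)%:E = (psi (tail x (s i)))%:E)%E].
Proof.
move=> mx hs.
(* chain_weight needs a chain ending with the empty set *)
pose E i : set R := if (i < n)%N then [set t | s i < `|x t|] else set0.
have [|i|/=|g [ug gB gs gE]] := @chain_weight n E.
- move=> i; rewrite /E; case: ifPn => _; first exact: mtail.
  by rewrite setI0.
- rewrite /E; have [h|h] := ltnP i.+1 n; last by [].
  by rewrite (ltn_trans (ltnSn i) h) => t/=; apply: le_lt_trans; exact: hs.
- by rewrite /E ltnn.
exists g; split => //.
- move=> t xt; apply: gs; rewrite /E; case: ifPn => /= _ h; last by [].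
  by move: xt; rewrite leNgt h.
- by move=> i iltn; have := gE i (ltnW iltn); rewrite /E iltn.
Qed.

Lemma indic_grid_le (u : R) (d : R) n : 0 < d -> 0 <= u ->
  \sum_(i < n) d * (d * i.+1%:R < u)%R%:R <= u.
Proof.
move=> d0 u0.
elim: n => [|n IH]; first by rewrite big_ord0.
rewrite big_ord_recr/=; case: ltP => /= h; last by rewrite mulr0 addr0.
apply: le_trans (ltW h); rewrite -[in leRHS]natr1 mulrDr lerD//.
rewrite mulr_natr -[in leRHS](card_ord n) -sumr_const.
by apply: ler_sum => i _; rewrite ler_piMr ?(ltW d0)//; case: (_ < _).
Qed.

Lemma indic_grid_ge (u : R) (d : R) n : 0 < d -> u <= d * n.+1%:R ->
  u <= d + \sum_(i < n) d * (d * i.+1%:R < u)%R%:R.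
Proof.
move=> d0; elim: n => [|n IH] un; first by rewrite big_ord0 addr0 -[d]mulr1.
have [h|h] := leP u (d * n.+1%:R).
  by apply: (le_trans (IH h)); rewrite lerD2l big_ord_recr/= lerDl mulr_ge0// ltW.
apply: (le_trans un); rewrite -[in leLHS]natr1 mulrDr mulr1 addrC lerD2l.
rewrite mulr_natr -[in leLHS](card_ord n.+1) -sumr_const.
apply: ler_sum => i _; rewrite (le_lt_trans _ h) ?mulr1//.
by rewrite ler_wpM2l ?(ltW d0)// ler_nat.
Qed.

(** Hardy-Littlewood: by layers of |x|, each layer being a set. *)
Lemma int_weight_le_norm x g : measurable_fun I01 x -> unit_weight g ->
  (\int[m]_(t in I01) (`|x t| * g t)%:E <= N x)%E.
Proof.
move=> mx [mg g0 gA]; apply/lee_addgt0Pr => e e0.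
have [d d0 de] := grid_step psi e0.
pose L i t : \bar R := (d * (g t * \1_[set t | d * i.+1%:R < `|x t|] t))%:E.
have mL i : measurable_fun I01 (L i).
  apply/measurable_EFinP/measurable_funM => //; apply: measurable_funM => //.
  by apply: measurable_indicI; exact: mtail.
have L0 i t : (0 <= L i t)%E.
  by rewrite lee_fin !mulr_ge0 ?(ltW d0)//.
have intL i : (\int[m]_(t in I01) L i t <= (d * psi (tail x (d * i.+1%:R)))%:E)%E.
  rewrite /L int_scale ?(ltW d0)//; last 2 first.
  - by apply: measurable_funM => //; apply: measurable_indicI; exact: mtail.
  - by move=> t; rewrite mulr_ge0//.
  rewrite [leRHS]EFinM; apply: lee_wpmul2l; first by rewrite lee_fin ltW.
  by apply: gA; exact: mtail.
apply: (@le_trans _ _ (\int[m]_(t in I01)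
    ((d * (g t * \1_setT t))%:E + \sum_(0 <= i <oo) L i t))%E).
  apply: ge0_le_integral; first exact: mI01.
  - by move=> t _; rewrite lee_fin mulr_ge0.
  - by apply/measurable_EFinP/measurable_funM => //; exact: measurableT_comp.
  - apply: emeasurable_funD.
      apply/measurable_EFinP/measurable_funM => //; apply: measurable_funM => //.
    by apply: ge0_emeasurable_sum => *; [exact: L0|exact: mL].
  move=> t It.
  have [n xn] : exists n, `|x t| <= d * n.+1%:R.
    exists (Num.truncn (`|x t| / d)); rewrite -ler_pdivrMl// mulrC ltW//.
    exact: truncnS_gt.
  apply: (@le_trans _ _ ((d * (g t * \1_setT t))%:E + \sum_(0 <= i < n) L i t)%E).
    rewrite big_mkord sumEFin -EFinD lee_fin indicT mulr1.
    rewrite (eq_bigr (fun i : 'I_n => (d * (d * i.+1%:R < `|x t|)%R%:R) * g t)).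
      rewrite -mulr_suml -mulrDl ler_wpM2r//; exact: indic_grid_ge.
    by move=> i _; rewrite indicE mulrCA mulrC; congr (_ * _ * _); rewrite mem_setE.
  by rewrite leeD2l// nneseries_lim_ge.
rewrite ge0_integralD; first last.
- by apply: ge0_emeasurable_sum => *; [exact: L0|exact: mL].
- by move=> t _; exact: nneseries_ge0.
- apply/measurable_EFinP/measurable_funM => //; apply: measurable_funM => //.
- by move=> t _; rewrite lee_fin !mulr_ge0 ?(ltW d0)//.
- exact: mI01.
rewrite addeC; apply: leeD.
  rewrite integral_nneseries; [|exact: mI01|exact: mL|by move=> *; exact: L0].
  apply: lime_le.
    by apply: is_cvg_nneseries => i _ _; apply: integral_ge0 => t _; exact: L0.
  apply: nearW => n; apply: le_trans (grid_le_norm psi n mx (ltW d0)).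
  by rewrite /grid mulr_sumr -sumEFin big_mkord; apply: lee_sum => i _.
rewrite int_scale ?(ltW d0)//; last 2 first.
- exact: measurable_funM.
- by move=> t; rewrite mulr_ge0//.
apply: (@le_trans _ _ (d%:E * (psi (pr setT))%:E)%E).
  apply: lee_wpmul2l; first by rewrite lee_fin ltW.
  by apply: gA; rewrite setIT; exact: mI01.
by rewrite prT -EFinM lee_fin de.
Qed.

Lemma norm_ge0 x : (0 <= N x)%E.
Proof. by apply: integral_ge0 => t _; exact: rearrangement_ge0. Qed.

(** Countable subadditivity, from which the triangle inequality and the
    monotonicity of the norm follow: the grid sums of x are integrals of |x|
    against a weight of the dual unit ball. *)
Lemma norm_le_series x (y : nat -> R -> R) : measurable_fun I01 x ->
  (forall i, measurable_fun I01 (y i)) ->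
  (forall t, I01 t -> (`|x t|%:E <= \sum_(0 <= i <oo) `|y i t|%:E)%E) ->
  (N x <= \sum_(0 <= i <oo) N (y i))%E.
Proof.
move=> mx my xy.
have mny i : measurable_fun I01 (fun t => `|y i t|).
  exact: (measurable_abs (my i)).
have S0 : (0 <= \sum_(0 <= i <oo) N (y i))%E.
  by apply: nneseries_ge0 => i _ _; exact: norm_ge0.
case SE : (\sum_(0 <= i <oo) N (y i))%E S0 => [M| |] // S0; last by rewrite leey.
apply/lee_addgt0Pr => e e0.
have [d d0 de] := grid_step psi e0.
have -> : (M%:E + e%:E)%E = (d * psi 1 + M)%:E.
  by rewrite de -EFinD addrC.
apply: norm_le_grid => // n.
have [|g [[mg g0 gA] _ _ gE]] := @level_weight x (fun i => d * i.+1%:R) n mx.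
  by move=> i j ij; rewrite ler_wpM2l ?(ltW d0)// ler_nat.
rewrite -lee_fin /grid mulr_sumr -sumEFin.
rewrite (eq_bigr (fun i : 'I_n => \int[m]_(t in I01)
  (d * (g t * \1_[set t | d * i.+1%:R < `|x t|] t))%:E)%E); last first.
  move=> i _; rewrite int_scale ?(ltW d0)//; last 2 first.
  - by apply: measurable_funM => //; apply: measurable_indicI; exact: mtail.
  - by move=> t; rewrite mulr_ge0//.
  by rewrite gE// EFinM.
rewrite -(@ge0_integral_sum _ _ _ m _ mI01 _
   (fun (i : 'I_n) t => (d * (g t * \1_[set t | d * i.+1%:R < `|x t|] t))%:E)); last 2 first.
- move=> i; apply/measurable_EFinP/measurable_funM => //; apply: measurable_funM => //.
  by apply: measurable_indicI; exact: mtail.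
- by move=> i t _; rewrite lee_fin !mulr_ge0 ?(ltW d0)//.
apply: (@le_trans _ _ (\int[m]_(t in I01)
    (\sum_(0 <= i <oo) (`|y i t| * g t)%:E))%E).
  apply: ge0_le_integral; first exact: mI01.
  - by move=> t _; apply: sume_ge0 => i _; rewrite lee_fin !mulr_ge0 ?(ltW d0)//.
  - apply: emeasurable_sum => i.
    apply/measurable_EFinP/measurable_funM => //; apply: measurable_funM => //.
    by apply: measurable_indicI; exact: mtail.
  - apply: ge0_emeasurable_sum => *.
      by rewrite lee_fin; apply: mulr_ge0; [exact: normr_ge0|exact: g0].
    by apply/measurable_EFinP/measurable_funM => //; exact: mny.
  move=> t It; rewrite sumEFin.
  rewrite (eq_bigr (fun i : 'I_n => g t * (d * (d * i.+1%:R < `|x t|)%R%:R))); last first.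
    by move=> i _; rewrite indicE mulrCA; congr (_ * (_ * _)); rewrite mem_setE.
  rewrite -mulr_sumr.
  under eq_eseriesr do rewrite mulrC EFinM.
  rewrite nneseriesZl//.
  rewrite EFinM lee_wpmul2l ?lee_fin//.
  apply: le_trans (xy t It); rewrite lee_fin.
  exact: indic_grid_le.
rewrite integral_nneseries; [|exact: mI01| |by move=> i t _; rewrite lee_fin mulr_ge0].
  rewrite -SE; apply: lee_nneseries => *.
    by apply: integral_ge0 => t _; rewrite lee_fin; apply: mulr_ge0.
  exact: int_weight_le_norm.
by move=> i; apply/measurable_EFinP/measurable_funM => //; exact: mny.
Qed.

End dual_ball.

(** * The Lorentz norm *)

Section norm_facts.
Context {R : realType} (psi : Psi R).
Implicit Types (x y z : R -> R) (A B : set R).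

Local Notation I01 := (`[0%R, 1%R]%classic : set R).
Local Notation m := (@lebesgue_measure R).
Local Notation N := (Lorentz_norm psi).

Lemma norm_ge_level x A (c : R) : measurable_fun I01 x -> measurable (I01 `&` A) ->
  0 <= c -> (forall t, I01 t -> A t -> c <= `|x t|) ->
  ((c * psi (pr A))%:E <= N x)%E.
Proof.
move=> mx mA c0 cx; apply/lee_addgt0Pr => e e0.
have [d d0 de] := grid_step psi e0.
have [n cn] : exists n, c <= d * n.+1%:R.
  exists (Num.truncn (c / d)); rewrite -ler_pdivrMl// mulrC ltW//.
  exact: truncnS_gt.
have h := indic_grid_ge d0 cn.
apply: (@le_trans _ _ (e%:E + (grid psi x d n)%:E)%E); last first.
  by rewrite addeC leeD2r// grid_le_norm// ltW.
rewrite -EFinD lee_fin /grid -de.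
have pA := pr01 mA.
apply: (@le_trans _ _ ((d + \sum_(i < n) d * (d * i.+1%:R < c)%R%:R) * psi (pr A))).
  by rewrite ler_wpM2r// psi_ge0.
rewrite mulrDl lerD//.
  by rewrite ler_wpM2l ?(ltW d0)// psi_le1.
rewrite mulr_suml mulr_sumr; apply: ler_sum => i _.
rewrite -mulrA ler_wpM2l ?(ltW d0)//; case: ltP => /= h'; last first.
  by rewrite mul0r psi_ge0// tail01.
rewrite mul1r psi_mono ?pr_ge0//; last by case/andP: (tail01 (d * i.+1%:R) mx).
apply: le_pr => //; first exact: mtail.
by move=> t [It At]; split => //=; rewrite (lt_le_trans h')// cx.
Qed.

Lemma norm_le_level x A (c : R) : measurable_fun I01 x -> measurable (I01 `&` A) ->
  (forall t, I01 t -> `|x t| <= c * \1_A t) -> 0 <= c ->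
  (N x <= (c * psi (pr A))%:E)%E.
Proof.
move=> mx mA xc c0; apply/lee_addgt0Pr => e e0.
have [d d0 de] := grid_step psi e0.
rewrite -EFinD addrC -de; apply: norm_le_grid => // n.
have pA := pr01 mA.
apply: (@le_trans _ _ ((\sum_(i < n) d * (d * i.+1%:R < c)%R%:R) * psi (pr A))); last first.
  by rewrite ler_wpM2r ?psi_ge0// indic_grid_le.
rewrite /grid mulr_suml mulr_sumr; apply: ler_sum => i _.
rewrite -mulrA ler_wpM2l ?(ltW d0)//.
have s0 : 0 <= d * i.+1%:R by rewrite mulr_ge0// ltW.
case: ltP => /= h'.
  rewrite mul1r psi_mono//; [by case/andP: (tail01 (d * i.+1%:R) mx)| |by case/andP: pA].
  apply: le_pr => //; first exact: mtail.
  move=> t [It /= st]; split => //; apply: contrapT => nAt; have At := memNset nAt.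
  by move: (lt_le_trans st (xc t It)); rewrite indicE At mulr0 ltNge s0.
rewrite mul0r /tail (_ : pr _ = 0) ?Psi0//.
apply/eqP; rewrite eq_le pr_ge0 andbT -pr0; apply: le_pr; first exact: mtail.
  by rewrite setI0.
move=> t [It /= st]; exfalso.
move: (lt_le_trans st (xc t It)); rewrite ltNge; apply/negP; rewrite negbK.
by apply: le_trans h'; rewrite ler_piMr// indicE; case: (_ \in _).
Qed.

Lemma norm0 : N (fun=> 0) = 0%E.
Proof.
apply/eqP; rewrite eq_le norm_ge0 andbT.
have := @norm_le_level (fun=> 0) set0 0; rewrite setI0 mul0r; apply => //.
by move=> t _; rewrite normr0 mul0r.
Qed.

Lemma norm_cst (c : R) : (N (fun=> c) <= (`|c| * psi 1)%:E)%E.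
Proof.
have := @norm_le_level (fun=> c) setT `|c|; rewrite prT; apply => //.
  by rewrite setIT; exact: mI01.
by move=> t _; rewrite indicT mulr1.
Qed.

Lemma norm_le_sum x n (y : 'I_n -> R -> R) : measurable_fun I01 x ->
  (forall i, measurable_fun I01 (y i)) ->
  (forall t, I01 t -> `|x t| <= \sum_(i < n) `|y i t|) ->
  (N x <= \sum_(i < n) N (y i))%E.
Proof.
move=> mx my xy.
(* the finite family is completed by zero functions, to use the series *)
pose z i : R -> R := if insub i is Some j then y j else fun=> 0.
have mz i : measurable_fun I01 (z i) by rewrite /z; case: insubP.
have zE (i : 'I_n) : z i = y i by rewrite /z valK.
have tailz (f : (R -> R) -> \bar R) : (forall u, 0 <= f u)%E -> f (fun=> 0) = 0%E ->
    (\sum_(0 <= i <oo) f (z i) = \sum_(i < n) f (y i))%E.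
  move=> fp f0; rewrite (nneseries_split 0 n) ?add0n; last by move=> *; exact: fp.
  rewrite big_mkord [X in (_ + X)%E](_ : _ = 0%E) ?adde0.
    by apply: eq_bigr => i _; rewrite zE.
  apply: eseries0 => i ni _; rewrite /z insubN//; by rewrite -leqNgt.
have := @norm_le_series _ psi x z mx mz; rewrite (tailz N)//.
- apply => t It; rewrite (tailz (fun u => `|u t|%:E)).
  + by rewrite sumEFin lee_fin xy.
  + by move=> u; rewrite lee_fin.
  + by rewrite normr0.
- by move=> u; exact: norm_ge0.
- exact: norm0.
Qed.

Lemma norm_mono x y : measurable_fun I01 x -> measurable_fun I01 y ->
  (forall t, I01 t -> `|x t| <= `|y t|) -> (N x <= N y)%E.
Proof.
move=> mx my xy; have := @norm_le_sum x 1 (fun=> y) mx (fun=> my).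
by rewrite big_ord1; apply => t It; rewrite big_ord1 xy.
Qed.

Lemma norm_triangle x y z : measurable_fun I01 x -> measurable_fun I01 y ->
  measurable_fun I01 z -> (forall t, I01 t -> `|x t| <= `|y t| + `|z t|) ->
  (N x <= N y + N z)%E.
Proof.
move=> mx my mz xyz.
have := @norm_le_sum x 2 (fun i => if i == ord0 then y else z) mx.
rewrite big_ord_recl big_ord1; apply; first by move=> i; case: ifP.
by move=> t It; rewrite big_ord_recl big_ord1; exact: xyz.
Qed.

Lemma norm_scale x (c : R) : measurable_fun I01 x ->
  (N (fun t => (c * x t)%R) <= `|c|%:E * N x)%E.
Proof.
move=> mx.
have mcx : measurable_fun I01 (fun t => c * x t) by exact: measurable_funM.
have [->|c0] := eqVneq c 0.
  rewrite normr0 mul0e (_ : (fun _ => _) = fun=> 0) ?norm0//.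
  by apply/funext => t; rewrite mul0r.
have cp : 0 < `|c| by rewrite normr_gt0.
case xE : (N x) (norm_ge0 psi x) => [M| |] // M0; last first.
  by rewrite gt0_muley ?lte_fin// leey.
apply/lee_addgt0Pr => e e0.
have [d d0 de] := grid_step psi e0.
rewrite -EFinM -EFinD addrC -de; apply: norm_le_grid => // n.
apply: (@le_trans _ _ (`|c| * grid psi x (d / `|c|) n)); last first.
  by rewrite ler_wpM2l// -lee_fin -xE grid_le_norm// divr_ge0// ltW.
rewrite /grid mulrA [`|c| * _]mulrC divfK ?gt_eqF// ler_wpM2l ?(ltW d0)//.
apply: ler_sum => i _; rewrite le_eqVlt; apply/orP; left; apply/eqP; congr (psi _).
congr pr; apply/seteqP; split => t /=; rewrite normrM mulrAC ltr_pdivrMr//;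
  by rewrite [`|c| * _]mulrC.
Qed.

Lemma fsp_measurable x : function_space N x -> measurable_fun I01 x.
Proof. by case. Qed.

Lemma fsp_fin x : function_space N x -> N x \is a fin_num.
Proof. by case=> _ h; rewrite ge0_fin_numE// norm_ge0. Qed.

Lemma fsp_lin (a : R) x y : function_space N x -> function_space N y ->
  function_space N (fun t => a * x t + y t).
Proof.
move=> fx fy; have [mx my] := (fsp_measurable fx, fsp_measurable fy).
have max : measurable_fun I01 (fun t => a * x t) by exact: measurable_funM.
split; first exact: measurable_funD.
apply: (@le_lt_trans _ _ (N (fun t => (a * x t)%R) + N y)%E).
  apply: norm_triangle => //; first exact: measurable_funD.
  by move=> t _; exact: ler_normD.
rewrite lte_add_pinfty//; last by case: fy.
apply: le_lt_trans (norm_scale a mx) _.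
by rewrite -(fineK (fsp_fin fx)) -EFinM ltry.
Qed.

Lemma fsp_bounded x (c : R) : measurable_fun I01 x ->
  (forall t, I01 t -> `|x t| <= c) -> function_space N x.
Proof.
move=> mx xc; split => //; apply: (@le_lt_trans _ _ (N (fun=> c))).
  by apply: norm_mono => // t It; rewrite (le_trans (xc t It))// ler_norm.
by apply: le_lt_trans (norm_cst c) _; rewrite ltry.
Qed.

Lemma fsp0 : function_space N (fun=> 0).
Proof. by apply: (@fsp_bounded _ 0) => // t _; rewrite normr0. Qed.

Lemma fsp_sum n (x : 'I_n -> R -> R) : (forall i, function_space N (x i)) ->
  function_space N (fun t => \sum_(i < n) x i t).
Proof.
move=> fx; elim: n x fx => [|n IH] x fx.
  by under eq_fun do rewrite big_ord0; exact: fsp0.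
under eq_fun do rewrite big_ord_recl -[x _ _]mul1r.
by apply: fsp_lin => //; exact: IH.
Qed.

Lemma int_abs_le_norm x : measurable_fun I01 x ->
  (\int[m]_(t in I01) (`|x t|)%:E <= (psi 1)^-1%:E * N x)%E.
Proof.
move=> mx; have p1 := psi1_gt0 psi.
have mx' : measurable_fun I01 (fun t => `|x t|).
  exact: (measurable_abs mx).
rewrite muleC lee_pdivlMr// muleC -(int_scale (ltW p1) mx' (fun t => normr_ge0 (x t))).
apply: (@le_trans _ _ (\int[m]_(t in I01) (`|x t| * (psi 1))%:E)%E).
  by rewrite le_eqVlt; apply/orP; left; apply/eqP; apply: eq_integral => t _; rewrite mulrC.
apply: (@int_weight_le_norm _ psi x (fun=> psi 1)) => //; split => //.
  by move=> t; exact: ltW.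
move=> A mA; rewrite int_indicI ?(ltW p1)// lee_fin mulrC.
by apply: psi_ge_lin; exact: pr01.
Qed.

End norm_facts.

(** * Norming functionals and gliding humps *)

Section functionals.
Context {R : realType} (psi : Psi R).
Implicit Types (x y z h u : R -> R) (A : set R) (F : (R -> R) -> R).

Local Notation I01 := (`[0%R, 1%R]%classic : set R).
Local Notation m := (@lebesgue_measure R).
Local Notation N := (Lorentz_norm psi).

Definition linear_on F := forall (a : R) x y,
  function_space N x -> function_space N y ->
  F (fun t => a * x t + y t) = a * F x + F y.

Definition pairing h x : R := \int[m]_(t in I01) (x t * h t).

Lemma pairing_integrable h x : measurable_fun I01 h ->
  unit_weight psi (fun t => `|h t|) -> function_space N x ->
  m.-integrable I01 (EFin \o (fun t => x t * h t)).
Proof.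
move=> mh uh fx; have mx := fsp_measurable fx.
apply/integrableP; split.
  by apply/measurable_EFinP; exact: measurable_funM.
apply: (@le_lt_trans _ _ (N x)); last by case: fx.
apply: le_trans (int_weight_le_norm mx uh); rewrite le_eqVlt; apply/orP; left.
by apply/eqP; apply: eq_integral => t _ /=; rewrite normrM.
Qed.

Lemma pairing_abs_le h x : measurable_fun I01 h ->
  unit_weight psi (fun t => `|h t|) -> function_space N x ->
  (\int[m]_(t in I01) `|x t * h t| <= fine (N x)).
Proof.
move=> mh uh fx; have mx := fsp_measurable fx.
have hl := int_weight_le_norm mx uh.
apply: fine_le; [|exact: fsp_fin fx|].
  rewrite ge0_fin_numE; last by apply: integral_ge0 => t _; rewrite lee_fin.
  by have /integrableP[] := pairing_integrable mh uh fx.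
apply: le_trans hl; rewrite le_eqVlt; apply/orP; left.
by apply/eqP; apply: eq_integral => t _ /=; rewrite normrM.
Qed.

Lemma pairing_le h x : measurable_fun I01 h ->
  unit_weight psi (fun t => `|h t|) -> function_space N x ->
  `|pairing h x| <= fine (N x).
Proof.
move=> mh uh fx; apply: le_trans (pairing_abs_le mh uh fx).
by apply: le_normr_Rintegral; [exact: mI01|exact: pairing_integrable].
Qed.

Lemma pairing_linear h : measurable_fun I01 h ->
  unit_weight psi (fun t => `|h t|) -> linear_on (pairing h).
Proof.
move=> mh uh a x y fx fy; rewrite /pairing.
have ix := pairing_integrable mh uh fx; have iy := pairing_integrable mh uh fy.
transitivity (\int[m]_(t in I01) (a * (x t * h t) + y t * h t)).
  by apply: eq_Rintegral => t _; rewrite mulrDl mulrA.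
have iax : m.-integrable I01 (EFin \o (fun t => a * (x t * h t))).
  rewrite (_ : _ \o _ = (fun t => a%:E * (EFin \o (fun t => (x t * h t)%R)) t)%E).
    by apply: integrableZl => //; exact: mI01.
  by apply/funext => t /=; rewrite EFinM.
by rewrite RintegralD// RintegralZl.
Qed.

Lemma linear_on_sum F n (x : 'I_n -> R -> R) : linear_on F ->
  (forall i, function_space N (x i)) ->
  F (fun t => \sum_(i < n) x i t) = \sum_(i < n) F (x i).
Proof.
move=> lF; have F0 : F (fun=> 0) = 0.
  have := lF (-1) _ _ (fsp0 psi) (fsp0 psi).
  under eq_fun do rewrite mulr0 addr0.
  by rewrite mulN1r addNr.
elim: n x => [|n IH] x fx.
  by under eq_fun do rewrite big_ord0; rewrite F0 big_ord0.
under eq_fun do rewrite big_ord_recl -[x _ _]mul1r.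
by rewrite lF ?big_ord_recl ?mul1r ?IH//; exact: fsp_sum.
Qed.

(** A weight of the dual unit ball that detects the layers of |x| above the
    levels s i; the sign of x turns it into a functional. *)
Lemma level_functional x (s c : nat -> R) n : function_space N x ->
  {homo s : i j / (i <= j)%N >-> i <= j} -> (forall i, 0 <= c i) ->
  (forall v, 0 <= v -> \sum_(i < n) c i * (s i < v)%R%:R <= v) ->
  exists h, [/\ measurable_fun I01 h, unit_weight psi (fun t => `|h t|),
    exists b, forall t, `|h t| <= b,
    forall t, `|x t| <= s 0%N -> h t = 0 &
    \sum_(i < n) c i * psi (tail x (s i)) <= pairing h x].
Proof.
move=> fx hs c0 hc; have mx := fsp_measurable fx.
have [g [[mg g0 gA] [b gb] gs gE]] := @level_weight R psi x s n mx hs.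
pose D := [set t | 0 <= x t].
have mD : measurable (I01 `&` D).
  have := mx mI01 `[0, +oo[%classic (measurable_itv _).
  by congr (measurable (_ `&` _)); apply/seteqP; split => t /=;
    rewrite in_itv/= andbT.
pose h t := g t * (2 * \1_D t - 1).
have habs t : `|h t| = g t.
  rewrite /h normrM ger0_norm// indicE; case: (_ \in _) => /=.
    by rewrite mulr1 [2 - 1](_ : _ = 1) ?normr1 ?mulr1//; ring.
  by rewrite mulr0 sub0r normrN normr1 mulr1.
have xh t : x t * h t = `|x t| * g t.
  rewrite /h mulrCA mulrC; congr (_ * _); rewrite indicE.
  have [xt|xt] := leP 0 (x t).
    by rewrite mem_set//= mulr1 ger0_norm//; ring.
  rewrite memNset/=; last by rewrite /D/= leNgt xt.
  by rewrite mulr0 sub0r mulrN1 ltr0_norm.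
have mh : measurable_fun I01 h.
  apply: measurable_funM => //; apply: measurable_funB => //.
  by apply: measurable_funM => //; exact: measurable_indicI.
have uh : unit_weight psi (fun t => `|h t|) by rewrite (funext habs); split.
exists h; split => //.
- by exists b => t; rewrite habs.
- by move=> t xt; apply/eqP; rewrite -normr_eq0 habs gs.
have ip := pairing_integrable mh uh fx.
have fp := integrable_fin_num (mI01 : measurable (I01 : set (measurableTypeR R))) ip.
rewrite -lee_fin /pairing /Rintegral fineK; last exact: fp.
rewrite -sumEFin.
rewrite (eq_bigr (fun i : 'I_n => \int[m]_(t in I01)
  (c i * (g t * \1_[set t | s i < `|x t|] t))%:E)%E); last first.
  move=> i _; rewrite int_scale//; last 2 first.
  - by apply: measurable_funM => //; apply: measurable_indicI; exact: mtail.
  - by move=> t; rewrite mulr_ge0.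
  by rewrite gE// EFinM.
rewrite -(@ge0_integral_sum _ _ _ m _ mI01 _
   (fun (i : 'I_n) t => (c i * (g t * \1_[set t | s i < `|x t|] t))%:E)); last 2 first.
- move=> i; apply/measurable_EFinP/measurable_funM => //; apply: measurable_funM => //.
  by apply: measurable_indicI; exact: mtail.
- by move=> i t _; rewrite lee_fin !mulr_ge0.
apply: ge0_le_integral; first exact: mI01.
- by move=> t _; apply: sume_ge0 => i _; rewrite lee_fin !mulr_ge0.
- apply: emeasurable_sum => i.
  apply/measurable_EFinP/measurable_funM => //; apply: measurable_funM => //.
  by apply: measurable_indicI; exact: mtail.
- by apply/measurable_EFinP/measurable_funM.
move=> t It; rewrite sumEFin xh lee_fin.
rewrite (eq_bigr (fun i : 'I_n => g t * (c i * (s i < `|x t|)%R%:R))); last first.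
  by move=> i _; rewrite indicE mulrCA; congr (_ * (_ * _)); rewrite mem_setE.
by rewrite -mulr_sumr mulrC ler_wpM2r// hc.
Qed.

(** For a fine grid, the grid sum is close to the norm, and by level_functional
    it is attained by a functional of the unit ball. *)
Lemma norming_functional x (a : R) : function_space N x -> a < fine (N x) ->
  exists h, [/\ measurable_fun I01 h, unit_weight psi (fun t => `|h t|) &
    a < pairing h x].
Proof.
move=> fx ax; have mx := fsp_measurable fx.
pose e := (fine (N x) - a) / 2.
have e0 : 0 < e by rewrite divr_gt0// subr_gt0.
have [d d0 de] := grid_step psi e0.
have [n an] : exists n, a < grid psi x d n.
  apply: contrapT => no.
  have := @norm_le_grid _ psi x d a mx d0.
  have -> : d * psi 1 + a = fine (N x) - e by rewrite de /e; lra.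
  rewrite -(fineK (fsp_fin fx)) lee_fin => h.
  have : fine (N x) <= fine (N x) - e.
    by apply: h => n; rewrite leNgt; apply/negP => ?; apply: no; exists n.
  by rewrite lerBrDl gerDr leNgt e0.
have [| | |h [mh uh _ _ hx]] := @level_functional x (fun i => d * i.+1%:R) (fun=> d) n fx.
- by move=> i j ij; rewrite ler_wpM2l ?(ltW d0)// ler_nat.
- by move=> _; exact: ltW.
- by move=> v v0; exact: indic_grid_le.
exists h; split; [exact: mh|exact: uh|].
by apply: lt_le_trans an _; rewrite /grid mulr_sumr.
Qed.

Section signed_series.
Variables (x : nat -> R -> R) (F : nat -> (R -> R) -> R) (n : nat -> nat).

Fixpoint signed_sum j : (R -> R) -> R :=
  if j is i.+1 then fun u => signed_sum i u +
    (if 0 <= signed_sum i (x (n i)) then 1 else -1) * F i u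
  else fun=> 0.

(** Gliding hump: the signs are chosen so that the j-th functional can only
    increase the absolute value taken at x (n j) by the first ones; those of
    index greater than j are too small there to undo it. *)
Lemma gliding_hump (C eps : R) : (forall j, linear_on (F j)) ->
  (forall u J, function_space N u -> \sum_(j < J) `|F j u| <= C * fine (N u)) ->
  (forall j, (j <= n j)%N) -> 0 < eps ->
  (forall j J, \sum_(j.+1 <= i < J) `|F i (x (n j))| + eps <= F j (x (n j))) ->
  ~ weakly_null N x.
Proof.
move=> lF FC nj eps0 Feps [fx wx].
pose a i : R := if 0 <= signed_sum i (x (n i)) then 1 else -1.
have a1 i : `|a i| = 1 by rewrite /a; case: ifP; rewrite ?normrN normr1.
have sE u J : signed_sum J u = series (fun i => a i * F i u) J.
  rewrite /series/=; elim: J => [|J IH]; first by rewrite big_nil.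
  by rewrite big_nat_recr//= -IH.
pose G u := limn (series (fun i => a i * F i u)).
have cG u : function_space N u -> cvgn (series (fun i => a i * F i u)).
  move=> fu; apply: normed_cvg; apply: nondecreasing_is_cvgn.
    apply: nondecreasing_series => i _ _; exact: normr_ge0.
  exists (C * fine (N u)) => _ [J _ <-]; apply: le_trans (FC u J fu).
  change (\sum_(0 <= i < J) `|a i * F i u| <= \sum_(i < J) `|F i u|).
  rewrite big_mkord le_eqVlt; apply/orP; left; apply/eqP.
  by apply: eq_bigr => i _; rewrite normrM a1 mul1r.
have cG' u (fu : function_space N u) :
  series (fun i => a i * F i u) @ \oo --> G u := cG u fu.
have lG : bounded_linear_functional N G.
  split.
    move=> b u v fu fv.
    have fuv := fsp_lin b fu fv.
    apply: cvg_lim => //.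
    rewrite (_ : series _ = (fun J => b * series (fun i => a i * F i u) J +
      series (fun i => a i * F i v) J)).
      by apply: cvgD; [apply: cvgMr; exact: cG'|exact: cG'].
    apply/funext => J; rewrite /series/= mulr_sumr -big_split/=.
    by apply: eq_bigr => i _; rewrite lF//; ring.
  exists C => u fu; rewrite -(fineK (fsp_fin fu)) -EFinM lee_fin.
  have hn : `|series (fun i => a i * F i u) J| @[J --> \oo] --> `|G u|.
    by apply: cvg_norm; exact: cG'.
  apply: (cvgr_to_le hn); apply: nearW => J.
  apply: le_trans (FC u J fu); rewrite /series/= big_mkord.
  apply: le_trans (ler_norm_sum _ _ _) _.
  by apply: ler_sum => i _; rewrite normrM a1 mul1r.
have Geps j : eps <= `|G (x (n j))|.
  have hn : `|series (fun i => a i * F i (x (n j))) J| @[J --> \oo] -->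
      `|G (x (n j))|.
    by apply: cvg_norm; exact: cG'.
  apply: (cvgr_to_ge hn).
  exists j.+1 => // J /= jJ.
  rewrite /series/= (@big_cat_nat _ _ _ j.+1)//=.
  set S1 := \sum_(0 <= i < j.+1) _; set S2 := \sum_(j.+1 <= i < J) _.
  have h2 : `|S2| <= \sum_(j.+1 <= i < J) `|F i (x (n j))|.
    apply: le_trans (ler_norm_sum _ _ _) _.
    by apply: ler_sum => i _; rewrite normrM a1 mul1r.
  have h1 : F j (x (n j)) <= `|S1|.
    rewrite /S1 big_nat_recr//=.
    have := sE (x (n j)) j; rewrite /series/= => <-.
    rewrite /a; case: ifPn => [h|].
      by rewrite mul1r (le_trans _ (ler_norm _))// lerDr.
    rewrite -ltNge => h; rewrite mulN1r -normrN opprB (le_trans _ (ler_norm _))//.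
    by rewrite lerDl oppr_ge0 ltW.
  have h3 := Feps j J.
  have : `|S1| - `|S2| <= `|S1 + S2|.
    by have := lerB_normD S1 S2.
  by apply: le_trans; lra.
have := wx G lG => /cvgrPdist_lt/(_ _ eps0)[M _ /(_ (n M))].
rewrite /= sub0r normrN => /(_ (nj M)).
by rewrite ltNge Geps.
Qed.

End signed_series.

End functionals.

(** * Weakly null sequences are bounded *)

Section boundedness.
Context {R : realType} (psi : Psi R).
Implicit Types (x y : nat -> R -> R).

Local Notation I01 := (`[0%R, 1%R]%classic : set R).
Local Notation m := (@lebesgue_measure R).
Local Notation N := (Lorentz_norm psi).

(* c = 3 ^ j, v is the norm of the j-th term, w the value of the j-th
   functional on it before scaling; the later functionals add up to at most
   q * v / 2. *)
Let hump_arith (q c v w : R) : 0 < q -> q * c = 1 -> 4 * c < v -> 3 / 4 * v < w ->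
  2^-1 * q * v + 1 <= q * w.
Proof.
move=> q0 qc cv vw.
have : q * (4 * c) <= q * v by rewrite ler_wpM2l ?(ltW q0)// ltW.
have : q * (3 / 4 * v) <= q * w by rewrite ler_wpM2l ?(ltW q0)// ltW.
rewrite [q * (4 * c)]mulrCA qc; lra.
Qed.

(** If the norms were unbounded, there would be a subsequence with norms above
    4 * 3 ^ j; functionals of norm at most 3 ^ - j, almost norming its terms,
    would then form a gliding hump. *)
Lemma weakly_null_bounded x : weakly_null N x ->
  exists M : R, forall n, fine (N (x n)) <= M.
Proof.
move=> wx; have [fx _] := wx; apply: contrapT => nb.
have big (M : R) k : exists n, (k <= n)%N /\ M < fine (N (x n)).
  apply: contrapT => no; apply: nb.
  (* a bound valid from the index k on gives one for the whole sequence *)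
  exists (Num.max M (\sum_(i < k) fine (N (x i)))) => n; rewrite le_max.
  have [kn|nk] := leqP k n.
    by rewrite leNgt; apply/orP; left; apply/negP => ?; apply: no; exists n.
  apply/orP; right; rewrite (bigD1 (Ordinal nk))//= lerDl sumr_ge0// => i _.
  by apply: fine_ge0; exact: norm_ge0.
have /choice[n nP] : forall j, exists n, (j <= n)%N /\ 4 * 3 ^+ j < fine (N (x n)).
  by move=> j; exact: big.
have /choice[h hP] : forall j, exists h : R -> R, [/\ measurable_fun I01 h,
    unit_weight psi (fun t => `|h t|) &
    3 / 4 * fine (N (x (n j))) < pairing h (x (n j))].
  move=> j; have Np : 0 < fine (N (x (n j))).
    have [_] := nP j; apply: le_lt_trans.
    by rewrite mulr_ge0// exprn_ge0.
  apply: norming_functional; [exact: fx|].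
  by rewrite gtr_pMl// ltr_pdivrMr// mul1r ltr_nat.
refine (@gliding_hump R psi x (fun j u => 3^-1 ^+ j * pairing (h j) u) n
  (3 / 2) 1 _ _ _ ltr01 _ wx).
- move=> j a u v fu fv; have [mh uh _] := hP j.
  by rewrite (pairing_linear mh uh)//; ring.
- move=> u J fu.
  apply: (@le_trans _ _ (\sum_(j < J) (3^-1 ^+ j) * fine (N u))).
    apply: ler_sum => j _; have [mh uh _] := hP j.
    have q0 : 0 <= (3^-1 : R) ^+ j by rewrite exprn_ge0// invr_ge0.
    by rewrite normrM (ger0_norm q0); apply: ler_wpM2l; [exact: q0|exact: pairing_le].
  rewrite -mulr_suml ler_wpM2r//; first by apply: fine_ge0; exact: norm_ge0.
  by rewrite -(big_mkord xpredT (fun i => 3^-1 ^+ i)) (le_trans (geo3_le 0 J))// expr0 mulr1.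
- by move=> j; case: (nP j).
- move=> j J; have [_ nj] := nP j; have [_ _ hj] := hP j.
  set v := fine (N (x (n j))) in nj hj *.
  have v0 : 0 <= v by apply: fine_ge0; exact: norm_ge0.
  apply: (@le_trans _ _ (\sum_(j.+1 <= i < J) 3^-1 ^+ i * v + 1)).
    rewrite lerD2r; apply: ler_sum => i _; have [mh uh _] := hP i.
    have q0 : 0 <= (3^-1 : R) ^+ i by rewrite exprn_ge0// invr_ge0.
    by rewrite normrM (ger0_norm q0); apply: ler_wpM2l; [exact: q0|exact: pairing_le].
  rewrite -mulr_suml.
  have q0 : 0 < (3^-1 : R) ^+ j by rewrite exprn_gt0// invr_gt0.
  apply: (@le_trans _ _ (2^-1 * 3^-1 ^+ j * v + 1)).
    rewrite lerD2r ler_wpM2r//; apply: le_trans (geo3_le j.+1 J) _.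
    by rewrite exprS mulrA ler_wpM2r ?(ltW q0)//; lra.
  apply: (hump_arith q0 _ nj hj).
  by rewrite -exprMn mulVf// expr1n.
Qed.

Lemma powR_BS (p : R) (j : nat) (c : R) : (0 < j)%N ->
  j%:R `^ (- p^-1) * (c * j%:R `^ (p^-1)) = c.
Proof.
move=> j0; have j0' : (j%:R : R) `^ (p^-1) > 0 by rewrite powR_gt0// ltr0n.
by rewrite powRN mulrCA mulVf ?mulr1// gt_eqF.
Qed.

Lemma BS_of_bound (p C M : R) x : (forall n, function_space N (x n)) ->
  (forall n, fine (N (x n)) <= M) ->
  (forall f : nat -> nat, {homo f : i j / (i < j)%N} -> forall j, (0 < j)%N ->
    (N (fun t => (\sum_(k < j) x (f k) t)%R) <= (C * j%:R `^ (p^-1))%:E)%E) ->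
  BS_sequence N p x.
Proof.
move=> fx Mx Cx; split.
  split => //; apply: (@le_lt_trans _ _ M%:E); last exact: ltry.
  apply: ge_ereal_sup => _ [n _ <-] /=.
  by rewrite -(fineK (fsp_fin (fx n))) lee_fin.
move=> y [f hf ->]; apply: (@le_lt_trans _ _ C%:E); last exact: ltry.
apply: ge_ereal_sup => _ [j /= j0 <-].
rewrite -[leRHS](congr1 EFin (powR_BS p C j0)) EFinM.
apply: lee_wpmul2l; first by rewrite lee_fin powR_ge0.
exact: Cx.
Qed.

Lemma Gamma_i_1 : Gamma_i N 1.
Proof.
split => // x wx _; have [M xM] := weakly_null_bounded wx.
have [fx _] := wx.
exists x; first by exists id.
apply: (@BS_of_bound 1 M M) => // f _ j j0.
rewrite invr1 powRr1//.
have fxf (k : 'I_j) : function_space N (x (f k)) by [].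
apply: (@le_trans _ _ (\sum_(k < j) N (x (f k)))%E).
  apply: norm_le_sum; first exact: (fsp_measurable (fsp_sum fxf)).
    by move=> k; exact: (fsp_measurable (fxf k)).
  by move=> t _; exact: ler_norm_sum.
apply: (@le_trans _ _ (\sum_(k < j) M%:E)%E).
  by apply: lee_sum => k _; rewrite -(fineK (fsp_fin (fx _))) lee_fin.
by rewrite sumEFin lee_fin sumr_const card_ord mulr_natr.
Qed.

End boundedness.

(** * Independent events and exponential moments *)

Section independent_events.
Context {R : realType}.
Implicit Types (A : nat -> set R).

Local Notation I01 := (`[0%R, 1%R]%classic : set R).
Local Notation m := (@lebesgue_measure R).

Definition independent_events A := (forall i, measurable (I01 `&` A i)) /\
  forall s : seq nat, uniq s ->
    pr (\bigcap_(i in [set` s]) A i) = \prod_(i <- s) pr (A i).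

Definition hits A (j : nat) (t : R) : R := \sum_(k < j) \1_(A k) t.

Lemma independent_events_sub A (f : nat -> nat) : injective f ->
  independent_events A -> independent_events (A \o f).
Proof.
move=> fi [mA iA]; split => [i|s us]; first exact: mA.
have := iA (map f s); rewrite map_inj_uniq// big_map => <-//.
congr pr; apply/seteqP; split => t /= h i.
  by move=> /mapP[k ks ie]; rewrite ie; exact: h.
by move=> is_; apply: h; exact: map_f.
Qed.

Lemma bounded_integrable (f : R -> R) (b : R) : measurable_fun I01 f ->
  (forall t, `|f t| <= b) -> m.-integrable I01 (EFin \o f).
Proof.
move=> mf fb; apply/integrableP; split; first exact/measurable_EFinP.
apply: (@le_lt_trans _ _ (b%:E * m I01)%E).
  apply: integral_le_bound => //.
  - exact/measurable_EFinP.
  - by rewrite lee_fin (le_trans _ (fb 0)).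
  - by apply/aeW => t _; rewrite /= lee_fin.
by rewrite measure_I01 mule1 ltry.
Qed.

Lemma Rint_indic (B : set R) : measurable (I01 `&` B) ->
  \int[m]_(t in I01) (\1_B t : R) = pr B.
Proof.
move=> mB; transitivity (fine (1 * pr B)%:E); last by rewrite /= mul1r.
rewrite -(int_indicI ler01 mB); congr fine.
by apply: eq_integral => t _; rewrite mul1r.
Qed.

Lemma measurable_prod_fun (s : seq nat) (f : nat -> R -> R) :
  (forall i, measurable_fun I01 (f i)) ->
  measurable_fun I01 (fun t => \prod_(i <- s) f i t).
Proof.
move=> mf; elim: s => [|c s IH].
  by apply: (@eq_measurable_fun _ _ _ _ _ (fun=> 1 : R)) => [t _|]; rewrite ?big_nil.
apply: (@eq_measurable_fun _ _ _ _ _ (fun t => f c t * \prod_(i <- s) f i t)) => [t _|].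
  by rewrite big_cons.
exact: measurable_funM.
Qed.

Lemma measurable_sum_fun n (f : 'I_n -> R -> R) :
  (forall i, measurable_fun I01 (f i)) ->
  measurable_fun I01 (fun t => \sum_(i < n) f i t).
Proof.
move=> mf; elim: n f mf => [|n IH] f mf.
  by apply: (@eq_measurable_fun _ _ _ _ _ (fun=> 0 : R)) => [t _|]; rewrite ?big_ord0.
apply: (@eq_measurable_fun _ _ _ _ _ (fun t => f ord0 t + \sum_(i < n) f (lift ord0 i) t)).
  by move=> t _; rewrite big_ord_recl.
by apply: measurable_funD => //; exact: (IH (fun i => f (lift ord0 i))).
Qed.

Lemma prod_bounded (s : seq nat) (f : nat -> R -> R) (b : R) : 1 <= b ->
  (forall i t, `|f i t| <= b) -> forall t,
  `|\prod_(i <- s) f i t| <= b ^+ size s.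
Proof.
move=> b1 fb t; elim: s => [|a s IH]; first by rewrite big_nil normr1 expr0.
rewrite big_cons normrM exprS ler_pM//.
Qed.

(** The expectation of a product over independent events, expanded one factor
    at a time; the second list collects the indicators already split off. *)
Lemma expectation_prod A (g : R) (s r : seq nat) : independent_events A ->
  uniq (s ++ r) ->
  \int[m]_(t in I01) ((\prod_(i <- s) (1 + g * \1_(A i) t)) *
                      \prod_(i <- r) (\1_(A i) t : R)) =
  (\prod_(i <- s) (1 + g * pr (A i))) * \prod_(i <- r) pr (A i).
Proof.
move=> [mA iA]; elim: s r => [|a s IH] r.
  rewrite cat0s => ur; rewrite big_nil mul1r -iA//.
  have mB : measurable (I01 `&` \bigcap_(i in [set` r]) A i).
    case: r ur => [|a r] ur.
      by rewrite set_nil bigcap_set0 setIT; exact: mI01.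
    have ne : [set` a :: r] !=set0 by exists a; rewrite /= mem_head.
    rewrite -bigcapIr//.
    by apply: bigcap_measurable => // i _; exact: mA.
  rewrite -Rint_indic//; apply: eq_Rintegral => t _.
  rewrite big_nil mul1r; elim: r {ur mB} => [|a r IH].
    by rewrite big_nil set_nil bigcap_set0 indicT.
  have -> : [set` a :: r] = a |` [set` r].
    apply/seteqP; split => i /=; rewrite inE.
      by case/orP => [/eqP|]; [left|right].
    by case=> [->|->]; rewrite ?eqxx ?orbT.
  by rewrite big_cons IH bigcap_setU1 indicI.
move=> uasr; rewrite !big_cons.
have /= /andP[anin usr] := uasr.
have usar : uniq (s ++ a :: r) by rewrite -[a :: r]cat1s uniq_catCA.
have mf i : measurable_fun I01 (fun t => 1 + g * \1_(A i) t : R).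
  apply: measurable_funD => //; apply: measurable_funM => //.
  exact: measurable_indicI.
have mf' i : measurable_fun I01 (\1_(A i) : R -> R) by exact: measurable_indicI.
have fb i t : `|1 + g * \1_(A i) t| <= 1 + `|g|.
  apply: le_trans (ler_normD _ _) _; rewrite normr1 lerD2l normrM ler_piMr//.
  by rewrite indicE; case: (_ \in _); rewrite ?normr1 ?normr0.
have fb' i t : `|\1_(A i) t : R| <= 1 + `|g|.
  by rewrite indicE; case: (_ \in _); rewrite ?normr1 ?normr0 ?lerDl ?addr_ge0.
have g1 : 1 <= 1 + `|g| by rewrite lerDl.
have int_prod s' r' : m.-integrable I01 (EFin \o (fun t =>
    (\prod_(i <- s') (1 + g * \1_(A i) t)) * \prod_(i <- r') (\1_(A i) t : R))).
  apply: (@bounded_integrable _ ((1 + `|g|) ^+ size s' * (1 + `|g|) ^+ size r')).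
    by apply: measurable_funM; exact: measurable_prod_fun.
  move=> t; rewrite normrM; apply: ler_pM => //.
    exact: (@prod_bounded s' (fun i t => 1 + g * \1_(A i) t)).
  exact: (@prod_bounded r' (fun i t => \1_(A i) t)).
transitivity (\int[m]_(t in I01) (
   (\prod_(i <- s) (1 + g * \1_(A i) t)) * \prod_(i <- r) (\1_(A i) t : R) +
   g * ((\prod_(i <- s) (1 + g * \1_(A i) t)) * \prod_(i <- a :: r) (\1_(A i) t : R)))).
  by apply: eq_Rintegral => t _; rewrite !big_cons; ring.
have ig : m.-integrable I01 (EFin \o (fun t =>
    g * ((\prod_(i <- s) (1 + g * \1_(A i) t)) * \prod_(i <- a :: r) (\1_(A i) t : R)))).
  rewrite (_ : _ \o _ = (fun t => g%:E * (EFin \o (fun t => ((\prod_(i <- s) (1 + g * \1_(A i) t)) * \prod_(i <- a :: r) (\1_(A i) t : R))%R)) t)%E).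
    by apply: integrableZl => //; exact: mI01.
  by apply/funext => t /=; rewrite EFinM.
rewrite RintegralD// RintegralZl// IH// IH// big_cons; ring.
Qed.

Lemma prod_iota (f : nat -> R) j :
  \prod_(i <- iota 0 j) f i = \prod_(i < j) f i.
Proof. by rewrite -(big_mkord xpredT f) /index_iota subn0. Qed.

(** As hits A j is a sum of indicators, exp (la * hits) is the product of the
    1 + (exp la - 1) * 1_(A k). *)
Lemma expectation_exp_hits A (la : R) j : independent_events A ->
  \int[m]_(t in I01) expR (la * hits A j t) =
  \prod_(k < j) (1 + (expR la - 1) * pr (A k)).
Proof.
move=> iA.
have := @expectation_prod A (expR la - 1) (iota 0 j) [::] iA.
rewrite cats0 iota_uniq => /(_ isT).
rewrite big_nil mulr1 prod_iota => <-.
apply: eq_Rintegral => t _; rewrite big_nil mulr1 /hits mulr_sumr expR_sum.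
rewrite prod_iota; apply: eq_bigr => i _.
by rewrite indicE; case: (_ \in _); rewrite ?mulr1 ?mulr0 ?expR0 ?addr0// addrC subrK.
Qed.

Lemma hits_measurable A j : (forall i, measurable (I01 `&` A i)) ->
  measurable_fun I01 (hits A j).
Proof.
by move=> mA; apply: measurable_sum_fun => i; exact: measurable_indicI.
Qed.

Lemma mlevel (f : R -> R) (s : R) : measurable_fun I01 f ->
  measurable (I01 `&` [set t | s <= f t]).
Proof.
move=> mf; have := mf mI01 `[s, +oo[%classic (measurable_itv _).
by congr (measurable (_ `&` _)); apply/seteqP; split => t /=;
  rewrite in_itv/= andbT.
Qed.

Lemma hits_ge0 A j t : 0 <= hits A j t.
Proof. by apply: sumr_ge0 => i _; rewrite indicE. Qed.

Lemma hits_le A j t : hits A j t <= j%:R.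
Proof.
rewrite -[j in leRHS]card_ord -sum1_card natr_sum; apply: ler_sum => i _.
by rewrite indicE; case: (_ \in _).
Qed.

Lemma sum_pr_le A j : (forall i, measurable (I01 `&` A i)) ->
  \sum_(k < j) pr (A k) <= j%:R.
Proof.
move=> mA; rewrite -[j in leRHS]card_ord -sum1_card natr_sum.
by apply: ler_sum => i _; exact: pr_le1.
Qed.

(** Markov's inequality for exp (la * hits); la may be negative. *)
Lemma markov_exp A (la s : R) j : independent_events A ->
  pr [set t | s <= la * hits A j t] <=
  expR (- s) * \prod_(k < j) (1 + (expR la - 1) * pr (A k)).
Proof.
move=> iA; have [mA _] := iA; rewrite -expectation_exp_hits//.
have mc : measurable_fun I01 (fun t => la * hits A j t).
  by apply: measurable_funM => //; exact: hits_measurable.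
have mB := mlevel s mc; set B : set R := [set t | s <= la * hits A j t] in mB *.
rewrite expRN ler_pdivlMl ?expR_gt0//.
rewrite -Rint_indic// -RintegralZl//; last first.
  apply: (@bounded_integrable _ 1); first exact: measurable_indicI.
  by move=> t; rewrite indicE; case: (_ \in _); rewrite ?normr1 ?normr0.
apply: le_Rintegral => //.
- apply: (@bounded_integrable _ (expR s)).
    by apply: measurable_funM => //; exact: measurable_indicI.
  move=> t; rewrite normrM ger0_norm ?expR_ge0// ler_piMr ?expR_ge0//.
  by rewrite indicE; case: (_ \in _); rewrite ?normr1 ?normr0.
- apply: (@bounded_integrable _ (expR (`|la| * j%:R))).
    by apply: measurableT_comp => //; exact: measurable_expR.
  move=> t; rewrite ger0_norm ?expR_ge0// ler_expR.
  apply: le_trans (ler_norm _) _; rewrite normrM ler_wpM2l//.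
  by rewrite ger0_norm ?hits_ge0// hits_le.
- move=> t _; rewrite indicE; case: (boolP (t \in B)) => [|_].
    by rewrite inE mulr1 ler_expR.
  by rewrite mulr0 expR_ge0.
Qed.

(** From 1 - x <= exp (- x); at the optimal parameter this costs only a factor
    in the exponent of Chernoff's bound. *)
Lemma expR_quad (x : R) : x <= 1 / 2 -> expR x <= 1 + x + 2 * x ^+ 2.
Proof.
move=> x2; have h := expR_ge1Dx (- x).
have x1 : 0 < 1 - x by lra.
have : expR x <= (1 - x)^-1.
  by rewrite -[x in leLHS]opprK expRN lef_pV2// posrE ?expR_gt0.
move=> /le_trans; apply; rewrite -[leLHS]mul1r ler_pdivrMr//; nra.
Qed.

(** Chernoff's bound for the centred sum of indicators, of the strength given by
    expR_quad on the range |la| <= 1/2. *)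
Lemma centred_hits_tail A (a J : R) j : independent_events A ->
  (j%:R <= J) -> 0 < J -> 0 <= a <= 2 * J ->
  pr [set t | a <= `|hits A j t - \sum_(k < j) pr (A k)|] <=
  2 * expR (- (a ^+ 2 / (8 * J))).
Proof.
move=> iA jJ J0 /andP[a0 a2]; have [mA _] := iA.
set M := \sum_(k < j) pr (A k).
have MJ : M <= J by apply: le_trans jJ; exact: sum_pr_le.
have M0 : 0 <= M by apply: sumr_ge0 => i _; exact: pr_ge0.
(* this la minimizes 2 la ^ 2 J - la a, the exponent obtained below *)
pose la := a / (4 * J).
have la2 : la <= 1 / 2 by rewrite ler_pdivrMr ?mulr_gt0//; lra.
have la0 : 0 <= la by rewrite divr_ge0// mulr_ge0// ltW.
have mc : measurable_fun I01 (hits A j) by exact: hits_measurable.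
have key (mu : R) : mu ^+ 2 = la ^+ 2 -> mu <= 1 / 2 ->
    pr [set t | la * a + mu * M <= mu * hits A j t] <= expR (- (a ^+ 2 / (8 * J))).
  move=> mu2 muh; apply: le_trans (markov_exp _ _ _ iA) _.
  apply: (@le_trans _ _ (expR (- (la * a + mu * M)) * expR ((mu + 2 * la ^+ 2) * M))).
    rewrite ler_wpM2l ?expR_ge0// /M mulr_sumr expR_sum.
    apply: ler_prod => i _; apply/andP; split.
      have := pr01 (mA i); have := expR_gt0 mu; nra.
    apply: le_trans (expR_ge1Dx _); rewrite lerD2l ler_wpM2r ?pr_ge0//.
    by rewrite lerBlDl -mu2 addrA expR_quad.
  rewrite -expRD ler_expR.
  have -> : - (la * a + mu * M) + (mu + 2 * la ^+ 2) * M = 2 * la ^+ 2 * M - la * a.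
    by ring.
  apply: (@le_trans _ _ (2 * la ^+ 2 * J - la * a)).
    by rewrite lerD2r ler_wpM2l// mulr_ge0// sqr_ge0.
  rewrite le_eqVlt; apply/orP; left; apply/eqP; rewrite /la.
  by field; rewrite gt_eqF.
have ml mu : measurable (I01 `&` [set t | la * a + mu * M <= mu * hits A j t]).
  by apply: mlevel; exact: measurable_funM.
apply: (@le_trans _ _ (pr ([set t | la * a + la * M <= la * hits A j t] `|`
   [set t | la * a + (- la) * M <= (- la) * hits A j t]))).
  apply: le_pr.
  - apply: mlevel; apply: (measurableT_comp (@normr_measurable R setT)).
    exact: measurable_funB.
  - by rewrite setIUr; exact: measurableU.
  move=> t [It /= h]; split => //=.
  have [c0|c0] := leP 0 (hits A j t - M).
    left; rewrite -mulrDr ler_wpM2l//.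
    by move: h; rewrite ger0_norm//; lra.
  right; rewrite !mulNr lerBlDr addrC lerBrDr -mulrDr ler_wpM2l//.
  by move: h; rewrite ltr0_norm//; lra.
have hU (B C : set R) : measurable (I01 `&` B) -> measurable (I01 `&` C) ->
    pr (B `|` C) <= pr B + pr C.
  move=> mB mC; rewrite -lee_fin EFinD !prE//.
    by rewrite setIUr; exact: measureU2.
  by rewrite setIUr; exact: measurableU.
apply: le_trans (hU _ _ (ml _) (ml _)) _.
by rewrite mulr_natl mulr2n lerD// key// ?sqrrN//; lra.
Qed.

End independent_events.

(** * Independence of the digits in a mixed radix expansion *)

Section digits.
Context {R : realType}.
Local Notation I01 := (`[0%R, 1%R]%classic : set R).
Local Notation m := (@lebesgue_measure R).

Lemma truncn_divn (r : nat) (z : R) : (0 < r)%N -> 0 <= z ->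
  (Num.truncn (r%:R * z) %/ r)%N = Num.truncn z.
Proof.
move=> r0 z0; have rp : 0 < (r%:R : R) by rewrite ltr0n.
have rz0 : 0 <= r%:R * z by rewrite mulr_ge0// ltW.
apply/esym/truncn_def; have /andP[h1 h2] := truncn_itv rz0.
set k := Num.truncn _ in h1 h2 *; apply/andP; split.
  rewrite -(ler_pM2l rp) (le_trans _ h1)// -natrM ler_nat mulnC.
  exact: leq_divM.
rewrite -(ltr_pM2l rp) (lt_le_trans h2)// -natrM ler_nat mulnC.
exact: ltn_ceil.
Qed.

Lemma sum_divn_modn (f g : nat -> nat) (Q r : nat) : (0 < r)%N ->
  (\sum_(0 <= c < Q * r) f (c %/ r) * g (c %% r) =
   (\sum_(0 <= c < Q) f c) * \sum_(0 <= d < r) g d)%N.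
Proof.
move=> r0; elim: Q => [|Q IH]; first by rewrite mul0n big_geq// [in RHS]big_geq.
rewrite mulSnr (@big_cat_nat _ _ _ (Q * r))//=; last exact: leq_addr.
rewrite IH [in RHS]big_nat_recr//= mulnDl; congr addn.
rewrite -{1}[(Q * r)%N]add0n big_addn addKn big_distrr/=.
apply: eq_big_nat => d /andP[_ dr].
by rewrite addnC divnMDl// divn_small// addn0 modnMDl modn_small.
Qed.

(* The interval [0, 1[ is divided into Q cells of equal length; D selects some
   of them, and K is the variable of an induction over the cells. *)
Let partial_cells (D : pred nat) (Q K : nat) : set R :=
  [set t | [/\ 0 <= t, t < K%:R / Q%:R & D (Num.truncn (Q%:R * t))]].

Let partial_cells_pr D Q K : (0 < Q)%N -> (K <= Q)%N ->
  measurable (I01 `&` partial_cells D Q K) /\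
  pr (partial_cells D Q K) = (\sum_(0 <= c < K) D c)%N%:R / Q%:R.
Proof.
move=> Q0; have Qp : 0 < (Q%:R : R) by rewrite ltr0n.
elim: K => [|K IH] KQ.
  rewrite big_geq// mul0r (_ : partial_cells _ _ _ = set0) ?setI0 ?pr0//.
  apply/seteqP; split => t //= -[t0 t1 _].
  by move: t1; rewrite mul0r ltNge t0.
have [mK prK] := IH (ltnW KQ).
pose E : set R := if D K then `[K%:R / Q%:R, K.+1%:R / Q%:R[%classic else set0.
have EI : E `<=` I01.
  rewrite /E; case: ifPn => _; last exact: sub0set.
  move=> t /=; rewrite !in_itv/= => /andP[tK tK1].
  rewrite (le_trans _ tK) ?divr_ge0 ?ler0n//= (le_trans (ltW tK1))//.
  by rewrite ler_pdivrMr// mul1r ler_nat.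
have mE : measurable (I01 `&` E).
  rewrite (setIidr EI) /E; case: ifPn => _ //.
have trE (t : R) : (t \in `[K%:R / Q%:R, K.+1%:R / Q%:R[) -> Num.truncn (Q%:R * t) = K.
  rewrite in_itv/= => /andP[tK tK1]; apply: truncn_def.
  rewrite [Q%:R * t]mulrC.
  by rewrite -ler_pdivrMr// -ltr_pdivlMr// tK.
have EQ : partial_cells D Q K.+1 = partial_cells D Q K `|` E.
  apply/seteqP; split => t /=.
    move=> [t0 t1 Dt]; have [tK|tK] := ltP t (K%:R / Q%:R); first by left.
    have tI : t \in `[K%:R / Q%:R, K.+1%:R / Q%:R[ by rewrite in_itv/= tK.
    by right; rewrite /E; move: Dt; rewrite trE// => ->.
  case=> [[t0 t1 Dt]|].
    by split => //; apply: (lt_trans t1); rewrite ltr_pM2r ?invr_gt0// ltr_nat.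
  rewrite /E; case: ifPn => // DK /= tI; split; last by rewrite trE.
    by move: tI; rewrite in_itv/= => /andP[+ _]; apply: le_trans; rewrite divr_ge0.
  by move: tI; rewrite in_itv/= => /andP[].
rewrite EQ; split; first by rewrite setIUr; exact: measurableU.
rewrite prU//; last first.
  apply/seteqP; split => t //= -[[_ t1 _]]; rewrite /E; case: ifPn => // _ /=.
  by rewrite in_itv/= leNgt t1.
rewrite prK big_nat_recr//= natrD mulrDl; congr (_ + _).
rewrite /pr (setIidr EI) /E; case: ifPn => _; last by rewrite measure0 mul0r.
rewrite lebesgue_measure_itv/= lte_fin ltr_pM2r ?invr_gt0// ltr_nat ltnS leqnn.
by rewrite -EFinB/= -mulrBl -natr1 addrAC subrr add0r.
Qed.

Lemma cells_pr (D : pred nat) (Q : nat) : (0 < Q)%N ->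
  let G := [set t : R | D (Num.truncn (Q%:R * t))] in
  measurable (I01 `&` G) /\ pr G = (\sum_(0 <= c < Q) D c)%N%:R / Q%:R.
Proof.
move=> Q0 G; have Qp : 0 < (Q%:R : R) by rewrite ltr0n.
have [mK prK] := partial_cells_pr D Q0 (leqnn Q).
(* the point 1 lies in none of the Q cells *)
pose E : set R := if `[< G 1 >] then [set 1] else set0.
have EI : E `<=` I01.
  rewrite /E; case: ifPn => _; last exact: sub0set.
  by move=> t /= ->; rewrite in_itv/= ler01 lexx.
have mE : measurable (I01 `&` E).
  by rewrite (setIidr EI) /E; case: ifPn => _ //; exact: measurable_set1.
have GE : I01 `&` G = I01 `&` (partial_cells D Q Q `|` E).
  apply/seteqP; split => t /= [It Gt]; split => //; move: (It); rewrite in_itv/= => /andP[t0 t1].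
    have [t1'|t1'] := ltP t 1; first by left; split => //; rewrite divff// gt_eqF.
    right; have te : t = 1 by apply/eqP; rewrite eq_le t1 t1'.
    by rewrite /E -te; have /asboolP -> := Gt.
  case: Gt => [[]//|]; rewrite /E; case: ifPn => // /asboolP G1 /= ->.
  exact: G1.
split; first by rewrite GE setIUr; exact: measurableU.
rewrite /pr GE -/(pr _) prU//; last first.
  apply/seteqP; split => t //= -[[_ t1 _]]; rewrite /E; case: ifPn => // _ /= te.
  by move: t1; rewrite te divff ?gt_eqF// ltxx.
rewrite prK [X in _ + X](_ : _ = 0) ?addr0//.
rewrite /pr (setIidr EI) /E; case: ifPn => _; last by rewrite measure0.
by rewrite lebesgue_measure_set1.
Qed.

Variables (r : nat -> nat).
Hypothesis r0 : forall n, (0 < r n)%N.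

Let Q n := (\prod_(i < n) r i)%N.

Let Q_gt0 n : (0 < Q n)%N.
Proof. by rewrite /Q prodn_gt0. Qed.

(** The n-th digit in the mixed radix expansion of t with radices r. *)
Definition digit n (t : R) : nat := (Num.truncn ((Q n.+1)%:R * t) %% r n)%N.

Let QS n : Q n.+1 = (r n * Q n)%N.
Proof. by rewrite /Q big_ord_recr/= mulnC. Qed.

(** The conditions C on the first n digits, as a condition on the index c of the
    cell of size 1 / (r 0 * ... * r (n - 1)) which these digits determine. *)
Fixpoint digits_pred (C : nat -> pred nat) n (c : nat) : bool :=
  if n is k.+1 then digits_pred C k (c %/ r k)%N && C k (c %% r k)%N else true.

Let digits_predE C n t : 0 <= t ->
  digits_pred C n (Num.truncn ((Q n)%:R * t)) = [forall i : 'I_n, C i (digit i t)].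
Proof.
move=> t0; elim: n => [|n IH] /=; first by apply/esym/forallP => -[].
rewrite {1}QS natrM -mulrA truncn_divn//; last by rewrite mulr_ge0.
rewrite IH; apply/andP/forallP => [[/forallP h1 h2] i|h].
  have [il|] := ltnP i n; first exact: (h1 (Ordinal il)).
  move=> ni; have -> : (i : nat) = n by apply/eqP; rewrite eqn_leq ni -ltnS ltn_ord.
  exact: h2.
split; last exact: (h ord_max).
by apply/forallP => i; exact: (h (widen_ord (leqnSn n) i)).
Qed.

Let digits_count C n :
  ((\sum_(0 <= c < Q n) digits_pred C n c)%N%:R / (Q n)%:R : R) =
  \prod_(i < n) ((\sum_(0 <= d < r i) C i d)%N%:R / (r i)%:R).
Proof.
elim: n => [|n IH].
  by rewrite /Q !big_ord0 big_nat1/= divr1.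
have h : (\sum_(0 <= c < Q n.+1) digits_pred C n.+1 c =
    (\sum_(0 <= c < Q n) digits_pred C n c) * \sum_(0 <= d < r n) C n d)%N.
  rewrite QS mulnC -(sum_divn_modn (digits_pred C n) (C n) (Q n) (r0 n)).
  by apply: eq_bigr => c _; rewrite /= mulnb.
rewrite h big_ord_recr/= -IH QS mulnC !natrM invfM; ring.
Qed.

Let digits_pr (C : nat -> pred nat) n :
  let G := [set t : R | [forall i : 'I_n, C i (digit i t)]] in
  measurable (I01 `&` G) /\
  pr G = \prod_(i < n) ((\sum_(0 <= d < r i) C i d)%N%:R / (r i)%:R).
Proof.
move=> G; have [mG prG] := cells_pr (digits_pred C n) (Q_gt0 n).
have GE : I01 `&` G =
    I01 `&` [set t : R | digits_pred C n (Num.truncn ((Q n)%:R * t))].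
  apply/seteqP; split => t /= [It]; move: (It); rewrite in_itv/= => /andP[t0 _];
  by rewrite digits_predE.
by split; [rewrite GE|rewrite /pr GE -/(pr _) prG digits_count].
Qed.

(** Counting cells: the number of cells of rank n whose digits satisfy given
    conditions is the product of the numbers of admissible values. *)
Lemma digits_independent (C : nat -> pred nat) (s : seq nat) : uniq s ->
  measurable (I01 `&` \bigcap_(i in [set` s]) [set t | C i (digit i t)]) /\
  pr (\bigcap_(i in [set` s]) [set t | C i (digit i t)]) =
  \prod_(i <- s) ((\sum_(0 <= d < r i) C i d)%N%:R / (r i)%:R).
Proof.
move=> us; pose n := (\max_(i <- s) i).+1.
have sn i : i \in s -> (i < n)%N.
  by move=> is_; rewrite ltnS; apply: leq_bigmax_seq.
pose C' i := if i \in s then C i else xpredT.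
have [mG prG] := digits_pr C' n.
have -> : \bigcap_(i in [set` s]) [set t | C i (digit i t)] =
    [set t | [forall i : 'I_n, C' i (digit i t)]].
  apply/seteqP; split => t /= h.
    by apply/forallP => i; rewrite /C'; case: ifPn => // is_; exact: h.
  move=> i /= is_; move/forallP: h => /(_ (Ordinal (sn i is_))).
  by rewrite /C'/= is_.
split => //; rewrite prG.
rewrite -(big_mkord xpredT (fun i => (\sum_(0 <= d < r i) C' i d)%N%:R / (r i)%:R)).
rewrite (bigID (fun i => i \in s))/= [X in _ * X]big1 ?mulr1; last first.
  move=> i /negbTE is_; rewrite /C' is_ (eq_bigr (fun=> 1%N))//.
  by rewrite sum_nat_const_nat subn0 muln1 divff// pnatr_eq0 -lt0n.
rewrite -big_filter (perm_big s).
  rewrite big_seq [RHS]big_seq; apply: eq_bigr => i is_.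
  by rewrite /C' is_.
apply: uniq_perm; [exact/filter_uniq/iota_uniq|exact: us|].
move=> i; rewrite mem_filter mem_index_iota/=; apply/andP/idP => [[]//|is_].
by split => //; exact: sn.
Qed.

End digits.

(** * Centred sums of independent indicators *)

Section law_of_large_numbers.
Context {R : realType} (psi : Psi R).
Local Notation I01 := (`[0%R, 1%R]%classic : set R).
Local Notation N := (Lorentz_norm psi).

(** How tail bounds for a bounded function z enter norm estimates. *)
Lemma norm_two_level (z : R -> R) (a b : R) : measurable_fun I01 z -> 0 <= a ->
  (forall t, `|z t| <= b) ->
  (N z <= (a * psi 1 + b * psi (pr [set t | a <= `|z t|]))%:E)%E.
Proof.
move=> mz a0 zb; set B := [set t | _].
have b0 : 0 <= b by rewrite (le_trans _ (zb 0)).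
have mB : measurable (I01 `&` B).
  by apply: mlevel; exact: (measurable_abs mz).
have mbB : measurable_fun I01 (fun t => b * \1_B t).
  by apply: measurable_funM => //; exact: measurable_indicI.
apply: (@le_trans _ _ (N (fun=> a) + N (fun t => (b * \1_B t)%R))%E).
  apply: norm_triangle => // t _.
  have [az|az] := leP a `|z t|.
    rewrite indicE mem_set//= mulr1 [`|b|]ger0_norm//.
    by apply: (le_trans (zb t)); rewrite lerDr.
  by rewrite (le_trans (ltW az))// (le_trans (ler_norm _))// lerDl.
rewrite EFinD; apply: leeD.
  by apply: le_trans (norm_cst psi a) _; rewrite ger0_norm.
apply: norm_le_level => // t _; rewrite ger0_norm ?mulr_ge0//.
Qed.

Definition centred (A : nat -> set R) j (t : R) : R :=
  hits A j t - \sum_(k < j) pr (A k).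

Lemma centred_measurable A j : (forall i, measurable (I01 `&` A i)) ->
  measurable_fun I01 (centred A j).
Proof. by move=> mA; apply: measurable_funB => //; exact: hits_measurable. Qed.

Lemma centred_le A j t : (forall i, measurable (I01 `&` A i)) ->
  `|centred A j t| <= j%:R.
Proof.
move=> mA; have h1 := hits_ge0 A j t; have h2 := hits_le A j t.
have h3 := sum_pr_le j mA.
have h4 : 0 <= \sum_(k < j) pr (A k) by apply: sumr_ge0 => i _; exact: pr_ge0.
rewrite /centred ler_norml; lra.
Qed.

(** A law of large numbers, uniform over all independent events: Chernoff's
    bound at the level th * j, together with the continuity of psi at 0. *)
Lemma centred_small (eta : R) : 0 < eta -> exists j0 : nat,
  forall j A, (j0 <= j)%N -> independent_events A ->
    (N (centred A j) <= (eta * j%:R)%:E)%E.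
Proof.
move=> eta0; have p1 := psi1_gt0 psi.
pose th := Num.min 1 (eta / 2 / psi 1).
have th0 : 0 < th by rewrite lt_min ltr01/= !divr_gt0.
have th1 : th <= 1 by rewrite ge_min lexx.
have thp : th * psi 1 <= eta / 2.
  by rewrite -ler_pdivlMr// ge_min lexx orbT.
have [ka /andP[ka0 ka1] kap] := psi_small psi (divr_gt0 eta0 (ltr0n R 2)).
pose J : R := 8 * (- ln (ka / 2)) / th ^+ 2.
exists (Num.truncn J).+1 => j A Jj iA; have [mA _] := iA.
have jJ : J < j%:R.
  by apply: (lt_le_trans (truncnS_gt J)); rewrite ler_nat.
have j0 : (0 : R) < j%:R by rewrite ltr0n (leq_trans _ Jj).
have mz := centred_measurable j mA.
apply: le_trans (norm_two_level mz (a := th * j%:R) (b := j%:R) _ _) _.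
- by rewrite mulr_ge0// ltW.
- by move=> t; exact: centred_le.
rewrite lee_fin; set q := pr _.
have q0 : 0 <= q <= ka.
  rewrite pr_ge0/=.
  apply: le_trans (@centred_hits_tail _ A (th * j%:R) j%:R j iA _ _ _) _ => //.
    by rewrite mulr_ge0 ?(ltW th0)// ler_wpM2r// (le_trans th1)// ler1n.
  rewrite -ler_pdivlMl// [leRHS]mulrC -[leRHS]lnK ?posrE ?divr_gt0// ler_expR lerNl.
  have -> : (th * j%:R) ^+ 2 / (8 * j%:R) = (th ^+ 2 * j%:R) / 8 :> R.
    by field; rewrite gt_eqF.
  rewrite ler_pdivlMr// mulrC -ler_pdivrMl ?exprn_gt0//.
  apply: le_trans (ltW jJ); rewrite /J [ka / 2]mulrC; set L := ln _.
  by rewrite mulrC [8 * _]mulrC.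
have := kap q q0; have : 0 < j%:R * 1 :> R by rewrite mulr1.
have := ler_wpM2r (ltW j0) thp; have := ler_wpM2l (ltW j0) (kap q q0).
by move: (psi q) (psi 1) => a b; lra.
Qed.

End law_of_large_numbers.

(** * A sequence with independent terms, built from digits *)

Section example.
Context {R : realType} (psi : Psi R).
Local Notation I01 := (`[0%R, 1%R]%classic : set R).
Local Notation m := (@lebesgue_measure R).
Local Notation N := (Lorentz_norm psi).

Variables (rho : nat -> nat) (c : nat -> R).
Hypothesis rho0 : forall i, (0 < rho i)%N.
Hypothesis c0 : forall i, 0 <= c i.

(* The n-th radix is divisible by rho 0, ..., rho n, so that 1 / rho i is the
   probability that the n-th digit is below r n / rho i. *)
Let r n := (\prod_(i < n.+1) rho i)%N.

Let r0 n : (0 < r n)%N. Proof. by rewrite /r prodn_gt0. Qed.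

(** For fixed i, independent events of probability 1 / rho i, one for each
    n >= i. *)
Definition block n i : set R := [set t | (digit r n t < r n %/ rho i)%N].

Let blockE n i : block n i = \bigcap_(k in [set` [:: n]])
  [set t | (fun _ d => (d < r n %/ rho i)%N : bool) k (digit r k t)].
Proof.
apply/seteqP; split => t /=; first by move=> h k /=; rewrite inE => /eqP ->.
by move=> h; apply: h; rewrite /= inE.
Qed.

Lemma block_measurable n i : measurable (I01 `&` block n i).
Proof.
rewrite blockE.
by have [] := @digits_independent R r r0
  (fun _ d => (d < r n %/ rho i)%N : bool) [:: n] isT.
Qed.

Let count_lt a b : (a <= b)%N -> (\sum_(0 <= d < b) (d < a)%N = a)%N.
Proof.
move=> ab; rewrite (@big_cat_nat _ _ _ a)//= (eq_big_nat _ _ (F2 := fun=> 1%N)).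
  rewrite sum_nat_const_nat muln1 subn0 (eq_big_nat _ _ (F2 := fun=> 0%N)).
    by rewrite sum_nat_const_nat muln0 addn0.
  by move=> d /andP[ad _]; rewrite ltnNge ad.
by move=> d /andP[_ ->].
Qed.

Lemma block_pr n i : (i <= n)%N -> pr (block n i) = (rho i)%:R^-1.
Proof.
move=> ilen; rewrite blockE.
have [_ ->] := @digits_independent R r r0
  (fun _ d => (d < r n %/ rho i)%N : bool) [:: n] isT.
rewrite big_seq1 count_lt ?leq_div//.
have dv : (rho i %| r n)%N.
  by rewrite /r (bigD1 (Ordinal (n:=n.+1) (m:=i) ilen))//= dvdn_mulr.
have {2}-> : r n = (r n %/ rho i * rho i)%N by rewrite divnK.
rewrite natrM invfM mulrA divff ?mul1r// pnatr_eq0 -lt0n divn_gt0//.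
exact: dvdn_leq.
Qed.

Lemma block_independent (f : nat -> nat) i : injective f ->
  independent_events (fun k => block (f k) i).
Proof.
move=> fi; apply: (@independent_events_sub _ (fun n => block n i) f fi).
split=> [n|s us]; first exact: block_measurable.
pose C k d : bool := (d < r k %/ rho i)%N.
have [_ h] := @digits_independent R r r0 C s us.
rewrite -[X in pr X]/(\bigcap_(k in [set` s]) [set t | C k (digit r k t)]) h.
apply: eq_bigr => n _; rewrite blockE.
by have [_ ->] := @digits_independent R r r0
  (fun _ d => (d < r n %/ rho i)%N : bool) [:: n] isT; rewrite big_seq1.
Qed.

(** A superposition of centred indicators; the n-th term only has the levels
    i <= n, but over the sequence every level occurs infinitely often. *)
Definition example n (t : R) : R :=
  \sum_(i < n.+1) c i * (\1_(block n i) t - (rho i)%:R^-1).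

Lemma example_independent : independent example.
Proof.
move=> s B us mB.
pose xi n d : R := \sum_(i < n.+1) c i * ((d < r n %/ rho i)%N%:R - (rho i)%:R^-1).
have exE n t : example n t = xi n (digit r n t).
  apply: eq_bigr => i _; rewrite indicE.
  have -> // : (t \in block n i) = (digit r n t < r n %/ rho i)%N.
  by rewrite /block; apply/idP/idP => [|h]; rewrite inE.
pose C n d : bool := `[< B n (xi n d) >].
have pre n : example n @^-1` B n = [set t : R | C n (digit r n t)].
  by apply/seteqP; split => t /=; rewrite exE /C => h; apply/asboolP.
have [ms prs] := @digits_independent R r r0 C s us.
have -> : \bigcap_(i in [set` s]) (example i @^-1` B i) =
    \bigcap_(i in [set` s]) [set t | C i (digit r i t)].
  by apply: eq_bigcapr => i _; exact: pre.
rewrite -prE// prs -prodEFin; apply: eq_bigr => n _; rewrite pre.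
have sE : [set t : R | C n (digit r n t)] =
    \bigcap_(k in [set` [:: n]]) [set t : R | C k (digit r k t)].
  apply/seteqP; split => t /=; first by move=> h k /=; rewrite inE => /eqP ->.
  by move=> h; apply: h; rewrite /= inE.
have [mn prn] := @digits_independent R r r0 C [:: n] isT.
by rewrite sE -prE// prn big_seq1.
Qed.

End example.

(** * Weak nullity from Cesaro means *)

Section example_weakly_null.
Context {R : realType} (psi : Psi R).
Local Notation I01 := (`[0%R, 1%R]%classic : set R).
Local Notation N := (Lorentz_norm psi).

(** Otherwise some functional would, up to its sign, be bounded below by some
    e > 0 along a subsequence, hence on all Cesaro means of that subsequence. *)
Lemma weakly_null_cesaro (x : nat -> R -> R) :
  (forall n, function_space N (x n)) ->
  (forall e : R, 0 < e -> exists i j : nat, (0 < j)%N /\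
    forall f : nat -> nat, injective f -> (forall k, (i <= f k)%N) ->
    (N (fun t => (\sum_(k < j) x (f k) t)%R) <= (e * j%:R)%:E)%E) ->
  weakly_null N x.
Proof.
move=> fx ces; split => //.
have half F (e : R) : bounded_linear_functional N F -> 0 < e ->
    exists M, forall n, (M <= n)%N -> F (x n) <= e.
  move=> [lF [C FC]] e0; apply: contrapT => no.
  have /choice[g gP] : forall M, exists n, (M <= n)%N /\ e < F (x n).
    move=> M; apply: contrapT => nM; apply: no; exists M => n Mn.
    by rewrite leNgt; apply/negP => ?; apply: nM; exists n.
  have C0 : 0 < `|C| + 1 by rewrite ltr_wpDl.
  have [i [j [j0 hj]]] := ces (e / (2 * (`|C| + 1))) (divr_gt0 e0 (mulr_gt0 (ltr0n R 2) C0)).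
  pose f := fix f k := if k is k'.+1 then g (f k').+1 else g i.
  have fS k : (f k < f k.+1)%N by have [] := gP (f k).+1.
  have fe k : e < F (x (f k)) by case: k => [|k] /=; [have [] := gP i|have [] := gP (f k).+1].
  have fi k : (i <= f k)%N.
    elim: k => [|k IH]; first by have [] := gP i.
    by apply: (leq_trans IH); apply: ltnW.
  have fm : {homo f : a b / (a < b)%N} by apply: homo_ltn; [exact: ltn_trans|exact: fS].
  have finj := increasing_inj fm.
  have := hj f finj fi; have fxf (k : 'I_j) : function_space N (x (f k)) by exact: fx.
  have fs := fsp_sum fxf.
  rewrite -(fineK (fsp_fin fs)) lee_fin; set s := fine _ => hs.
  have s0 : 0 <= s by apply: fine_ge0; exact: norm_ge0.
  have h1 : F (fun t => \sum_(k < j) x (f k) t) <= C * s.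
    have := FC _ fs; rewrite -(fineK (fsp_fin fs)) -EFinM lee_fin.
    exact: le_trans (ler_norm _).
  rewrite (linear_on_sum lF fxf) in h1.
  have h2 : e * j%:R <= \sum_(k < j) F (x (f k)).
    rewrite mulr_natr -[j in leLHS]card_ord -sumr_const.
    by apply: ler_sum => k _; exact: ltW.
  have h3 : C * s <= (`|C| + 1) * (e / (2 * (`|C| + 1)) * j%:R).
    apply: (@le_trans _ _ ((`|C| + 1) * s)).
      by rewrite ler_wpM2r// (le_trans (ler_norm C))// lerDl.
    by rewrite ler_wpM2l// ltW.
  have h4 : (`|C| + 1) * (e / (2 * (`|C| + 1)) * j%:R) = e * j%:R / 2.
    by field; rewrite gt_eqF.
  have : 0 < e * j%:R by rewrite mulr_gt0// ltr0n.
  lra.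
move=> F bF; apply/cvgrPdist_le => e e0.
have [M1 h1] := half F e bF e0.
have bF' : bounded_linear_functional N (fun u => - F u).
  case: bF => lF [C FC]; split => [a u v fu fv|].
    by rewrite lF//; ring.
  by exists C => u fu; rewrite normrN FC.
have [M2 h2] := half _ e bF' e0.
exists (maxn M1 M2) => // n /=; rewrite geq_max => /andP[n1 n2].
rewrite sub0r normrN ler_norml lerNl h1// andbT; exact: h2.
Qed.

Variables (rho : nat -> nat) (c : nat -> R).
Hypothesis rho0 : forall i, (0 < rho i)%N.
Hypothesis c0 : forall i, 0 <= c i.
Hypothesis hc : forall i, c i * psi (rho i)%:R^-1 <= 2^-1 ^+ i.

Let B n i : set R := block rho n i.
Let u i : R := (rho i)%:R^-1.

Lemma inv_nat01 n : (0 < n)%N -> 0 < (n%:R^-1 : R) <= 1.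
Proof. by move=> n0; rewrite invr_gt0 ltr0n n0 invf_le1 ?ltr0n// ler1n. Qed.

Let u01 i : 0 <= u i <= 1.
Proof. by have /andP[h ->] := inv_nat01 (rho0 i); rewrite ltW. Qed.

Let term n i t : R := c i * (\1_(B n i) t - u i).

Let term_measurable n i : measurable_fun I01 (term n i).
Proof.
apply: measurable_funM => //.
by apply: measurable_funB => //; apply: measurable_indicI; exact: block_measurable.
Qed.

Let term_norm n i : (i <= n)%N -> (N (term n i) <= (2 * 2^-1 ^+ i)%:E)%E.
Proof.
move=> ilen; have mB := block_measurable rho0 n i.
have mcB : measurable_fun I01 (fun t => c i * \1_(B n i) t).
  by apply: measurable_funM => //; exact: measurable_indicI.
apply: (@le_trans _ _ (N (fun t => (c i * \1_(B n i) t)%R) + N (fun=> (c i * u i)%R))%E).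
  apply: norm_triangle => // t _.
  by rewrite /term mulrBr; apply: le_trans (ler_normB _ _) _.
have ci := c0 i; have /andP[u0 u1] := u01 i.
apply: (@le_trans _ _ ((c i * psi (u i))%:E + (c i * u i * psi 1)%:E)%E).
  apply: leeD.
    rewrite /u -(block_pr rho0 ilen); apply: norm_le_level => // t _.
    by rewrite ger0_norm// mulr_ge0.
  by have := norm_cst psi (c i * u i); rewrite ger0_norm// mulr_ge0.
rewrite -EFinD lee_fin -mulrA.
have h1 : c i * (u i * psi 1) <= c i * psi (u i).
  by rewrite ler_wpM2l// psi_ge_lin// u01.
have := hc i; rewrite -/(u i); lra.
Qed.

Let term_bounded n i : exists b, forall t, `|term n i t| <= b.
Proof.
exists (c i * 1) => t; rewrite normrM (ger0_norm (c0 i)) ler_wpM2l//.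
by have := u01 i; rewrite indicE; case: (_ \in _) => /=; rewrite ler_norml; lra.
Qed.

Lemma example_fsp n : function_space N (example rho c n).
Proof.
apply: (@fsp_sum _ psi n.+1 (term n)) => i; have [b tb] := term_bounded n i.
by apply: (@fsp_bounded _ psi _ b) => // t _; exact: tb.
Qed.

(* The levels i, ..., n of the n-th term. Together they have norm at most
   4 * 2 ^ - i, whatever n. *)
Let tailsum n i t : R := \sum_(i <= k < n.+1) term n k t.

Let tailsum_measurable n i : measurable_fun I01 (tailsum n i).
Proof.
rewrite /tailsum; elim: n.+1 => [|k IH].
  apply: (@eq_measurable_fun _ _ _ _ _ (fun=> 0 : R)) => // t _.
  by rewrite big_geq.
have [ik|ki] := leqP i k.
  apply: (@eq_measurable_fun _ _ _ _ _
    (fun t => \sum_(i <= k0 < k) term n k0 t + term n k t)) => [t _|].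
    by rewrite big_nat_recr.
  exact: measurable_funD.
apply: (@eq_measurable_fun _ _ _ _ _ (fun=> 0 : R)) => // t _.
by rewrite big_geq.
Qed.

Let tailsum_norm n i : (i <= n)%N -> (N (tailsum n i) <= (4 * 2^-1 ^+ i)%:E)%E.
Proof.
move=> ilen.
apply: (@le_trans _ _ (\sum_(k < (n.+1 - i)%N) N (term n (i + k)))%E).
  apply: norm_le_sum => // t _; rewrite /tailsum.
  rewrite -{1}[i]add0n big_addn big_mkord.
  apply: le_trans (ler_norm_sum _ _ _) _.
  by apply: ler_sum => k _; rewrite addnC.
apply: (@le_trans _ _ (\sum_(k < (n.+1 - i)%N) (2 * 2^-1 ^+ (i + k))%:E)%E).
  apply: lee_sum => k _; apply: term_norm.
  by have := ltn_ord k; rewrite ltn_subRL ltnS.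
rewrite sumEFin lee_fin -mulr_sumr.
have := geo2_le i n.+1 (R := R); rewrite -{1}[i]add0n big_addn big_mkord.
rewrite (eq_bigr (fun k : 'I_(n.+1 - i) => 2^-1 ^+ (i + k) : R)); last first.
  by move=> k _; rewrite addnC.
by lra.
Qed.

(** The high levels are uniformly small in norm, and each of the finitely many
    low levels obeys the law of large numbers. *)
Lemma example_weakly_null : weakly_null N (example rho c).
Proof.
apply: weakly_null_cesaro; first exact: example_fsp.
move=> e e0; have half : 0 < (2^-1 : R) < 1 by lra.
have [I [_ hI]] := expr_small half (divr_gt0 e0 (ltr0n R 8)).
pose S := \sum_(i < I) c i.
have S0 : 0 <= S by apply: sumr_ge0.
have S1 : 0 < 1 + S by rewrite ltr_wpDr.
have [j0 hj0] := centred_small psi (divr_gt0 e0 (mulr_gt0 (ltr0n R 2) S1)).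
exists I, j0.+1; split => // f fi fI; set j := j0.+1.
pose Z i := centred (fun k => B (f k) i) j.
have iB i : independent_events (fun k => B (f k) i) by exact: block_independent.
have mZ i : measurable_fun I01 (Z i) by apply: centred_measurable; case: (iB i).
have mcZ i : measurable_fun I01 (fun t => c i * Z i t) by exact: measurable_funM.
have mT k : measurable_fun I01 (tailsum (f k) I) by exact: tailsum_measurable.
have xE t : \sum_(k < j) example rho c (f k) t =
    \sum_(i < I) c i * Z i t + \sum_(k < j) tailsum (f k) I t.
  transitivity (\sum_(k < j) (\sum_(i < I) term (f k) i t + tailsum (f k) I t)).
    apply: eq_bigr => k _; rewrite /example /tailsum.
    rewrite -(big_mkord xpredT (fun i => term (f k) i t)).
    rewrite -(big_mkord xpredT (fun i => term (f k) i t)).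
    by rewrite (@big_cat_nat _ _ _ I)//=; exact: (leq_trans (fI k)).
  rewrite big_split/=; congr (_ + _); rewrite exchange_big/=.
  apply: eq_bigr => i _; rewrite -mulr_sumr sumrB; congr (_ * (_ - _)).
  apply: eq_bigr => k _; rewrite block_pr//.
  by apply: (leq_trans _ (fI k)); exact: ltnW.
have mS1 : measurable_fun I01 (fun t => \sum_(i < I) c i * Z i t).
  exact: (measurable_sum_fun (f := fun (i : 'I_I) t => c i * Z i t)).
have mS2 : measurable_fun I01 (fun t => \sum_(k < j) tailsum (f k) I t).
  exact: (measurable_sum_fun (f := fun (k : 'I_j) t => tailsum (f k) I t)).
apply: (@le_trans _ _ (N (fun t => (\sum_(i < I) c i * Z i t)%R) +
   N (fun t => (\sum_(k < j) tailsum (f k) I t)%R))%E).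
  apply: norm_triangle => //.
    apply: (@eq_measurable_fun _ _ _ _ _ (fun t => \sum_(i < I) c i * Z i t +
      \sum_(k < j) tailsum (f k) I t)) => [t _|]; first by rewrite xE.
    exact: measurable_funD.
  by move=> t _; rewrite xE; exact: ler_normD.
apply: (@le_trans _ _ ((\sum_(i < I) c i * (e / (2 * (1 + S)) * j%:R))%:E +
   (\sum_(k < j) (4 * 2^-1 ^+ I))%:E)%E).
  apply: leeD.
    apply: (@le_trans _ _ (\sum_(i < I) N (fun t => (c i * Z i t)%R))%E).
      by apply: norm_le_sum => // t _; exact: ler_norm_sum.
    rewrite -sumEFin; apply: lee_sum => i _.
    apply: le_trans (norm_scale psi (c i) (mZ i)) _.
    rewrite ger0_norm// EFinM; apply: lee_wpmul2l; first by rewrite lee_fin.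
    by apply: hj0 => //.
  apply: (@le_trans _ _ (\sum_(k < j) N (tailsum (f k) I))%E).
    by apply: norm_le_sum => // t _; exact: ler_norm_sum.
  by rewrite -sumEFin; apply: lee_sum => k _; exact: tailsum_norm.
rewrite -EFinD lee_fin -mulr_suml sumr_const card_ord -/S -[X in _ + X]mulr_natr.
have jp : 0 <= j%:R :> R by [].
have h1 : S * (e / (2 * (1 + S)) * j%:R) <= e / 2 * j%:R.
  rewrite mulrA ler_wpM2r// mulrA ler_pdivrMr ?mulr_gt0//.
  rewrite mulrA divfK// mulrC ler_wpM2l ?(ltW e0)// lerDr//.
have h2 : 4 * 2^-1 ^+ I * j%:R <= e / 2 * j%:R.
  by rewrite ler_wpM2r//; lra.
have -> : e * j%:R = e / 2 * j%:R + e / 2 * j%:R by field.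
apply: lerD; [exact: h1|exact: h2].
Qed.

End example_weakly_null.

(** * Necessity of the two conditions *)

Section lower_bounds.
Context {R : realType} (psi : Psi R).
Local Notation I01 := (`[0%R, 1%R]%classic : set R).
Local Notation N := (Lorentz_norm psi).

(** Sums of K independent copies of an indicator have, up to a constant, the
    norm that the triangle inequality allows. The margin c / 2 absorbs the
    centring of the copies and the other terms of the example. *)
Definition saturated (K rho : nat) := forall (A : nat -> set R) (S : R -> R) (c : R),
  independent_events A -> (forall k, (k < K)%N -> pr (A k) = rho%:R^-1) ->
  measurable_fun I01 S -> 0 <= c ->
  (forall t, I01 t -> 1 <= hits A K t -> c * hits A K t - c / 2 <= S t) ->
  ((c * K%:R * psi rho%:R^-1 / 16)%:E <= N S)%E.

Lemma limsup_large (f : R -> R) (a q ka : R) :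
  ~ (limf_esup (fun u => (f u)%:E) 0^'+ < a%:E)%E -> q < a -> 0 < ka ->
  exists u, [/\ 0 < u, u < ka & q < f u].
Proof.
move=> nlim qa ka0; apply: contrapT => no; apply: nlim.
apply: (@le_lt_trans _ _ q%:E); last by rewrite lte_fin.
apply: (@le_trans _ _ (ereal_sup ((fun u => (f u)%:E) @` `]0, ka[%classic))).
  apply: ereal_inf_lbound; exists (`]0, ka[%classic) => //.
  near=> u; rewrite /= in_itv/=; apply/andP; split; near: u.
    exact: nbhs_right_gt.
  exact: nbhs_right_lt.
apply: ge_ereal_sup => _ [u + <-]; rewrite /= in_itv/= => /andP[u0 uk].
by rewrite lee_fin leNgt; apply/negP => h; apply: no; exists u.
Unshelve. all: by end_near. Qed.

(** The probabilities in the example are inverses of integers. *)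
Lemma inv_nat_approx (v : R) : 0 < v -> v <= 1 ->
  exists rho : nat, [/\ (0 < rho)%N, v <= rho%:R^-1 & rho%:R^-1 <= 2 * v].
Proof.
move=> v0 v1; pose rho := Num.truncn v^-1.
have vi : 1 <= v^-1 by rewrite invf_ge1.
have rho0 : (0 < rho)%N by rewrite truncn_gt0.
have rp : 0 < (rho%:R : R) by rewrite ltr0n.
have vi0 : 0 <= v^-1 by rewrite invr_ge0 ltW.
have /andP[h1 h2] := truncn_itv vi0.
exists rho; split => //.
  by rewrite -[v]invrK lef_pV2 ?posrE ?invr_gt0.
rewrite -[v]invrK -[2]invrK -invfM lef_pV2 ?posrE ?mulr_gt0 ?invr_gt0//.
rewrite ler_pdivrMl// (le_trans (ltW h2))// -natr1 -/rho mulr_natl mulr2n lerD2l.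
by rewrite ler1n.
Qed.

(** Take a small v with psi (K v) >= (K / 2) psi v and round it to the inverse u
    of an integer. At least one of the K events occurs with probability at
    least K u / 2, and then S >= c / 2. *)
Lemma saturated_of_dilation :
  (forall k : nat, (2 <= k)%N ->
    ~ (limf_esup (fun u : R => (psi (k%:R * u) / psi u)%:E) 0^'+ < k%:R%:E)%E) ->
  forall (K : nat) (ka : R), (2 <= K)%N -> 0 < ka ->
  exists rho : nat, [/\ (0 < rho)%N, rho%:R^-1 <= ka & saturated K rho].
Proof.
move=> H K ka K2 ka0; have K0 : (0 : R) < K%:R by rewrite ltr0n (leq_trans _ K2).
pose ka' := Num.min (ka / 2) (1 / (2 * K%:R)).
have ka'0 : 0 < ka' by rewrite lt_min !divr_gt0// mulr_gt0.
have K2' : K%:R / 2 < K%:R :> R by rewrite ltr_pdivrMr// ltr_pMr// ltr1n.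
have [v [v0 vk]] := limsup_large (H K K2) K2' ka'0.
have vk1 : v <= ka / 2 by rewrite (le_trans (ltW vk))// ge_min lexx.
have vk2 : v <= 1 / (2 * K%:R) by rewrite (le_trans (ltW vk))// ge_min lexx orbT.
have Kv : 2 * K%:R * v <= 1 by rewrite mulrC -ler_pdivlMr ?mulr_gt0.
have K1 : (2 : R) <= K%:R by rewrite ler_nat.
have v1 : v <= 1 by nra.
rewrite ltr_pdivlMr ?psi_gt0 ?v0// => Kpsi.
have [rho [rho0 vr rv]] := inv_nat_approx v0 v1.
exists rho; split => //; first lra.
set u : R := rho%:R^-1 in vr rv *.
have u0 : 0 < u by lra.
have Ku : K%:R * u <= 1 by nra.
have u1 : u <= 1 by nra.
have psiKu : K%:R / 8 * psi u <= psi (K%:R * u / 2).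
  have h1 : 1 / 2 * psi (K%:R * u) <= psi (1 / 2 * (K%:R * u)).
    by apply: psi_star; apply/andP; split; nra.
  have h2 : psi (K%:R * v) <= psi (K%:R * u) by apply: psi_mono; nra.
  have h3 : psi u <= psi (2 * v) by apply: psi_mono; nra.
  have h4 : 1 / 2 * psi (2 * v) <= psi (1 / 2 * (2 * v)).
    by apply: psi_star; apply/andP; split; nra.
  rewrite (_ : 1 / 2 * (2 * v) = v) in h4; last by field.
  rewrite (_ : 1 / 2 * (K%:R * u) = K%:R * u / 2) in h1; last by field.
  nra.
move=> A S c iA Au mS c0 hS; have [mA _] := iA.
have mh := hits_measurable K mA.
pose G := [set t | 1 <= hits A K t].
have mG : measurable (I01 `&` G) by exact: mlevel.
have prG : K%:R * u / 2 <= pr G.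
  (* the probability of no hit is the integral of the product of 1 - \1_(A k) *)
  have := @expectation_prod _ A (-1) (iota 0 K) [::] iA.
  rewrite cats0 iota_uniq => /(_ isT).
  rewrite big_nil mulr1 => E1.
  have E2 : \prod_(k <- iota 0 K) (1 + -1 * pr (A k)) = (1 - u) ^+ K.
    rewrite prod_iota -[K in RHS]card_ord -prodr_const.
    by apply: eq_bigr => k _; rewrite Au// mulN1r.
  have E3 : 1 - pr G <= (1 - u) ^+ K.
    have mG' : measurable (I01 `&` ~` G).
      have -> : I01 `&` ~` G = I01 `\` (I01 `&` G).
        apply/seteqP; split => t /= [It nG]; split => //; last by move=> Gt; apply: nG.
        by case.
      exact: measurableD.
    have -> : 1 - pr G = pr (~` G).
      rewrite -(prT (R := R)) -(setUv G) prU ?setICr//.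
      by rewrite addrAC subrr add0r.
    rewrite -E2 -E1 -(Rint_indic mG'); apply: le_Rintegral => //.
    - apply: (@bounded_integrable _ _ 1); first exact: measurable_indicI.
      by move=> t; rewrite indicE; case: (_ \in _); rewrite ?normr1 ?normr0.
    - apply: (@bounded_integrable _ _ (1 ^+ size (iota 0 K))).
        apply: (@eq_measurable_fun _ _ _ _ _
          (fun t => \prod_(i <- iota 0 K) (1 + -1 * \1_(A i) t : R))) => [t _|].
          by rewrite big_nil mulr1.
        apply: measurable_prod_fun => i; apply: measurable_funD => //.
        by apply: measurable_funM => //; exact: measurable_indicI.
      move=> t; rewrite big_nil mulr1.
      apply: (@prod_bounded _ _ (fun i t => 1 + -1 * \1_(A i) t)) => // i s.
      by rewrite indicE; case: (_ \in _) => /=; rewrite ?mulN1r ?subrr ?normr0 ?subr0 ?mulr0 ?addr0 ?normr1.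
    - move=> t It; rewrite big_nil mulr1.
      have p0 (k : nat) : 0 <= 1 + -1 * \1_(A k) t :> R.
        by rewrite indicE; case: (_ \in _) => /=; rewrite ?mulr1 ?subrr ?mulr0 ?addr0.
      rewrite indicE; case: (boolP (t \in ~` G)) => /= [|_]; last by apply: prodr_ge0.
      rewrite inE /G/= => /negP; rewrite -ltNge => h.
      rewrite big_seq big1// => k; rewrite mem_iota add0n => /andP[_ kK].
      have : (\1_(A k) t : R) < 1.
        apply: le_lt_trans h; rewrite /hits (bigD1 (Ordinal kK))//= lerDl.
        by apply: sumr_ge0 => i _; rewrite indicE.
      by rewrite indicE; case: (_ \in _) => /=; rewrite ?ltxx// mulr0 addr0.
  have E4 (n : nat) : n%:R * u <= 1 -> (1 - u) ^+ n <= 1 - n%:R * u / 2.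
    elim: n => [|n IH] nu; first by rewrite expr0 mul0r mul0r subr0.
    have nu' : n.+1%:R = n%:R + 1 :> R by rewrite natr1.
    have n0 : 0 <= n%:R :> R by [].
    have : n%:R * u <= 1 by rewrite nu' in nu; nra.
    move=> /IH h; rewrite exprS nu'; rewrite nu' in nu.
    apply: (@le_trans _ _ ((1 - u) * (1 - n%:R * u / 2))).
      by rewrite ler_wpM2l// subr_ge0.
    nra.
  have := E4 K Ku; lra.
have := @norm_ge_level _ psi S G (c / 2) mS mG _ _.
rewrite divr_ge0// => /(_ isT) h; apply: le_trans (h _); last first.
  move=> t It Gt; have := hS t It Gt; have := Gt; rewrite /G/= => h1 h2.
  apply: le_trans (ler_norm _); nra.
rewrite lee_fin.
have : psi (K%:R * u / 2) <= psi (pr G).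
  by apply: psi_mono => //; [nra|exact: pr_le1].
nra.
Qed.

End lower_bounds.

Section necessity.
Context {R : realType} (psi : Psi R).
Local Notation I01 := (`[0%R, 1%R]%classic : set R).
Local Notation N := (Lorentz_norm psi).

(** Take a small v with psi (v ^ K) >= psi v / 2 and round it to the inverse u
    of an integer. With probability u ^ K all the events occur, and then
    S >= K c / 2. *)
Lemma saturated_of_power :
  (forall l : nat, (2 <= l)%N ->
    ~ (limf_esup (fun u : R => (psi (u ^+ l) / psi u)%:E) 0^'+ < 1%:E)%E) ->
  forall (K : nat) (ka : R), (2 <= K)%N -> 0 < ka ->
  exists rho : nat, [/\ (0 < rho)%N, rho%:R^-1 <= ka & saturated psi K rho].
Proof.
move=> H K ka K2 ka0; have K0 : (0 : R) < K%:R by rewrite ltr0n (leq_trans _ K2).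
have K1 : (1 : R) <= K%:R by rewrite ler1n (leq_trans _ K2).
pose ka' := Num.min (ka / 2) (1 / 2).
have ka'0 : 0 < ka' by rewrite lt_min !divr_gt0.
have h12 : 1 / 2 < 1 :> R by lra.
have [v [v0 vk]] := limsup_large (H K K2) h12 ka'0.
have vk1 : v <= ka / 2 by rewrite (le_trans (ltW vk))// ge_min lexx.
have vk2 : v <= 1 / 2 by rewrite (le_trans (ltW vk))// ge_min lexx orbT.
have v1 : v <= 1 by lra.
rewrite ltr_pdivlMr ?psi_gt0 ?v0// => Kpsi.
have [rho [rho0 vr rv]] := inv_nat_approx v0 v1.
exists rho; split => //; first lra.
set u : R := rho%:R^-1 in vr rv *.
have u0 : 0 < u by lra.
have u1 : u <= 1 by lra.
have uK1 : 0 <= u ^+ K <= 1 by rewrite exprn_ge0 ?(ltW u0)//= exprn_ile1// ltW.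
have psiu : 1 / 4 * psi u <= psi (u ^+ K).
  have h1 : psi (v ^+ K) <= psi (u ^+ K).
    apply: psi_mono; [by rewrite exprn_ge0// ltW| |by case/andP: uK1].
    by rewrite lerXn2r// nnegrE ltW.
  have h3 : psi u <= psi (2 * v) by apply: psi_mono; lra.
  have h4 : 1 / 2 * psi (2 * v) <= psi (1 / 2 * (2 * v)).
    by apply: psi_star; apply/andP; split; lra.
  rewrite (_ : 1 / 2 * (2 * v) = v) in h4; last by field.
  lra.
move=> A S c iA Au mS c0 hS; have [mA inA] := iA.
pose G := \bigcap_(i in [set` iota 0 K]) A i.
have GA k t : (k < K)%N -> G t -> A k t.
  by move=> kK; apply; rewrite /= mem_iota add0n kK.
have prG : pr G = u ^+ K.
  rewrite /G inA ?iota_uniq// prod_iota -[K in RHS]card_ord -prodr_const.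
  by apply: eq_bigr => k _; rewrite Au.
have mG : measurable (I01 `&` G).
  have ne : [set` iota 0 K] !=set0 by exists 0%N; rewrite /= mem_iota/= (leq_trans _ K2).
  rewrite /G -bigcapIr//; apply: bigcap_measurable => // i _; exact: mA.
have := @norm_ge_level _ psi S G (c * K%:R / 2) mS mG _ _.
rewrite divr_ge0 ?mulr_ge0// => /(_ isT) h; apply: le_trans (h _); last first.
  move=> t It Gt.
  have hE : hits A K t = K%:R.
    rewrite /hits (eq_bigr (fun=> 1)); first by rewrite sumr_const card_ord.
    by move=> k _; rewrite indicE mem_set//; exact: GA.
  have := hS t It; rewrite hE => /(_ K1) h2.
  by apply: le_trans (ler_norm _); nra.
rewrite lee_fin prG.
have : 0 <= c * K%:R by rewrite mulr_ge0.
have := psi_ge0 psi (u := u); rewrite (ltW u0) u1 => /(_ isT).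
move: (psi u) (psi (u ^+ K)) psiu => a b ab; move: (c * K%:R) => q; nra.
Qed.

Lemma powR_large (a M : R) : 0 < a -> exists K : nat, forall k : nat,
  (K <= k)%N -> M <= k%:R `^ a.
Proof.
move=> a0; have M1 : 0 < `|M| + 1 by rewrite ltr_wpDl.
exists (Num.truncn ((`|M| + 1) `^ a^-1)).+1 => k Kk.
have h : (`|M| + 1) `^ a^-1 <= k%:R.
  by apply: (le_trans (ltW (truncnS_gt _))); rewrite ler_nat.
apply: (@le_trans _ _ (`|M| + 1)); first by rewrite (le_trans (ler_norm M))// lerDl.
have := @ge0_ler_powR R a (ltW a0) ((`|M| + 1) `^ a^-1) k%:R.
rewrite !nnegrE powR_ge0 ler0n => /(_ isT isT h).
by rewrite -powRrM mulVf ?gt_eqF// powRr1// ltW.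
Qed.

(** In a subsequence of the example, the terms of index i, ..., i + K i - 1 all
    have an i-th level, on which saturation makes their sum as large as
    K i * 2 ^ - i / 16. The centring of all the levels subtracts at most
    2 / psi 1 from each term, which the size of c i absorbs. A p-BS bound C
    would give 2 ^ i <= 64 C for every i. *)
Lemma saturated_notin_Gamma (p : R) : 1 < p ->
  (forall (K : nat) (ka : R), (2 <= K)%N -> 0 < ka ->
  exists rho : nat, [/\ (0 < rho)%N, rho%:R^-1 <= ka & saturated psi K rho]) ->
  ~ Gamma_i N p.
Proof.
move=> p1 sat [_ Gp]; have p0 : 0 < p by apply: lt_trans p1.
have ps1 := psi1_gt0 psi.
have ip1 : p^-1 < 1 by rewrite invf_lt1.
have p2 k : 0 < (2^-1 : R) ^+ k by rewrite exprn_gt0// invr_gt0.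
have a0 : 0 < 1 - p^-1 by rewrite subr_gt0.
have /choice[K KP] : forall i, exists K : nat, (i + 2 <= K)%N /\
    4 ^+ i <= K%:R `^ (1 - p^-1) :> R.
  move=> i; have [K0 hK0] := powR_large (4 ^+ i) a0.
  exists (maxn K0 (i + 2)); split; first exact: leq_maxr.
  by apply: hK0; exact: leq_maxl.
have K0 i : 0 < (K i)%:R :> R by rewrite ltr0n; have [h _] := KP i; lia.
have K2 i : (2 <= K i)%N by have [h _] := KP i; lia.
have /choice[rho rhoP] : forall i, exists rho : nat, [/\ (0 < rho)%N,
    psi rho%:R^-1 <= 2^-1 ^+ i * psi 1 / (4 * (K i)%:R) & saturated psi (K i) rho].
  move=> i; have e0 : 0 < 2^-1 ^+ i * psi 1 / (4 * (K i)%:R).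
    by rewrite divr_gt0 ?mulr_gt0.
  have [ka /andP[ka0 ka1] kaP] := psi_small psi e0.
  have [rho [h1 h2 h3]] := sat (K i) ka (K2 i) ka0.
  exists rho; split => //; apply: kaP; rewrite h2 andbT.
  by rewrite invr_ge0.
have rho0 i : (0 < rho i)%N by have [] := rhoP i.
pose u i : R := (rho i)%:R^-1.
have u01 i : 0 < u i <= 1 by exact: inv_nat01.
have pu i : 0 < psi (u i) by exact: psi_gt0.
pose c i : R := 2^-1 ^+ i / psi (u i).
have c0 i : 0 <= c i by rewrite divr_ge0// ltW.
have cpsi i : c i * psi (u i) = 2^-1 ^+ i by rewrite /c divfK// gt_eqF.
have hc i : c i * psi (rho i)%:R^-1 <= 2^-1 ^+ i by rewrite cpsi.
have cbig i : 4 * (K i)%:R / psi 1 <= c i.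
  have [_ h _] := rhoP i.
  rewrite /c ler_pdivlMr// mulrAC ler_pdivrMr// mulrC -ler_pdivlMr ?mulr_gt0//.
have wn := example_weakly_null rho0 c0 hc.
have [y [f fm ->] [_ BS]] := Gp _ wn (example_independent c rho0).
have ss : subsequence (example rho c \o f) (example rho c \o f) by exists id.
have {BS ss} := BS _ ss.
set s := ereal_sup _ => sfin.
have fge := increasing_geq fm.
have finj := increasing_inj fm.
pose X := example rho c.
have fX n : function_space N (X n) := example_fsp psi rho0 c0 n.
have bound : exists2 C : R, 0 <= C & forall j : nat,
    (N (fun t => (\sum_(k < j) X (f k) t)%R) <= (C * j%:R `^ p^-1)%:E)%E.
  have s0 j : (0 < j)%N -> ((j%:R `^ (- p^-1))%:E *
      N (fun t => (\sum_(k < j) X (f k) t)%R) <= s)%E.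
    by move=> j0; apply: ereal_sup_ubound; exists j.
  have sge0 : (0 <= s)%E.
    apply: le_trans (s0 1%N isT); apply: mule_ge0; last exact: norm_ge0.
    by rewrite lee_fin powR_ge0.
  have sf : s \is a fin_num by rewrite ge0_fin_numE.
  exists (fine s); first exact: fine_ge0.
  move=> [|j].
    apply: (@le_trans _ _ 0%E).
      rewrite -(norm0 psi); apply: norm_mono => //.
        apply: (@eq_measurable_fun _ _ _ _ _ (fun=> 0 : R)) => // t _.
        by rewrite big_ord0.
      by move=> t _; rewrite big_ord0.
    by rewrite lee_fin mulr_ge0 ?fine_ge0// powR_ge0.
  have := s0 j.+1 isT; rewrite -(fineK sf).
  have fxk (k : 'I_j.+1) : function_space N (X (f k)) by exact: fX.
  rewrite -(fineK (fsp_fin (fsp_sum fxk))) -EFinM !lee_fin.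
  by rewrite powRN mulrC ler_pdivrMr// powR_gt0// ltr0n.
have [C C0 hC] := bound.
have final i : 2 ^+ i <= 64 * C :> R.
  have [iK iKp] := KP i; have [_ _ sati] := rhoP i.
  set k0 := K i in iK iKp sati.
  have k0p : 0 < k0%:R :> R by exact: K0.
  pose A k : set R := block rho (f (i + k)) i.
  have iA : independent_events A.
    apply: (block_independent rho0 (f := fun k => f (i + k)) i).
    by move=> a b /finj /addnI.
  have Au k : (k < k0)%N -> pr (A k) = (rho i)%:R^-1.
    move=> _; apply: block_pr => //.
    by apply: (leq_trans _ (fge _)); exact: leq_addr.
  pose S t : R := \sum_(k < k0) X (f (i + k)) t.
  have fxk (k : 'I_k0) : function_space N (X (f (i + k))) by exact: fX.
  have fS : function_space N S by exact: fsp_sum fxk.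
  have lower : ((c i * k0%:R * psi (u i) / 16)%:E <= N S)%E.
    apply: sati iA Au (fsp_measurable fS) (c0 i) _ => t It h1.
    have Xge (k : 'I_k0) : c i * \1_(A k) t - 2 / psi 1 <= X (f (i + k)) t.
      set n := f (i + k); have ni : (i < n.+1)%N.
        by rewrite ltnS; apply: (leq_trans _ (fge _)); exact: leq_addr.
      have -> : X n t = \sum_(q < n.+1) c q * \1_(block rho n q) t -
          \sum_(q < n.+1) c q * u q.
        by rewrite -sumrB; apply: eq_bigr => q _; rewrite -mulrBr.
      apply: lerB.
        rewrite (bigD1 (Ordinal ni))//= lerDl sumr_ge0// => q _.
        by rewrite mulr_ge0.
      apply: (@le_trans _ _ (\sum_(q < n.+1) 2^-1 ^+ q / psi 1)).
        apply: ler_sum => q _; rewrite /c mulrAC ler_pdivrMr//.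
        rewrite mulrAC -mulrA ler_wpM2l ?(ltW (p2 _))//.
        rewrite ler_pdivlMr//; apply: psi_ge_lin.
        by have /andP[h ->] := u01 q; rewrite ltW.
      rewrite -mulr_suml ler_wpM2r ?invr_ge0 ?(ltW ps1)//.
      have := geo2_le 0 n.+1 (R := R); rewrite big_mkord expr0 mulr1; exact.
    apply: (@le_trans _ _ (\sum_(k < k0) (c i * \1_(A k) t - 2 / psi 1))); last first.
      by apply: ler_sum => k _; exact: Xge.
    rewrite sumrB sumr_const card_ord -mulr_sumr -/(hits A k0 t) lerD2l lerN2.
    rewrite -mulr_natr ler_pdivlMr//; have := cbig i; rewrite -/k0.
    by apply: le_trans; rewrite le_eqVlt; apply/orP; left; apply/eqP; field; rewrite gt_eqF.
  have upper : (N S <= (4 * C * k0%:R `^ p^-1)%:E)%E.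
    (* the sum from i to i + k0 is a difference of two initial sums; as i <= k0,
       both have at most 2 * k0 terms *)
    pose S1 t : R := \sum_(k < i + k0) X (f k) t.
    pose S2 t : R := \sum_(k < i) X (f k) t.
    have mS1 : measurable_fun I01 S1.
      by apply: measurable_sum_fun => k; exact: (fsp_measurable (fX _)).
    have mS2 : measurable_fun I01 S2.
      by apply: measurable_sum_fun => k; exact: (fsp_measurable (fX _)).
    apply: (@le_trans _ _ (N S1 + N S2)%E).
      apply: norm_triangle => //; first exact: (fsp_measurable fS).
      move=> t _; have -> : S t = S1 t - S2 t.
        by rewrite /S1 big_split_ord/= -/(S2 t) addrAC subrr add0r.
      exact: ler_normB.
    apply: le_trans (leeD (hC _) (hC _)) _; rewrite -EFinD lee_fin.
    have k2 : (2 * k0%:R) `^ p^-1 <= 2 * k0%:R `^ p^-1 :> R.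
      rewrite powRM// ler_wpM2r ?powR_ge0//.
      have := @ler_powR R 2 _ p^-1 1 (ltW ip1); rewrite powRr1//; apply.
      by rewrite ler1n.
    have mono (j : nat) : (j <= 2 * k0)%N -> j%:R `^ p^-1 <= (2 * k0%:R) `^ p^-1 :> R.
      move=> jk; apply: ge0_ler_powR; rewrite ?nnegrE ?invr_ge0 ?(ltW p0)//.
      by rewrite -natrM ler_nat.
    have ik : (i <= k0)%N := leq_trans (leq_addr 2 i) iK.
    have ik1 : (i + k0 <= 2 * k0)%N by rewrite mul2n -addnn leq_add2r.
    have ik2 : (i <= 2 * k0)%N by apply: leq_trans ik1; exact: leq_addr.
    have m1 := mono _ ik1; have m2 := mono _ ik2.
    have : C * (i + k0)%:R `^ p^-1 <= C * (2 * k0%:R `^ p^-1).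
      by rewrite ler_wpM2l// (le_trans m1).
    have : C * i%:R `^ p^-1 <= C * (2 * k0%:R `^ p^-1).
      by rewrite ler_wpM2l// (le_trans m2).
    lra.
  have := le_trans lower upper; rewrite lee_fin [c i * _ * _]mulrAC cpsi => h.
  (* divide by the power of k0 and by 2^-i *)
  have kp : 0 < k0%:R `^ p^-1 :> R by rewrite powR_gt0.
  have kk : k0%:R = k0%:R `^ (1 - p^-1) * k0%:R `^ p^-1 :> R.
    by rewrite -powRD ?subrK ?powRr1// implybE gt_eqF ?orbT.
  have h2 : 2^-1 ^+ i * k0%:R `^ (1 - p^-1) / 16 <= 4 * C.
    rewrite -(ler_pM2r kp); apply: le_trans h; rewrite [in leRHS]kk.
    by rewrite le_eqVlt; apply/orP; left; apply/eqP; ring.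
  have h3 : 2^-1 ^+ i * 4 ^+ i <= 2^-1 ^+ i * k0%:R `^ (1 - p^-1).
    by rewrite ler_wpM2l// ltW.
  rewrite -exprMn (_ : 2^-1 * 4 = 2 :> R) in h3; last by field.
  lra.
pose n := Num.truncn (64 * C).
have := truncnS_gt (64 * C); rewrite -/n ltNge => /negP; apply.
apply: le_trans (final n); rewrite -natrX ler_nat.
exact: ltn_expl.
Qed.

End necessity.

(** * Iterating the two conditions *)

Section dilation_indices.
Context {R : realType} (psi : Psi R).

Lemma limsup_small (f : R -> R) (a : R) :
  (limf_esup (fun u => (f u)%:E) 0^'+ < a%:E)%E ->
  exists q ka : R, [/\ q < a, 0 < ka & forall u, 0 < u -> u < ka -> f u <= q].
Proof.
move=> /ereal_inf_lt[_ [V V0 <-] Va].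
move: V0 => [d /= d0 dV].
have Vd u : 0 < u -> u < d -> V u.
  move=> u0 ud; apply: dV => //=.
  by rewrite sub0r normrN gtr0_norm.
have fs u : 0 < u -> u < d -> ((f u)%:E <= ereal_sup [set (f u)%:E | u in V])%E.
  by move=> u0 ud; apply: ereal_sup_ubound; exists u => //; exact: Vd.
have d2 : 0 < d / 2 by rewrite divr_gt0.
have dd : d / 2 < d by rewrite ltr_pdivrMr// ltr_pMr// ltr1n.
have := fs _ d2 dd; case E : (ereal_sup _) => [q| |]; [move=> _| |].
- exists q, d; split => //; first by rewrite -lte_fin -E.
  by move=> u u0 ud; rewrite -lee_fin -E; exact: fs.
- by move: Va; rewrite E.
- by rewrite leeNy_eq.
Qed.

(** Both conditions of the theorem, with a common ratio r. Taking r at least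
    1 / k allows factors k ^ - n to be absorbed in r ^ n. *)
Definition upper_indices (k l : nat) (r u0 : R) := [/\ 0 < u0 < 1, 0 < r < 1,
  1 <= r * k%:R,
  forall u, 0 < u -> u <= u0 -> psi (k%:R * u) <= r * k%:R * psi u &
  forall u, 0 < u -> u <= u0 -> psi (u ^+ l) <= r * psi u].

Lemma upper_indices_of_limsup (k l : nat) : (2 <= k)%N ->
  (limf_esup (fun u : R => (psi (k%:R * u) / psi u)%:E) 0^'+ < k%:R%:E)%E ->
  (limf_esup (fun u : R => (psi (u ^+ l) / psi u)%:E) 0^'+ < 1%:E)%E ->
  exists r u0, upper_indices k l r u0.
Proof.
move=> k2 /limsup_small[q [d [qk d0 qd]]] /limsup_small[c [d' [c1 d'0 cd]]].
have k0 : (0 : R) < k%:R by rewrite ltr0n (leq_trans _ k2).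
have k1 : k%:R^-1 < 1 :> R by rewrite invf_lt1// ltr1n.
pose r := Num.max (q / k%:R) (Num.max c k%:R^-1).
pose u0 := Num.min (d / 2) (Num.min (d' / 2) (1 / 2)).
have u0d : u0 < d.
  by apply: (@le_lt_trans _ _ (d / 2)); [rewrite ge_min lexx|rewrite ltr_pdivrMr// ltr_pMr// ltr1n].
have u0d' : u0 < d'.
  by apply: (@le_lt_trans _ _ (d' / 2)); [rewrite !ge_min lexx orbT|rewrite ltr_pdivrMr// ltr_pMr// ltr1n].
have u01 : u0 < 1.
  by apply: (@le_lt_trans _ _ (1 / 2)); [rewrite !ge_min lexx !orbT|rewrite ltr_pdivrMr// mul1r ltr1n].
have rk : k%:R^-1 <= r by rewrite !le_max lexx !orbT.
exists r, u0; split.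
- by rewrite u01 andbT !lt_min !divr_gt0.
- rewrite (lt_le_trans _ rk) ?invr_gt0//= !gt_max c1 k1 !andbT.
  by rewrite ltr_pdivrMr// mul1r.
- by rewrite -ler_pdivrMr// mul1r.
- move=> u up uu; have pu : 0 < psi u by apply: psi_gt0; rewrite up (le_trans uu)// ltW.
  rewrite -ler_pdivrMr//; apply: le_trans (qd u up (le_lt_trans uu u0d)) _.
  by rewrite -ler_pdivrMr// le_max lexx.
- move=> u up uu; have pu : 0 < psi u by apply: psi_gt0; rewrite up (le_trans uu)// ltW.
  rewrite -ler_pdivrMr//; apply: le_trans (cd u up (le_lt_trans uu u0d')) _.
  by rewrite !le_max lexx orbT.
Qed.

Variables (k l : nat) (r u0 : R).
Hypotheses (k2 : (2 <= k)%N) (l2 : (2 <= l)%N) (ui : upper_indices k l r u0).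

Let k1 : 1 <= k%:R :> R. Proof. by rewrite ler1n (leq_trans _ k2). Qed.
Let k0 : 0 < k%:R :> R. Proof. exact: lt_le_trans k1. Qed.

Lemma dilation_iter n u : 0 < u -> k%:R ^+ n * u <= u0 ->
  psi (k%:R ^+ n * u) <= (r * k%:R) ^+ n * psi u.
Proof.
case: ui => /andP[u00 u01] /andP[r0 r1] rk h _ up.
elim: n => [|n IH] nu; first by rewrite !expr0 !mul1r.
have nu' : k%:R ^+ n * u <= u0.
  apply: le_trans nu; rewrite ler_wpM2r ?(ltW up)//.
  by rewrite ler_weXn2l.
rewrite exprS -mulrA; apply: le_trans (h _ _ nu') _.
  by rewrite mulr_gt0// exprn_gt0.
rewrite [in leRHS]exprS -[leRHS]mulrA ler_wpM2l ?IH//.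
by rewrite mulr_ge0// ltW.
Qed.

Lemma power_iter n u : 0 < u -> u <= u0 ->
  psi (u ^+ (l ^ n)) <= r ^+ n * psi u.
Proof.
case: ui => /andP[u00 u01] /andP[r0 r1] rk _ h up uu.
elim: n => [|n IH]; first by rewrite expn0 expr1 expr0 mul1r.
rewrite expnSr exprM; have ln0 : (0 < l ^ n)%N by rewrite expn_gt0 (leq_trans _ l2).
apply: le_trans (h _ _ _) _; first by rewrite exprn_gt0.
  apply: (le_trans _ uu); rewrite -[leRHS]expr1.
  by apply: ler_wiXn2l => //; rewrite ?(ltW up)// (le_trans uu)// ltW.
by rewrite exprS -[leRHS]mulrA ler_wpM2l ?(ltW r0).
Qed.

(** The first condition also bounds psi from below, because psi v >= v * psi 1
    at the point v = k ^ n * t. *)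
Lemma lin_le_psi n t : 0 < t -> k%:R ^+ n * t <= u0 ->
  t * psi 1 <= r ^+ n * psi t.
Proof.
move=> t0 nt; case: (ui) => /andP[u00 u01] _ _ _ _.
have kn : 0 < k%:R ^+ n :> R by rewrite exprn_gt0.
have := dilation_iter t0 nt; rewrite exprMn.
have : k%:R ^+ n * t * psi 1 <= psi (k%:R ^+ n * t).
  by apply: psi_ge_lin; rewrite mulr_ge0 ?(ltW kn) ?(ltW t0)//= (le_trans nt)// ltW.
move=> h1 h2; rewrite -(ler_pM2l kn) mulrA.
by apply: (le_trans h1); rewrite (le_trans h2)// mulrCA mulrA.
Qed.

(** The space is strictly smaller than L1, in the quantitative form in which the
    gliding hump for tails uses it. *)
Lemma psi_ratio_unbounded (M : R) : exists ka : R, 0 < ka /\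
  forall t, 0 < t -> t <= ka -> M * t <= psi t.
Proof.
case: (ui) => /andP[u00 u01] /andP[r0 r1] _ _ _; have p1 := psi1_gt0 psi.
have M1 : 0 < `|M| + 1 by rewrite ltr_wpDl.
have r01 : 0 < r < 1 by rewrite r0.
have e0 : 0 < psi 1 / (`|M| + 1) by rewrite divr_gt0.
have [n [_ rn]] := expr_small r01 e0.
exists (u0 / k%:R ^+ n); split; first by rewrite divr_gt0// exprn_gt0.
move=> t t0 tk.
have nt : k%:R ^+ n * t <= u0 by rewrite mulrC -ler_pdivlMr// exprn_gt0.
have := lin_le_psi t0 nt.
have pt : 0 <= psi t.
  apply: psi_ge0; rewrite ltW//=; apply: le_trans (ltW u01).
  apply: le_trans nt; rewrite ler_peMl ?(ltW t0)//.
  by rewrite exprn_ege1.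
move=> h; have h2 : t * psi 1 <= psi 1 / (`|M| + 1) * psi t.
  by apply: (le_trans h); rewrite ler_wpM2r.
have : t * psi 1 * (`|M| + 1) <= psi 1 * psi t.
  by rewrite -ler_pdivlMr// mulrAC.
rewrite [t * _]mulrC -mulrA ler_pM2l// => {}h.
apply: le_trans h; rewrite mulrC ler_wpM2l ?(ltW t0)//.
by rewrite (le_trans (ler_norm M))// lerDl.
Qed.

End dilation_indices.

(** * Rare events *)

Section sums_of_independent_indicators.
Context {R : realType} (psi : Psi R).
Local Notation I01 := (`[0%R, 1%R]%classic : set R).
Local Notation m := (@lebesgue_measure R).
Local Notation N := (Lorentz_norm psi).

Lemma hitsE (A : nat -> set R) j t :
  hits A j t = (\sum_(k < j) (t \in A k))%N%:R.
Proof. by rewrite /hits natr_sum; apply: eq_bigr => k _; rewrite indicE. Qed.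

Let sum_levels (n M : nat) : (\sum_(a < M) (a.+1 <= n)%N = minn n M)%N.
Proof.
elim: M => [|M IH]; first by rewrite big_ord0 minn0.
by rewrite big_ord_recr/= IH; case: (ltnP M n) => h; lia.
Qed.

Lemma mhits_level (A : nat -> set R) j (a : R) :
  (forall i, measurable (I01 `&` A i)) ->
  measurable (I01 `&` [set t | a <= hits A j t]).
Proof. by move=> mA; apply: mlevel; exact: hits_measurable. Qed.

Lemma sum_levels_pr (A : nat -> set R) j M :
  (forall i, measurable (I01 `&` A i)) ->
  \sum_(a < M) pr [set t | a.+1%:R <= hits A j t] <= \sum_(k < j) pr (A k).
Proof.
move=> mA; pose L a := [set t | a.+1%:R <= hits A j t].
have mL a : measurable (I01 `&` L a) by exact: mhits_level.
have sumE n (C : nat -> set R) : (forall i, measurable (I01 `&` C i)) ->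
    ((\sum_(k < n) pr (C k))%:E = \int[m]_(t in I01) (\sum_(k < n) (\1_(C k) t)%:E))%E.
  move=> mC; rewrite (@ge0_integral_sum _ _ _ m _ mI01 _ (fun (k : 'I_n) t => (\1_(C k) t)%:E)).
  - rewrite -sumEFin; apply: eq_bigr => k _.
    have := int_indicI ler01 (mC k); rewrite mul1r => <-.
    by apply: eq_integral => t _; rewrite mul1r.
  - by move=> k; apply/measurable_EFinP; exact: measurable_indicI.
  - by move=> k t _; rewrite lee_fin indicE.
rewrite -lee_fin (sumE M L)// (sumE j A)//; apply: ge0_le_integral.
- exact: mI01.
- by move=> t _; apply: sume_ge0 => k _; rewrite lee_fin indicE.
- by apply: emeasurable_sum => k; apply/measurable_EFinP; exact: measurable_indicI.
- by apply: emeasurable_sum => k; apply/measurable_EFinP; exact: measurable_indicI.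
move=> t _; rewrite !sumEFin lee_fin -/(hits A j t) hitsE.
rewrite (eq_bigr (fun a : 'I_M => (a.+1 <= \sum_(k < j) (t \in A k))%N%:R)).
  by rewrite -natr_sum ler_nat sum_levels geq_minl.
move=> a _; rewrite indicE.
have -> // : (t \in L a) = (a.+1 <= \sum_(k < j) (t \in A k))%N.
by apply/idP/idP; rewrite inE /L/= hitsE ler_nat.
Qed.

(** The layers of the counting function, up to M; above M it is only bounded by
    its maximum. *)
Lemma norm_hits_le (A : nat -> set R) (j M : nat) (J : R) :
  (forall i, measurable (I01 `&` A i)) -> j%:R <= J ->
  (N (hits A j) <= (\sum_(a < M) psi (pr [set t | a.+1%:R <= hits A j t]) +
     J * psi (pr [set t | M%:R <= hits A j t]))%:E)%E.
Proof.
move=> mA jJ; have J0 : 0 <= J by rewrite (le_trans _ jJ).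
pose L a := [set t | a.+1%:R <= hits A j t].
have mL a : measurable (I01 `&` L a) by exact: mhits_level.
pose H := [set t | M%:R <= hits A j t].
have mH : measurable (I01 `&` H) by exact: mhits_level.
have mS : measurable_fun I01 (fun t => \sum_(a < M) (\1_(L a) t : R)).
  exact: (measurable_sum_fun (f := fun (a : 'I_M) t => \1_(L a) t : R) (fun a => measurable_indicI (mL a))).
have mJ : measurable_fun I01 (fun t => J * \1_H t).
  by apply: measurable_funM => //; exact: measurable_indicI.
apply: (@le_trans _ _ (N (fun t => \sum_(a < M) (\1_(L a) t : R))%R +
    N (fun t => (J * \1_H t)%R))%E).
  apply: norm_triangle => //; first exact: hits_measurable.
  move=> t _; rewrite !ger0_norm; [|by rewrite mulr_ge0|by apply: sumr_ge0 => a _; rewrite indicE|exact: hits_ge0].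
  have [h|h] := leP M%:R (hits A j t).
    rewrite [X in _ <= _ + _ * X]indicE mem_set//= mulr1 (le_trans (hits_le A j t))//.
    by rewrite (le_trans jJ)// lerDr; apply: sumr_ge0 => a _; rewrite indicE.
  rewrite [X in _ <= _ + _ * X]indicE memNset/=; last by rewrite /H/= leNgt h.
  rewrite mulr0 addr0 hitsE; move: h; rewrite hitsE ltr_nat => h.
  rewrite (eq_bigr (fun a : 'I_M => (a.+1 <= \sum_(k < j) (t \in A k))%N%:R)).
    by rewrite -natr_sum ler_nat sum_levels (minn_idPl (ltnW h)).
  move=> a _; rewrite indicE.
  have -> // : (t \in L a) = (a.+1 <= \sum_(k < j) (t \in A k))%N.
  by apply/idP/idP; rewrite inE /L/= hitsE ler_nat.
rewrite EFinD; apply: leeD.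
  apply: (@le_trans _ _ (\sum_(a < M) N (\1_(L a) : R -> R))%E).
    apply: norm_le_sum => // [a|t _]; first exact: measurable_indicI.
    exact: ler_norm_sum.
  rewrite -sumEFin; apply: lee_sum => a _; rewrite -[psi _]mul1r.
  apply: norm_le_level; [exact: measurable_indicI|exact: mL| |exact: ler01].
  by move=> t _; rewrite mul1r ger0_norm// indicE.
apply: norm_le_level => // t _.
by rewrite ger0_norm// mulr_ge0.
Qed.

Lemma expR_half : expR (1 : R) <= 4.
Proof.
have h : expR (1 / 2 : R) <= 2.
  by apply: le_trans (expR_quad (lexx _)) _; rewrite expr2; lra.
have -> : (1 : R) = 1 / 2 + 1 / 2 by lra.
rewrite expRD; have := expR_gt0 (1 / 2 : R); nra.
Qed.

Variables (k l : nat) (r u0 : R).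
Hypotheses (k2 : (2 <= k)%N) (l2 : (2 <= l)%N) (ui : upper_indices psi k l r u0).

Let k1 : 1 <= k%:R :> R. Proof. by rewrite ler1n (leq_trans _ k2). Qed.
Let k0 : 0 < k%:R :> R. Proof. exact: lt_le_trans k1. Qed.

(** With K = k ^ n, there are 2 b levels below 2 b hits, where 2 b is a fraction
    1 / K of the admissible number of events. Their probabilities add up to at
    most 2 b * K t, so on average psi of them is comparable to
    psi (K t) <= (r k) ^ n psi t, and the factor k ^ n cancels. The probability
    of 2 b hits is at most t ^ b by Chernoff's bound, and since b >= l ^ n the
    second condition applies to it. *)
Lemma centred_rare (n b j : nat) (A : nat -> set R) (t : R) :
  independent_events A -> (0 < b)%N -> (l ^ n <= b)%N ->
  (j <= 2 * k ^ n * b)%N -> 0 < t -> k%:R ^+ n * t <= u0 ->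
  16 * k%:R ^+ (2 * n) * t <= 1 ->
  (forall i, (i < j)%N -> pr (A i) <= t) ->
  (N (centred A j) <= (4 * (2 * k ^ n * b)%N%:R * r ^+ n * psi t)%:E)%E.
Proof.
move=> iA b0 lb jJ t0 Kt0 K2t At; have [mA _] := iA.
have [/andP[u00 u01] /andP[r0 r1] _ _ _] := ui.
set K : R := k%:R ^+ n in Kt0.
have K0 : 0 < K by rewrite exprn_gt0.
have K1 : 1 <= K by rewrite exprn_ege1.
have Kt : 0 < K * t by rewrite mulr_gt0.
pose J : R := (2 * k ^ n * b)%N%:R; rewrite -/J; have JE : J = 2 * K * b%:R by rewrite /J !natrM natrX.
have bR : 0 < b%:R :> R by rewrite ltr0n.
have jJR : j%:R <= J by rewrite ler_nat.
have J0 : 0 <= J by [].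
have t1 : t <= u0 by apply: le_trans Kt0; rewrite ler_peMl// ltW.
have t01 : 0 <= t <= 1 by rewrite ltW//= (le_trans t1)// ltW.
have sumA : \sum_(i < j) pr (A i) <= J * t.
  apply: (@le_trans _ _ (\sum_(i < j) t)); first by apply: ler_sum => i _; exact: At.
  by rewrite sumr_const card_ord -mulr_natl ler_wpM2r// ltW.
have pt : 0 <= psi t by exact: psi_ge0.
have rn : 0 < r ^+ n by rewrite exprn_gt0.
have lin := lin_le_psi k2 ui t0 Kt0.
have few : \sum_(a < 2 * b) psi (pr [set s | a.+1%:R <= hits A j s]) <= 2 * J * r ^+ n * psi t.
  apply: (@le_trans _ _ (\sum_(a < 2 * b)
      (1 + pr [set s | a.+1%:R <= hits A j s] / (K * t)) * psi (K * t))).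
    apply: ler_sum => a _; apply: psi_le_scale; first by apply: pr01; exact: mhits_level.
    by rewrite Kt/= (le_trans Kt0)// ltW.
  rewrite -mulr_suml big_split/= sumr_const card_ord -mulr_suml.
  have h1 : (\sum_(a < 2 * b) pr [set s | a.+1%:R <= hits A j s]) / (K * t) <= 2 * b%:R.
    rewrite ler_pdivrMr//; apply: le_trans (sum_levels_pr j (2 * b) mA) _.
    by apply: (le_trans sumA); rewrite JE; lra.
  have h2 := dilation_iter k2 ui t0 Kt0; rewrite exprMn -/K in h2.
  have h3 : 0 <= psi (K * t) by apply: psi_ge0; rewrite (ltW Kt)/= (le_trans Kt0)// ltW.
  apply: (@le_trans _ _ (4 * b%:R * psi (K * t))).
    rewrite ler_wpM2r// -[1 *+ (2 * b)]/((2 * b)%N%:R) natrM; lra.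
  apply: (@le_trans _ _ (4 * b%:R * (r ^+ n * K * psi t))).
    by rewrite ler_wpM2l// mulr_ge0.
  by rewrite JE le_eqVlt; apply/orP; left; apply/eqP; ring.
have many : psi (pr [set s | (2 * b)%N%:R <= hits A j s]) <= r ^+ n * psi t.
  (* with this la, exp (la * hits) has expectation at most exp (2 b) *)
  pose la := ln (1 + (K * t)^-1).
  have iKt : 0 < (K * t)^-1 by rewrite invr_gt0.
  have elaE : expR la = 1 + (K * t)^-1 by rewrite lnK// posrE addr_gt0.
  have la0 : 0 < la by rewrite ln_gt0// ltrDl.
  have pb : pr [set s | (2 * b)%N%:R <= hits A j s] <= t ^+ b.
    have -> : [set s | (2 * b)%N%:R <= hits A j s] =
        [set s | (2 * b)%N%:R * la <= la * hits A j s].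
      by apply/seteqP; split => s /=; rewrite [la * _]mulrC ler_pM2r.
    apply: le_trans (markov_exp _ _ _ iA) _.
    rewrite -mulrN expRM_natl.
    have h1 : \prod_(i < j) (1 + (expR la - 1) * pr (A i)) <= expR 1 ^+ (2 * b).
      rewrite elaE addrC addKr -expRM_natl mulr1.
      apply: (@le_trans _ _ (\prod_(i < j) expR ((K * t)^-1 * pr (A i)))).
        apply: ler_prod => i _; rewrite expR_ge1Dx andbT.
        by rewrite addr_ge0// mulr_ge0 ?pr_ge0// ltW.
      rewrite -expR_sum ler_expR -mulr_sumr ler_pdivrMl//.
      apply: (le_trans sumA); rewrite JE natrM; lra.
    have h2 : expR (- la) <= K * t.
      rewrite expRN elaE -[leRHS]invrK lef_pV2 ?posrE ?addr_gt0//.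
      by rewrite lerDr.
    apply: (@le_trans _ _ ((K * t) ^+ (2 * b) * 4 ^+ (2 * b))).
      apply: ler_pM.
      - by rewrite exprn_ge0// expR_ge0.
      - by apply: prodr_ge0 => i _; rewrite addr_ge0// mulr_ge0 ?pr_ge0// elaE addrC addKr ltW.
      - by rewrite lerXn2r ?nnegrE ?expR_ge0// ltW.
      - apply: (le_trans h1); rewrite lerXn2r ?nnegrE ?expR_ge0//; exact: expR_half.
    rewrite -exprMn exprM lerXn2r ?nnegrE ?exprn_ge0//.
    - by rewrite mulr_ge0// ltW.
    - by rewrite ltW.
    have -> : (K * t * 4) ^+ 2 = (16 * k%:R ^+ (2 * n) * t) * t.
      by rewrite mulnC exprM -/K; ring.
    by rewrite ler_piMl// ltW.
  have tb : 0 < t ^+ b by rewrite exprn_gt0.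
  apply: (@le_trans _ _ (psi (t ^+ (l ^ n)))); last exact: (power_iter l2 ui).
  apply: psi_mono; first exact: pr_ge0.
    apply: (le_trans pb); apply: ler_wiXn2l => //; first exact: ltW.
    by case/andP: t01.
  by rewrite exprn_ile1// ?(ltW t0)//; case/andP: t01.
have mh := hits_measurable j mA.
apply: (@le_trans _ _ (N (hits A j) + N (fun=> (\sum_(i < j) pr (A i))%R))%E).
  apply: norm_triangle => //; first exact: centred_measurable.
  by move=> s _; exact: ler_normB.
apply: (@le_trans _ _ ((2 * J * r ^+ n * psi t + J * (r ^+ n * psi t))%:E +
    (J * t * psi 1)%:E)%E).
  apply: leeD.
    apply: le_trans (norm_hits_le (2 * b) mA jJR) _; rewrite lee_fin lerD//.
    by rewrite ler_wpM2l.
  apply: le_trans (norm_cst psi _) _; rewrite lee_fin ger0_norm; last first.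
    by apply: sumr_ge0 => i _; exact: pr_ge0.
  by rewrite ler_wpM2r// ltW// psi1_gt0.
have : J * (t * psi 1) <= J * (r ^+ n * psi t) by rewrite ler_wpM2l.
rewrite -EFinD lee_fin; lra.
Qed.

End sums_of_independent_indicators.

(** * The improved bound for centred sums *)

Section block_estimate.
Context {R : realType} (psi : Psi R).
Local Notation I01 := (`[0%R, 1%R]%classic : set R).
Local Notation m := (@lebesgue_measure R).
Local Notation N := (Lorentz_norm psi).

Lemma centred_null (A : nat -> set R) j : independent_events A ->
  (forall i, (i < j)%N -> pr (A i) = 0) -> N (centred A j) = 0%E.
Proof.
move=> iA A0; have [mA _] := iA; apply/eqP; rewrite eq_le norm_ge0 andbT.
apply: (@le_trans _ _ (\sum_(k < j) N (\1_(A k) : R -> R))%E).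
  apply: norm_le_sum => [|i|t _]; [exact: centred_measurable|exact: measurable_indicI|].
  rewrite /centred [X in _ - X]big1 ?subr0; first exact: ler_norm_sum.
  by move=> i _; exact: A0.
rewrite big1// => i _; apply/eqP; rewrite eq_le norm_ge0 andbT.
have := @norm_le_level _ psi (\1_(A i)) (A i) 1.
rewrite A0// Psi0 mulr0; apply => //; first exact: measurable_indicI.
by move=> t _; rewrite mul1r ger0_norm// indicE.
Qed.

Variables (k l : nat) (r u0 : R).
Hypotheses (k2 : (2 <= k)%N) (l2 : (2 <= l)%N) (ui : upper_indices psi k l r u0).

Let k1 : 1 <= k%:R :> R. Proof. by rewrite ler1n (leq_trans _ k2). Qed.
Let k0 : 0 < k%:R :> R. Proof. exact: lt_le_trans k1. Qed.

(** Let J be the admissible number of events. The centred sum reaches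
    J / k ^ (3 n) with a probability so small that, by the second condition, psi
    of it is at most k ^ - (3 n) * psi 1. Hence the norm is at most a multiple
    of J * k ^ - (3 n); here psi t, being at least v * k ^ - (2 n) * psi 1,
    accounts for k ^ - (2 n), and k ^ - n <= r ^ n is what is gained. *)
Lemma centred_common (n e D j : nat) (A : nat -> set R) (t v : R) :
  r ^+ e <= (k%:R ^+ 3)^-1 -> 2 * expR (- (D%:R / 4)) <= u0 -> (0 < n)%N ->
  (0 < e)%N -> (0 < D)%N ->
  independent_events A -> (j <= 2 * (k ^ 6 * l ^ e * D) ^ n)%N ->
  0 < v -> v / k%:R ^+ (2 * n) <= t -> t <= 1 ->
  (N (centred A j) <=
    (2 / v * (2 * (k ^ 6 * l ^ e * D) ^ n)%N%:R * r ^+ n * psi t)%:E)%E.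
Proof.
move=> re De n0 e0 D0 iA jJ v0 vt t1; have [mA _] := iA.
have [/andP[u00 u01] /andP[r0 r1] rk _ _] := ui.
have l0 : (0 < l)%N by rewrite (leq_trans _ l2).
pose x := (l ^ (e * n) * D ^ n)%N.
pose J : R := (2 * (k ^ 6 * l ^ e * D) ^ n)%N%:R; rewrite -/J.
have JE : J = 2 * (k%:R ^+ (3 * n)) ^+ 2 * x%:R.
  have jn : (2 * (k ^ 6 * l ^ e * D) ^ n = 2 * (k ^ (3 * n)) ^ 2 * x)%N.
    rewrite /x (expnMn (k ^ 6 * l ^ e) D) (expnMn (k ^ 6) (l ^ e)).
    by rewrite -!(expnM k) -(expnM l) -!mulnA; congr (_ * (_ ^ _ * _))%N; rewrite [RHS]mulnCA [RHS]mulnC.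
  by rewrite /J jn !natrM !natrX.
set q : R := k%:R ^+ (3 * n) in JE.
have q1 : 1 <= q by rewrite exprn_ege1.
have q0 : 0 < q by apply: lt_le_trans q1.
have x0 : (0 < x)%N by rewrite muln_gt0 !expn_gt0 l0 D0.
have xR : 0 < x%:R :> R by rewrite ltr0n.
have J0 : 0 < J by rewrite JE !mulr_gt0// exprn_gt0.
have jJR : j%:R <= J by rewrite ler_nat.
have p1 := psi1_gt0 psi.
have mc := centred_measurable j mA.
have rare : psi (pr [set s | J / q <= `|centred A j s|]) <= q^-1 * psi 1.
  have h1 : pr [set s | J / q <= `|centred A j s|] <= 2 * expR (- ((J / q) ^+ 2 / (8 * J))).
    apply: centred_hits_tail => //; rewrite divr_ge0 ?(ltW J0) ?(ltW q0)//=.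
    by rewrite ler_pdivrMr//; nra.
  have h2 : 2 * expR (- ((J / q) ^+ 2 / (8 * J))) <= u0 ^+ (l ^ (e * n)).
    have -> : (J / q) ^+ 2 / (8 * J) = x%:R / 4 by rewrite JE; field; rewrite !gt_eqF.
    have ln0 : (0 < l ^ (e * n))%N by rewrite expn_gt0 l0.
    apply: (@le_trans _ _ ((2 * expR (- (D%:R / 4))) ^+ (l ^ (e * n)))); last first.
      by rewrite lerXn2r// ?nnegrE ?(ltW u00)// mulr_ge0// expR_ge0.
    rewrite exprMn ler_pM ?expR_ge0//.
      by rewrite -[leLHS]expr1 ler_weXn2l// ler1n.
    rewrite -expRM_natl ler_expR mulrN lerN2 mulrA ler_wpM2r ?invr_ge0//.
    rewrite -natrM ler_nat /x leq_mul2l; apply/orP; right.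
    by rewrite -[X in (X <= _)%N]expn1 leq_pexp2l.
  apply: (@le_trans _ _ (psi (u0 ^+ (l ^ (e * n))))).
    apply: psi_mono; [exact: pr_ge0|exact: le_trans h1 h2|].
    by rewrite exprn_ile1// ltW.
  apply: le_trans (power_iter l2 ui (e * n) u00 (lexx _)) _.
  apply: ler_pM; [by rewrite exprn_ge0// ltW|by apply: psi_ge0; rewrite !ltW| |].
    rewrite exprM; apply: (@le_trans _ _ ((k%:R ^+ 3)^-1 ^+ n)).
      by rewrite lerXn2r// nnegrE ?exprn_ge0 ?(ltW r0)// invr_ge0 exprn_ge0// ltW.
    by rewrite exprVn -exprM.
  by apply: psi_le1; rewrite !ltW.
apply: le_trans (norm_two_level psi mc (a := J / q) (b := J) _ _) _.
- by rewrite divr_ge0// ltW.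
- by move=> s; apply: le_trans (centred_le j s mA) _.
rewrite lee_fin.
have kn : 0 < k%:R ^+ n :> R by rewrite exprn_gt0.
have k2n : 0 < k%:R ^+ (2 * n) :> R by rewrite exprn_gt0.
have t0 : 0 < t by apply: lt_le_trans vt; rewrite divr_gt0.
have lin : v * psi 1 <= k%:R ^+ (2 * n) * psi t.
  apply: (@le_trans _ _ (k%:R ^+ (2 * n) * (t * psi 1))).
    by rewrite mulrA ler_wpM2r ?(ltW p1)// mulrC -ler_pdivrMr.
  by rewrite ler_wpM2l ?(ltW k2n)// psi_ge_lin// (ltW t0).
apply: (@le_trans _ _ (2 * J / q * psi 1)).
  have : J * psi (pr [set s | J / q <= `|centred A j s|]) <= J * (q^-1 * psi 1).
    by rewrite ler_wpM2l// ltW.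
  lra.
have qE : q = k%:R ^+ n * k%:R ^+ (2 * n) by rewrite -exprD -mulSn.
have kr : (k%:R ^+ n)^-1 <= r ^+ n.
  rewrite -exprVn lerXn2r// ?nnegrE ?invr_ge0 ?(ltW k0) ?(ltW r0)//.
  by rewrite -[leLHS]mul1r ler_pdivrMr.
have -> : 2 * J / q * psi 1 = 2 / v * J * (k%:R ^+ n)^-1 * ((v * psi 1) / k%:R ^+ (2 * n)).
  by rewrite qE; field; rewrite !gt_eqF.
apply: ler_pM.
- by rewrite !mulr_ge0 ?invr_ge0// ltW.
- by rewrite divr_ge0 ?mulr_ge0 ?(ltW v0) ?(ltW p1) ?(ltW k2n).
- by rewrite ler_wpM2l// mulr_ge0 ?(ltW J0)// divr_ge0// ltW.
- by rewrite ler_pdivrMr// [psi t * _]mulrC.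
Qed.

(** For J = 2 B ^ n a deviation J / k ^ (3 n) has a probability exponentially
    small in J / k ^ (6 n), hence the factor k ^ 6 of B; the other factors then
    leave the exponent l ^ (e n) * D ^ n, which is what the second condition
    requires in centred_common. The rare and the common case meet where t is of
    order k ^ - (2 n). *)
Lemma block_estimate : exists (B : nat) (q C : R), [/\ (2 <= B)%N, 0 < q < 1, 0 <= C &
  forall (n j : nat) (A : nat -> set R) (t : R), (0 < n)%N -> (j <= B ^ n)%N ->
    independent_events A -> 0 <= t <= 1 -> (forall i, (i < j)%N -> pr (A i) <= t) ->
    (N (centred A j) <= (C * (q * B%:R) ^+ n * psi t)%:E)%E].
Proof.
have [/andP[u00 u01] r01 rk _ _] := ui.
have [e [e0 re]] : exists e, (0 < e)%N /\ r ^+ e <= (k%:R ^+ 3)^-1.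
  by apply: expr_small => //; rewrite invr_gt0 exprn_gt0.
pose D := (Num.truncn (- 4 * ln (u0 / 2))).+1.
have De : 2 * expR (- (D%:R / 4)) <= u0.
  rewrite -ler_pdivlMl// [leRHS]mulrC -[leRHS]lnK ?posrE ?divr_gt0// ler_expR.
  rewrite lerNl ler_pdivlMr//.
  have -> : - ln (u0 / 2) * 4 = - 4 * ln (u0 / 2) by ring.
  exact: (ltW (truncnS_gt _)).
pose v := Num.min u0 (16^-1).
have v0 : 0 < v by rewrite lt_min u00 invr_gt0/=.
have vu : v <= u0 by rewrite ge_min lexx.
have v16 : 16 * v <= 1.
  by rewrite -ler_pdivlMl// mulr1 ge_min lexx orbT.
pose B := (k ^ 6 * l ^ e * D)%N.
have l0 : (0 < l)%N by rewrite (leq_trans _ l2).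
have kp : (0 < k)%N by rewrite (leq_trans _ k2).
have B2 : (2 <= B)%N.
  rewrite /B -mulnA expnS -!mulnA; apply: (leq_trans k2); apply: leq_pmulr.
  by rewrite !muln_gt0 !expn_gt0 kp l0.
exists B, r, (2 * (4 + 2 / v)); split => //.
  by rewrite mulr_ge0// addr_ge0// divr_ge0// ltW.
move=> n j A t n0 jB iA t01 At; have /andP[tge t1] := t01.
have [t0|tn0] := eqVneq t 0.
  rewrite centred_null//.
    by rewrite t0 Psi0 mulr0.
  by move=> i ij; apply/eqP; rewrite eq_le pr_ge0 andbT -t0 At.
have tp : 0 < t by rewrite lt_neqAle eq_sym tn0.
have pt : 0 <= psi t by exact: psi_ge0.
have /andP[r0 r1] := r01.
have rn : 0 <= r ^+ n by rewrite exprn_ge0// ltW.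
have jJ : (j <= 2 * B ^ n)%N by apply: (leq_trans jB); exact: leq_pmull.
have v2 : 0 <= 2 / v by rewrite divr_ge0// ltW.
have JE : (2 * B ^ n)%N%:R = 2 * B%:R ^+ n :> R by rewrite natrM natrX.
have Bn : 0 <= B%:R ^+ n :> R by rewrite exprn_ge0.
have k2n : 0 < k%:R ^+ (2 * n) :> R by rewrite exprn_gt0.
rewrite exprMn; have [tv|vt] := leP (v / k%:R ^+ (2 * n)) t.
  apply: le_trans (centred_common re De n0 e0 isT iA jJ v0 tv t1) _.
  rewrite -/B JE lee_fin.
  have : 0 <= B%:R ^+ n * (r ^+ n * psi t) by rewrite !mulr_ge0.
  move: (psi t) (r ^+ n) (B%:R ^+ n) (2 / v) => a b c d; lra.
pose b := (k ^ (5 * n) * l ^ (e * n) * D ^ n)%N.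
have bE : (2 * k ^ n * b = 2 * B ^ n)%N.
  rewrite /B /b (expnMn (k ^ 6 * l ^ e) D) (expnMn (k ^ 6) (l ^ e)).
  rewrite -!(expnM k) -(expnM l) !mulnA; congr (_ * _ * _)%N.
  by rewrite -mulnA -expnD; congr (_ * (_ ^ _))%N; rewrite -mulSn.
have kt : t * k%:R ^+ (2 * n) <= v by rewrite -ler_pdivlMr// ltW.
have h := @centred_rare _ psi k l r u0 k2 l2 ui n b j A t iA.
rewrite bE in h; apply: le_trans (h _ _ jJ tp _ _ At) _.
- by rewrite !muln_gt0 !expn_gt0 kp l0.
- rewrite /b mulnAC mulnC; apply: leq_trans (leq_pmulr _ _).
    by rewrite leq_pexp2l// leq_pmull.
  by rewrite muln_gt0 !expn_gt0 kp.
- apply: le_trans vu; apply: le_trans kt; rewrite mulrC ler_wpM2l//.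
  by rewrite ler_weXn2l// leq_pmull.
- by rewrite -mulrA [k%:R ^+ _ * t]mulrC; apply: le_trans v16; rewrite ler_wpM2l.
rewrite JE lee_fin.
have : 0 <= 2 / v * (B%:R ^+ n * (r ^+ n * psi t)) by rewrite !mulr_ge0// invr_ge0 ltW.
move: (psi t) (r ^+ n) (B%:R ^+ n) (2 / v) => a b' c d; lra.
Qed.

End block_estimate.

(** * The part of a function above a level *)

Section uniform_tails.
Context {R : realType} (psi : Psi R).
Local Notation I01 := (`[0%R, 1%R]%classic : set R).
Local Notation m := (@lebesgue_measure R).
Local Notation N := (Lorentz_norm psi).

Definition excess (u : R -> R) (T : R) (t : R) : R := Num.max 0 (`|u t| - T).

Lemma excess_measurable u T : measurable_fun I01 u -> measurable_fun I01 (excess u T).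
Proof.
move=> mu; apply: measurable_maxr => //; apply: measurable_funB => //.
exact: (measurable_abs mu).
Qed.

Lemma excess_ge0 u T t : 0 <= excess u T t.
Proof. by rewrite /excess le_max lexx. Qed.

Lemma indic_sum_ge (v : R) n : v <= n%:R -> v <= \sum_(i < n) (i%:R < v)%R%:R.
Proof.
elim: n => [|n IH] vn; first by rewrite big_ord0.
have [h|h] := leP v n%:R.
  by apply: (le_trans (IH h)); rewrite big_ord_recr/= lerDl.
apply: (le_trans vn); rewrite -[in leLHS](card_ord n.+1) -sumr_const.
by apply: ler_sum => i _; rewrite (le_lt_trans _ h)// ler_nat -ltnS.
Qed.

(** The excess over T is at most the sum of the indicators of the sets where
    |u| > T + i, by layers of thickness 1. *)
Lemma norm_excess (u : R -> R) (T : nat) (s : R) : measurable_fun I01 u ->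
  (forall J, \sum_(i < J) psi (tail u (T + i)%:R) <= s) ->
  (N (excess u T%:R) <= s%:E)%E.
Proof.
move=> mu hs.
pose y i : R -> R := \1_[set t | (T + i)%:R < `|u t|].
have my i : measurable_fun I01 (y i) by apply: measurable_indicI; exact: mtail.
apply: (@le_trans _ _ (\sum_(0 <= i <oo) N (y i))%E).
  apply: norm_le_series; [exact: excess_measurable|exact: my|move=> t It].
  set v := `|u t| - T%:R.
  have [v0|v0] := leP v 0.
    rewrite /excess max_l// normr0.
    by apply: nneseries_ge0 => i _ _; rewrite lee_fin.
  pose n := (Num.truncn v).+1.
  apply: le_trans (nneseries_lim_ge n _); last by move=> i _ _; rewrite lee_fin.
  rewrite big_mkord sumEFin lee_fin /excess max_r ?(ltW v0)// ger0_norm ?(ltW v0)//.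
  apply: le_trans (indic_sum_ge (ltW (truncnS_gt v))) _; apply: ler_sum => i _.
  rewrite /y indicE; have [h|h] := ltP i%:R v; last exact: normr_ge0.
  rewrite mem_set ?normr1//=.
  by rewrite natrD; move: h; rewrite /v; lra.
apply: lime_le; first by apply: is_cvg_nneseries => i _ _; exact: norm_ge0.
apply: nearW => n; rewrite big_mkord.
apply: (@le_trans _ _ (\sum_(i < n) (psi (tail u (T + i)%:R))%:E)%E); last first.
  by rewrite sumEFin lee_fin.
apply: lee_sum => i _; rewrite -[psi _]mul1r.
apply: norm_le_level; [exact: my|exact: mtail| |exact: ler01].
by move=> t _; rewrite mul1r ger0_norm// indicE.
Qed.

Lemma tail_sums_le (u : R -> R) J : function_space N u ->
  \sum_(i < J) psi (tail u i.+1%:R) <= fine (N u).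
Proof.
move=> fu; rewrite -lee_fin (fineK (fsp_fin fu)).
apply: le_trans (grid_le_norm psi J (fsp_measurable fu) ler01).
rewrite lee_fin /grid mul1r; apply: ler_sum => i _.
by rewrite mul1r.
Qed.

Lemma nonneg_tails_small (f : nat -> R) (C e : R) : (forall i, 0 <= f i) ->
  (forall J, \sum_(i < J) f i <= C) -> 0 < e ->
  exists T0, forall T, (T0 <= T)%N -> forall J, \sum_(i < J) f (T + i)%N <= e.
Proof.
move=> f0 fC e0.
pose S := [set \sum_(i < J) f i | J in [set: nat]].
have Sub : has_sup S.
  split; first by exists (\sum_(i < 0) f i), 0%N.
  by exists C => _ [J _ <-]; exact: fC.
have [_ [T0 _ <-] hT0] := sup_adherent e0 Sub.
exists T0 => T TT J.
have h : \sum_(i < T + J) f i <= sup S.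
  by apply: sup_upper_bound => //; exists (T + J)%N.
rewrite big_split_ord/= in h.
have h2 : \sum_(i < T0) f i <= \sum_(i < T) f i.
  rewrite -(subnKC TT) [leRHS]big_split_ord/= lerDl; exact: sumr_ge0.
lra.
Qed.

Lemma tails_small (u : R -> R) (e : R) : function_space N u -> 0 < e ->
  exists T0 : nat, forall T : nat, (T0 <= T)%N ->
    forall J, \sum_(i < J) psi (tail u (T + i)%:R) <= e.
Proof.
move=> fu e0; have mu := fsp_measurable fu.
have f0 i : 0 <= psi (tail u i.+1%:R) by apply: psi_ge0; exact: tail01.
have [T0 h] := nonneg_tails_small f0 (fun J => tail_sums_le J fu) e0.
exists T0.+1 => T TT J; have T0' : (0 < T)%N by apply: leq_trans TT.
have := h T.-1; rewrite -ltnS prednK// => /(_ TT J).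
apply: le_trans; rewrite le_eqVlt; apply/orP; left; apply/eqP.
by apply: eq_bigr => i _; rewrite -addSn prednK.
Qed.

(** Absolute continuity of the norm of u, tested against weights of small
    integral. *)
Lemma small_weights (u : R -> R) (e : R) : function_space N u -> 0 < e ->
  exists2 d : R, 0 < d & forall h : R -> R, measurable_fun I01 h ->
    unit_weight psi (fun t => `|h t|) ->
    (\int[m]_(t in I01) (`|h t|)%:E <= d%:E)%E -> `|pairing h u| <= e.
Proof.
move=> fu e0; have mu := fsp_measurable fu.
have e20 : 0 < e / 2 by rewrite divr_gt0.
have [T hT] := tails_small fu e20; have {}hT := hT T (leqnn T).
(* below T the integral of h is used, above T its membership in the unit ball *)
exists (e / 2 / (T%:R + 1)); first by rewrite divr_gt0// ltr_wpDl.
move=> h mh uh hd.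
have nE := norm_excess mu hT.
have mE := excess_measurable T%:R mu.
rewrite -lee_fin; apply: (@le_trans _ _ (\int[m]_(t in I01) (`|u t| * `|h t|)%:E)%E).
  have h1 : `|pairing h u| <= \int[m]_(t in I01) `|u t * h t|.
    by apply: le_normr_Rintegral; [exact: mI01|exact: pairing_integrable uh fu].
  apply: (@le_trans _ _ (\int[m]_(t in I01) `|u t * h t|)%:E); first by rewrite lee_fin.
  have /integrableP[_ fin] := pairing_integrable mh uh fu.
  rewrite /Rintegral fineK.
    rewrite le_eqVlt; apply/orP; left; apply/eqP.
    by apply: eq_integral => t _; rewrite normrM.
  rewrite ge0_fin_numE; first exact: fin.
  by apply: integral_ge0 => t _; rewrite lee_fin.
have mnh : measurable_fun I01 (fun t => `|h t|).
  exact: (measurable_abs mh).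
have mnu : measurable_fun I01 (fun t => `|u t|).
  exact: (measurable_abs mu).
apply: (@le_trans _ _ (\int[m]_(t in I01)
   ((T%:R * `|h t|)%:E + (`|excess u T%:R t| * `|h t|)%:E))%E).
  apply: ge0_le_integral; first exact: mI01.
  - by move=> t _; rewrite lee_fin mulr_ge0.
  - by apply/measurable_EFinP; exact: measurable_funM.
  - apply: emeasurable_funD; apply/measurable_EFinP; apply: measurable_funM => //.
    exact: (measurable_abs mE).
  move=> t _; rewrite -EFinD lee_fin -mulrDl ler_wpM2r//.
  rewrite [`|excess _ _ _|]ger0_norm ?excess_ge0// -lerBlDl.
  by rewrite /excess le_max lexx orbT.
rewrite ge0_integralD; first last.
- apply/measurable_EFinP; apply: measurable_funM => //.
  exact: (measurable_abs mE).
- by move=> t _; rewrite lee_fin mulr_ge0.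
- by apply/measurable_EFinP; exact: measurable_funM.
- by move=> t _; rewrite lee_fin mulr_ge0.
- exact: mI01.
have -> : e = e / 2 + e / 2 by lra.
rewrite EFinD; apply: leeD; last first.
  exact: le_trans (int_weight_le_norm mE uh) nE.
rewrite int_scale//.
apply: (@le_trans _ _ (T%:R%:E * (e / 2 / (T%:R + 1))%:E)%E).
  by apply: lee_wpmul2l; rewrite ?lee_fin.
rewrite -EFinM lee_fin mulrCA ler_piMr ?(ltW e20)//.
by rewrite ler_pdivrMr ?ltr_wpDl// mul1r lerDl.
Qed.

End uniform_tails.

(** * Weakly null sequences have uniformly small tails *)

Section uniform_tails_thm.
Context {R : realType} (psi : Psi R).
Local Notation I01 := (`[0%R, 1%R]%classic : set R).
Local Notation m := (@lebesgue_measure R).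
Local Notation N := (Lorentz_norm psi).

Variables (x : nat -> R -> R) (eps M : R).
Hypotheses (fx : forall n, function_space N (x n)) (eps0 : 0 < eps)
  (xM : forall n, fine (N (x n)) <= M)
  (heavy : forall T : nat, exists n J,
     eps < \sum_(i < J) psi (tail (x n) (T + i)%:R)).

(* Markov's inequality for the terms, from the lower bound psi u >= u * psi 1. *)
Let heavy_tail_pr (n T : nat) : (0 < T)%N -> tail (x n) T%:R <= M / psi 1 / T%:R.
Proof.
move=> T0; have mx := fsp_measurable (fx n).
have TR : 0 < T%:R :> R by rewrite ltr0n.
have := @norm_ge_level _ psi (x n) [set t | T%:R < `|x n t|] T%:R mx (mtail _ mx) (ltW TR).
move=> /(_ (fun t _ h => ltW h)); rewrite -(fineK (fsp_fin (fx n))) lee_fin => h.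
rewrite ler_pdivlMr// ler_pdivlMr ?psi1_gt0//.
apply: le_trans (xM n); apply: le_trans h.
rewrite -mulrA [leLHS]mulrCA ler_wpM2l ?(ltW TR)//.
by apply: psi_ge_lin; exact: tail01.
Qed.

(* One step of the gliding hump: a functional seeing the heavy tail of some x n
   of large index. It lives on the set where |x n| > T for a large T, which is
   so small that the functional is negligible on the earlier terms and has
   small integral. *)
Let step (k : nat) (eta : R) : 0 < eta -> exists n (h : R -> R) (b : R),
  [/\ (k < n)%N, measurable_fun I01 h, unit_weight psi (fun t => `|h t|),
    forall t, `|h t| <= b &
    [/\ eps <= pairing h (x n),
      forall A, measurable (I01 `&` A) ->
        (\int[m]_(t in I01) (`|h t| * \1_A t)%:E <= eta%:E)%E &
      forall i, (i <= k)%N -> `|pairing h (x i)| <= eta]].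
Proof.
move=> eta0.
have /choice[T0 hT0] : forall i, exists T0 : nat, forall T : nat, (T0 <= T)%N ->
    forall J, \sum_(j < J) psi (tail (x i) (T + j)%:R) <= eps.
  by move=> i; exact: tails_small.
have /choice[d hd] : forall i, exists d : R, 0 < d /\ forall h : R -> R, measurable_fun I01 h ->
    unit_weight psi (fun t => `|h t|) ->
    (\int[m]_(t in I01) (`|h t|)%:E <= d%:E)%E -> `|pairing h (x i)| <= eta.
  by move=> i; have [d d0 hd] := small_weights (fx i) eta0; exists d.
have [del del0 hdel] : exists2 del : R, 0 < del &
    del <= eta /\ forall i, (i <= k)%N -> del <= d i.
  elim: k => [|k [del del0 [h1 h2]]].
    exists (Num.min eta (d 0%N)); first by rewrite lt_min eta0; case: (hd 0%N).
    split; first by rewrite ge_min lexx.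
    by move=> i; rewrite leqn0 => /eqP ->; rewrite ge_min lexx orbT.
  exists (Num.min del (d k.+1)); first by rewrite lt_min del0; case: (hd k.+1).
  split; first by rewrite ge_min h1.
  move=> i; rewrite leq_eqVlt => /orP[/eqP ->|]; first by rewrite ge_min lexx orbT.
  by rewrite ltnS => /h2 h; rewrite ge_min h.
have [ka /andP[ka0 ka1] kaP] := psi_small psi del0.
pose T := (\max_(i < k.+1) T0 i + (Num.truncn (M / psi 1 / ka)%R).+1)%N.
have TT i : (i <= k)%N -> (T0 i <= T)%N.
  move=> ik; apply: (leq_trans _ (leq_addr _ _)).
  exact: (leq_bigmax (Ordinal (n := k.+1) (m := i) ik)).
have Tp : (0 < T)%N by rewrite /T addnS.
have TR : 0 < T%:R :> R by rewrite ltr0n.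
have [n [J hJ]] := heavy T.
have kn : (k < n)%N.
  rewrite ltnNge; apply/negP => nk.
  by have := hT0 n T (TT n nk) J; rewrite leNgt hJ.
have tailka : tail (x n) T%:R <= ka.
  apply: (le_trans (heavy_tail_pr n Tp)).
  rewrite ler_pdivrMr// [leRHS]mulrC -ler_pdivrMr//.
  apply: (le_trans (ltW (truncnS_gt _))); rewrite ler_nat.
  exact: leq_addl.
have mx := fsp_measurable (fx n).
have hs : {homo (fun i => (T + i)%:R : R) : i j / (i <= j)%N >-> i <= j}.
  by move=> i j ij; rewrite ler_nat leq_add2l.
have [|v v0|h [mh uh [b hb] hsupp hp]] :=
  @level_functional _ psi (x n) (fun i => (T + i)%:R) (fun=> 1) J (fx n) hs.
- by move=> _; exact: ler01.
- (* there are at most v - T + 1 <= v levels T + i below v *)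
  elim: J {hJ} => [|J IH]; first by rewrite big_ord0.
  rewrite big_ord_recr/= mul1r; case: ltP => /= h; last by rewrite addr0.
  apply: (@le_trans _ _ (J%:R + 1)).
    rewrite lerD2r -[J in leRHS]card_ord -sum1_card natr_sum.
    by apply: ler_sum => i _; rewrite mul1r; case: (_ < _).
  apply: le_trans (ltW h); rewrite natrD addrC lerD2r.
  by rewrite ler1n.
have hint A : measurable (I01 `&` A) ->
    (\int[m]_(t in I01) (`|h t| * \1_A t)%:E <= del%:E)%E.
  move=> mA; have [mg g0 gA] := uh.
  pose E := [set t | T%:R < `|x n t|].
  have mE : measurable (I01 `&` E) by exact: mtail.
  apply: (@le_trans _ _ (\int[m]_(t in I01) (`|h t| * \1_E t)%:E)%E).
    apply: ge0_le_integral; first exact: mI01.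
    - by move=> t _; rewrite lee_fin mulr_ge0.
    - by apply/measurable_EFinP/measurable_funM => //; exact: measurable_indicI.
    - by apply/measurable_EFinP/measurable_funM => //; exact: measurable_indicI.
    move=> t _; rewrite lee_fin.
    have [xt|xt] := leP `|x n t| T%:R.
      by rewrite hsupp ?addn0// normr0 !mul0r.
    rewrite ler_wpM2l// [leRHS]indicE mem_set//= indicE.
    by case: (_ \in _).
  apply: (le_trans (gA _ mE)); rewrite lee_fin; apply: kaP.
  by rewrite pr_ge0.
have hint' : (\int[m]_(t in I01) (`|h t|)%:E <= del%:E)%E.
  have := hint setT; rewrite setIT => /(_ mI01).
  apply: le_trans; rewrite le_eqVlt; apply/orP; left; apply/eqP.
  by apply: eq_integral => t _; rewrite indicT mulr1.
exists n, h, b; split; [exact: kn|exact: mh|exact: uh|exact: hb|split].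
- apply: le_trans hp; apply: le_trans (ltW hJ) _.
  by apply: ler_sum => i _; rewrite mul1r.
- move=> A mA; apply: (le_trans (hint A mA)); rewrite lee_fin.
  by case: hdel.
- move=> i ik; have [_ hi] := hd i; apply: hi => //.
  apply: (le_trans hint'); rewrite lee_fin.
  by case: hdel => _; exact.
Qed.

(** The functionals h_j of the successive steps are concentrated on smaller and
    smaller scales: the bounded function h_j is negligible against psi on sets
    of measure below ka_(j+1), since psi u / u is unbounded, and its whole
    integral is negligible against psi on sets of measure above ka_j. Each set
    therefore sees at most one of them fully, so the sum of all |h_j| is at most 3
    times a weight of the unit ball, and gliding_hump applies. *)
Lemma heavy_tails_not_weakly_null :
  (forall K : R, exists ka : R, 0 < ka /\ forall t, 0 < t -> t <= ka -> K * t <= psi t) ->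
  ~ weakly_null N x.
Proof.
move=> ratio.
have p2 k : 0 < (2^-1 : R) ^+ k by rewrite exprn_gt0// invr_gt0.
(* the state after j steps: the last index used, and the scale below which all
   the weights used so far are dominated *)
pose good (j : nat) (p : nat * R) (q : nat * R * (R -> R) * R) :=
  [/\ (p.1 < q.1.1.1)%N, measurable_fun I01 q.1.2,
    unit_weight psi (fun t => `|q.1.2 t|), forall t, `|q.1.2 t| <= q.2 &
  [/\ 0 < q.1.1.2 /\ q.1.1.2 <= p.2,
    forall t, 0 < t -> t <= q.1.1.2 -> q.2 * t <= 2^-1 ^+ j * psi t,
    eps <= pairing q.1.2 (x q.1.1.1),
    forall A, measurable (I01 `&` A) ->
      (\int[m]_(t in I01) (`|q.1.2 t| * \1_A t)%:E <= (2^-1 ^+ j * psi p.2)%:E)%E &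
    forall i, (i <= p.1)%N -> `|pairing q.1.2 (x i)| <= 2^-1 ^+ j * (eps / 4)]].
have ex : forall jp : nat * (nat * R), exists q, 0 < jp.2.2 <= 1 -> good jp.1 jp.2 q.
  move=> [j [n ka]]; have [/andP[ka0 ka1]|no] := pselect (0 < ka <= 1); last first.
    by exists (0%N, 0, fun=> 0, 0).
  have pk : 0 < psi ka by apply: psi_gt0; rewrite ka0.
  have eta0 : 0 < Num.min (2^-1 ^+ j * psi ka) (2^-1 ^+ j * (eps / 4)).
    by rewrite lt_min !mulr_gt0// divr_gt0.
  have [n' [h [b [nn' mh uh hb [hp hA hi]]]]] := step n eta0.
  have [ka' [ka'0 hka']] := ratio (2 ^+ j * b).
  exists (n', Num.min ka ka', h, b) => _; split => //; split => /=.
  - by rewrite lt_min ka0 ka'0 ge_min lexx.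
  - move=> t t0; rewrite le_min => /andP[_ /(hka' _ t0)].
    rewrite -[leRHS]mul1r -mulrA => ht.
    rewrite -(ler_pM2l (exprn_gt0 j (ltr0n R 2))) [leRHS]mulrA -exprMn divff// expr1n.
    exact: ht.
  - exact: hp.
  - move=> A mA; apply: (le_trans (hA A mA)); rewrite lee_fin.
    by rewrite ge_min lexx.
  - by move=> i ii; apply: (le_trans (hi i ii)); rewrite ge_min lexx orbT.
have [g gP] := choice ex.
pose st := fix st j : nat * R :=
  if j is i.+1 then (g (i, st i)).1.1 else (0%N, 1).
pose q j := g (j, st j).
have stS j : st j.+1 = (q j).1.1 by [].
have st01 j : 0 < (st j).2 <= 1.
  elim: j => [|j IH]; first by rewrite /= ltr01 lexx.
  have [_ _ _ _ [[h1 h2] _ _ _ _]] := gP (j, st j) IH.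
  by rewrite stS h1/= (le_trans h2)//; case/andP: IH.
have Q j : good j (st j) (q j) by exact: (gP (j, st j) (st01 j)).
pose h j := (q j).1.2; pose n j := (st j.+1).1; pose ka j := (st j).2.
have kaS j : ka j.+1 <= ka j by have [_ _ _ _ [[_ ?] _ _ _ _]] := Q j.
have mh j : measurable_fun I01 (h j) by have [] := Q j.
have uh j : unit_weight psi (fun t => `|h j t|) by have [] := Q j.
have nS j : (n j < n j.+1)%N by have [] := Q j.+1.
have n_incr : {homo n : i j / (i < j)%N} by apply: homo_ltn; [exact: ltn_trans|exact: nS].
have mnh j : measurable_fun I01 (fun t => `|h j t|).
  exact: (measurable_abs (mh j)).
(* the weights together: at most one of them is neither dominated through its
   height nor through its integral *)
pose mid j (u : R) := (ka j.+1 < u) && (u < ka j).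
have midsum (u : R) J : \sum_(j < J) (mid j u)%:R <= (ka J < u)%R%:R :> R.
  elim: J => [|J IH]; first by rewrite big_ord0.
  rewrite big_ord_recr/= /mid; have [uk|uk] := ltP u (ka J).
    rewrite andbT; move: IH; rewrite ltNge (ltW uk)/= => IH.
    by apply: le_trans (lerD IH (lexx _)) _; rewrite add0r.
  rewrite andbF addr0; apply: (le_trans IH); rewrite ler_nat.
  by case: ltP => // k1; rewrite (le_lt_trans (kaS J) k1).
have term j A : measurable (I01 `&` A) ->
    (\int[m]_(t in I01) (`|h j t| * \1_A t)%:E <=
      ((2^-1 ^+ j + (mid j (pr A))%:R) * psi (pr A))%:E)%E.
  move=> mA; have pA := pr01 mA; have [_ _ hA] := uh j.
  have [_ _ _ hb [_ hk _ hint _]] := Q j.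
  have pp : 0 <= psi (pr A) by exact: psi_ge0.
  have [/eqP A0|An0] := boolP (pr A == 0).
    by apply: (le_trans (hA A mA)); rewrite A0 Psi0 mulr0.
  have Ap : 0 < pr A by rewrite lt_neqAle eq_sym An0 pr_ge0.
  have [Ak|Ak] := leP (pr A) (ka j.+1).
    apply: (@le_trans _ _ ((q j).2 * pr A)%:E).
      rewrite -int_indicI//; last first.
        by have := hb 0; apply: le_trans.
      apply: ge0_le_integral; first exact: mI01.
      - by move=> t _; rewrite lee_fin mulr_ge0.
      - apply/measurable_EFinP/measurable_funM; first exact: mnh.
        exact: measurable_indicI.
      - apply/measurable_EFinP/measurable_funM; first exact: measurable_cst.
        exact: measurable_indicI.
      - by move=> t _; rewrite lee_fin ler_wpM2r//; exact: hb.
    rewrite lee_fin; apply: (le_trans (hk _ Ap Ak)).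
    by rewrite ler_wpM2r// lerDl.
  have [kA|kA] := leP (ka j) (pr A).
    apply: (le_trans (hint A mA)); rewrite lee_fin.
    apply: (@le_trans _ _ (2^-1 ^+ j * psi (pr A))).
      rewrite ler_wpM2l ?(ltW (p2 j))//; have /andP[k0 _] := st01 j.
      by apply: psi_mono => //; [exact: ltW|case/andP: pA].
    by rewrite ler_wpM2r// lerDl.
  apply: (le_trans (hA A mA)); rewrite lee_fin /mid Ak kA/=.
  by rewrite -[leLHS]mul1r ler_wpM2r// lerDr ltW.
have sum_weight J : unit_weight psi (fun t => 3^-1 * \sum_(j < J) `|h j t|).
  have mS : measurable_fun I01 (fun t => \sum_(j < J) `|h j t|).
    exact: (measurable_sum_fun (f := fun (j : 'I_J) t => `|h j t|)).
  have S0 t : 0 <= \sum_(j < J) `|h j t| by apply: sumr_ge0.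
  split; [exact: measurable_funM|by move=> t; rewrite mulr_ge0// invr_ge0|].
  move=> A mA; have pp : 0 <= psi (pr A) by apply: psi_ge0; exact: pr01.
  have mSA : measurable_fun I01 (fun t => (\sum_(j < J) `|h j t|) * \1_A t).
    by apply: measurable_funM => //; exact: measurable_indicI.
  rewrite (_ : (\int[m]_(t in I01) _)%E = (\int[m]_(t in I01)
      (3^-1 * ((\sum_(j < J) `|h j t|) * \1_A t))%:E)%E); last first.
    by apply: eq_integral => t _; rewrite mulrA.
  rewrite int_scale//; last by move=> t; rewrite mulr_ge0.
  have -> : (\int[m]_(t in I01) ((\sum_(j < J) `|h j t|) * \1_A t)%:E =
      \sum_(j < J) \int[m]_(t in I01) (`|h j t| * \1_A t)%:E)%E.
    rewrite -(int_sum (f := fun (j : 'I_J) t => `|h j t| * \1_A t)).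
    - by apply: eq_integral => t _; rewrite mulr_suml.
    - by move=> j; apply: measurable_funM; [exact: mnh|exact: measurable_indicI].
    - by move=> j t; rewrite mulr_ge0.
  apply: (@le_trans _ _ ((3^-1)%:E *
     (\sum_(j < J) ((2^-1 ^+ j + (mid j (pr A))%:R) * psi (pr A))%:E))%E).
    apply: lee_wpmul2l; first by rewrite lee_fin invr_ge0.
    by apply: lee_sum => j _; exact: term.
  rewrite sumEFin -EFinM lee_fin -mulr_suml big_split/= mulrA.
  rewrite -[leRHS]mul1r ler_wpM2r// ler_pdivrMl// mulr1.
  have h1 := geo2_le 0 J (R := R); rewrite big_mkord expr0 in h1.
  have h2 := midsum (pr A) J.
  have h3 : (ka J < pr A)%R%:R <= 1 :> R by case: (_ < _).
  lra.
have e2 : 0 < eps / 2 by rewrite divr_gt0.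
refine (@gliding_hump R psi x (fun j => pairing (h j)) n 3 (eps / 2) _ _ _ e2 _).
- by move=> j; exact: pairing_linear.
- move=> u J fu.
  have mS : measurable_fun I01 (fun t => 3^-1 * \sum_(j < J) `|h j t|) by case: (sum_weight J).
  have S0 t : 0 <= 3^-1 * \sum_(j < J) `|h j t| by case: (sum_weight J).
  have mu := fsp_measurable fu.
  have hl := int_weight_le_norm mu (sum_weight J).
  rewrite -ler_pdivrMl// -lee_fin (fineK (fsp_fin fu)).
  apply: le_trans hl.
  have mnu : measurable_fun I01 (fun t => `|u t|).
    exact: (measurable_abs mu).
  rewrite (_ : (\int[m]_(t in I01) _)%E = (\int[m]_(t in I01)
      (3^-1 * (\sum_(j < J) `|u t| * `|h j t|))%:E)%E); last first.
    by apply: eq_integral => t _; rewrite -mulr_sumr mulrCA.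
  rewrite int_scale//; last 2 first.
  - apply: (measurable_sum_fun (f := fun (j : 'I_J) t => `|u t| * `|h j t|)) => j.
    exact: measurable_funM.
  - by move=> t; apply: sumr_ge0 => j _; rewrite mulr_ge0.
  rewrite EFinM; apply: lee_wpmul2l; first by rewrite lee_fin invr_ge0.
  rewrite (int_sum (f := fun (j : 'I_J) t => `|u t| * `|h j t|)); first last.
  - by move=> j t; rewrite mulr_ge0.
  - by move=> j; exact: (measurable_funM mnu (mnh j)).
  rewrite -sumEFin; apply: lee_sum => j _.
  have /integrableP[_ fin] := pairing_integrable (mh j) (uh j) fu.
  apply: (@le_trans _ _ (\int[m]_(t in I01) `|u t * h j t|)%:E).
    rewrite lee_fin; apply: le_normr_Rintegral; first exact: mI01.
    exact: pairing_integrable (uh j) fu.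
  rewrite /Rintegral fineK.
    rewrite le_eqVlt; apply/orP; left; apply/eqP.
    by apply: eq_integral => t _; rewrite normrM.
  rewrite ge0_fin_numE; first exact: fin.
  by apply: integral_ge0 => t _; rewrite lee_fin.
- move=> j; elim: j => [//|j IH]; exact: (leq_ltn_trans IH).
- move=> j J; have [_ _ _ _ [_ _ hj _ _]] := Q j.
  have h1 : \sum_(j.+1 <= i < J) `|pairing (h i) (x (n j))| <=
      \sum_(j.+1 <= i < J) 2^-1 ^+ i * (eps / 4).
    rewrite big_nat [leRHS]big_nat; apply: ler_sum => i /andP[ji _].
    have [_ _ _ _ [_ _ _ _ hi]] := Q i; apply: hi.
    case: i ji => // i ji; rewrite -/(n i).
    by move: ji; rewrite ltnS leq_eqVlt => /orP[/eqP ->//|/n_incr/ltnW].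
  have h2 : \sum_(j.+1 <= i < J) (2^-1 : R) ^+ i <= 1.
    apply: (le_trans (geo2_le _ _)); rewrite exprS mulrA divff// mul1r.
    by apply: exprn_ile1; lra.
  rewrite -mulr_suml in h1.
  apply: le_trans hj; rewrite -/(h j).
  have : (\sum_(j.+1 <= i < J) (2^-1 : R) ^+ i) * (eps / 4) <= 1 * (eps / 4).
    by rewrite ler_wpM2r// divr_ge0// ltW.
  have : 0 < eps by [].
  lra.
Qed.

End uniform_tails_thm.

(** * Subsequences with a common majorant *)

Section extraction.
Context {R : realType}.

(** A limit along an ultrafilter finer than \oo serves every coordinate at once,
    which spares a diagonal argument. *)
Lemma cluster_sequence (a : nat -> nat -> R) (c : R) :
  (forall n i, 0 <= a n i <= c) ->
  exists b : nat -> R, (forall i, 0 <= b i) /\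
    forall (T N0 : nat) (eta : R), 0 < eta ->
    exists2 n, (N0 <= n)%N & forall i, (i < T)%N -> `|a n i - b i| <= eta.
Proof.
move=> ac; have [U [UU Uoo]] := ultraFilterLemma (T := nat) (eventually_filter).
pose V i := [set v : R | U [set n | v <= a n i]].
have V0 i : V i 0 by apply: filterS filterT => n _; case/andP: (ac n i).
have Vc i : has_sup (V i).
  split; first by exists 0.
  exists c => v Vv; rewrite leNgt; apply/negP => cv.
  apply: (@filter_not_empty _ U); apply: filterS Vv => n /= vn.
  by have := lt_le_trans cv vn; rewrite ltNge; case/andP: (ac n i) => _ ->.
pose b i := sup (V i).
have b0 i : 0 <= b i by exact: sup_upper_bound.
exists b; split=> // T N0 eta eta0.
have near_b i : U [set n | `|a n i - b i| <= eta].
  have [v Vv bv] := sup_adherent eta0 (Vc i).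
  have up : U [set n | a n i < b i + eta].
    have [h|h] := in_ultra_setVsetC [set n | b i + eta <= a n i] UU.
      have : b i + eta <= b i by exact: sup_upper_bound.
      by rewrite gerDl leNgt eta0.
    by apply: filterS h => n /=; rewrite leNgt => /negP; rewrite negbK.
  apply: filterS2 Vv up => n /= h1 h2; rewrite ler_norml; apply/andP.
  by rewrite /b in h2 *; split; lra.
have : U [set n | (N0 <= n)%N /\ forall i, (i < T)%N -> `|a n i - b i| <= eta].
  have hN : U [set n | (N0 <= n)%N] by apply: Uoo; exists N0.
  elim: T => [|T IH]; first by apply: filterS hN => n.
  apply: filterS2 IH (near_b T) => n /= [h1 h2] h3; split=> // i.
  by rewrite ltnS leq_eqVlt => /orP[/eqP ->|/h2].
by move=> /filter_ex[n [h1 h2]]; exists n.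
Qed.

(** Let b be a cluster point, coordinate by coordinate. By the uniform smallness
    of the tails, f can be chosen so that the positive parts of a (f k) - b have
    sums at most 2 ^ - k; b plus the first K of these positive parts then
    majorizes the first K terms. *)
Lemma dominated_subsequence (a : nat -> nat -> R) (M : R) (P : nat -> nat -> Prop) :
  (forall n i, 0 <= a n i) -> (forall n J, \sum_(i < J) a n i <= M) ->
  (forall e : R, 0 < e -> exists T, forall n J, \sum_(i < J) a n (T + i)%N <= e) ->
  (forall k, exists N0, forall n, (N0 <= n)%N -> P k n) ->
  exists2 f : nat -> nat, {homo f : i j / (i < j)%N} & (forall k, P k (f k)) /\
    forall K, exists2 g : nat -> R,
      (forall k, (k < K)%N -> forall i, a (f k) i <= g i) &
      forall J, \sum_(i < J) g i <= M + 3.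
Proof.
move=> a0 aM tails evP.
have ac n i : 0 <= a n i <= M.
  rewrite a0 /=; apply: le_trans (aM n i.+1); rewrite big_ord_recr/= lerDr.
  exact: sumr_ge0.
have [b [b0 hb]] := cluster_sequence ac.
pose pos n i := Num.max 0 (a n i - b i).
have p2 k : 0 < (2^-1 : R) ^+ k by rewrite exprn_gt0// invr_gt0.
have close k N0 : exists n, [/\ (N0 <= n)%N, P k n &
    forall J, \sum_(i < J) pos n i <= 2^-1 ^+ k].
  have e0 : 0 < (2^-1 : R) ^+ k / 2 by rewrite divr_gt0.
  have [T hT] := tails _ e0; have [N1 hN1] := evP k.
  have T1 : 0 < T%:R + 1 :> R by rewrite ltr_wpDl.
  have d0 : 0 < (2^-1 : R) ^+ k / 2 / (T%:R + 1) by rewrite divr_gt0.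
  have [n Nn hn] := hb T (maxn N0 N1) _ d0.
  exists n; split.
  - exact: leq_trans (leq_maxl _ _) Nn.
  - by apply: hN1; exact: leq_trans (leq_maxr _ _) Nn.
  move=> J; have pos0 i : 0 <= pos n i by rewrite /pos le_max lexx.
  apply: (@le_trans _ _ (\sum_(i < T + J) pos n i)).
    rewrite addnC [leRHS]big_split_ord/= lerDl; exact: sumr_ge0.
  rewrite big_split_ord/= [leRHS](splitr (2^-1 ^+ k)); apply: lerD.
    apply: (@le_trans _ _ (\sum_(i < T) 2^-1 ^+ k / 2 / (T%:R + 1))).
      apply: ler_sum => i _; rewrite /pos ge_max (ltW d0)/=.
      exact: le_trans (ler_norm _) (hn i (ltn_ord i)).
    rewrite sumr_const card_ord -[leLHS]mulr_natr mulrAC ler_pdivrMr//.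
    by rewrite ler_wpM2l ?(ltW e0)// lerDl.
  apply: le_trans (hT n J); apply: ler_sum => i _.
  by rewrite /pos ge_max a0/= gerBl.
have /choice[nx hnx] : forall q : nat * nat, exists n, [/\ (q.2 <= n)%N, P q.1 n &
    forall J, \sum_(i < J) pos n i <= 2^-1 ^+ q.1].
  by move=> [k N0]; exact: close.
pose f := fix f k := if k is j.+1 then nx (k, (f j).+1) else nx (0%N, 0%N).
have fP k : P k (f k) by case: k => [|k]; [case: (hnx (0%N, 0%N))|case: (hnx (k.+1, (f k).+1))].
have fS k J : \sum_(i < J) pos (f k) i <= 2^-1 ^+ k.
  by case: k => [|k]; [case: (hnx (0%N, 0%N))|case: (hnx (k.+1, (f k).+1))].
exists f.
  by apply: homo_ltn; [exact: ltn_trans|move=> k; case: (hnx (k.+1, (f k).+1))].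
split=> // K; exists (fun i => b i + \sum_(k < K) pos (f k) i).
  move=> k kK i; rewrite -lerBlDl.
  apply: (@le_trans _ _ (pos (f k) i)); first by rewrite /pos le_max lexx orbT.
  rewrite (bigD1 (Ordinal kK))//= lerDl; apply: sumr_ge0 => j _.
  by rewrite /pos le_max lexx.
move=> J; rewrite big_split/= exchange_big/=.
have h1 : \sum_(k < K) \sum_(i < J) pos (f k) i <= 2.
  apply: (@le_trans _ _ (\sum_(k < K) 2^-1 ^+ k)); first by apply: ler_sum.
  by have := geo2_le 0 K (R := R); rewrite big_mkord expr0 mulr1.
have J1 : 0 < J%:R + 1 :> R by rewrite ltr_wpDl.
have d0 : 0 < (J%:R + 1)^-1 :> R by rewrite invr_gt0.
have [n _ hn] := hb J 0%N _ d0.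
have h2 : \sum_(i < J) b i <= M + 1.
  apply: (@le_trans _ _ (\sum_(i < J) (a n i + (J%:R + 1)^-1))).
    apply: ler_sum => i _; have := hn i (ltn_ord i).
    by rewrite ler_norml => /andP[h _]; lra.
  rewrite big_split/= lerD ?aM// sumr_const card_ord -[leLHS]mulr_natr mulrC.
  by rewrite ler_pdivrMr// mul1r lerDl.
lra.
Qed.

End extraction.

Section extraction_tails.
Context {R : realType} (psi : Psi R).
Local Notation I01 := (`[0%R, 1%R]%classic : set R).
Local Notation m := (@lebesgue_measure R).
Local Notation N := (Lorentz_norm psi).

Lemma fsp_integrable (u : R -> R) : function_space N u -> m.-integrable I01 (EFin \o u).
Proof.
move=> fu; have mu := fsp_measurable fu.
apply/integrableP; split; first exact/measurable_EFinP.
apply: (le_lt_trans (int_abs_le_norm psi mu)).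
by rewrite -(fineK (fsp_fin fu)) -EFinM ltry.
Qed.

Lemma mean_le_norm (u : R -> R) : function_space N u ->
  (`|\int[m]_(t in I01) u t|%:E <= (psi 1)^-1%:E * N u)%E.
Proof.
move=> fu; apply: le_trans (int_abs_le_norm psi (fsp_measurable fu)).
have iu := fsp_integrable fu; have /integrableP[mu fin] := iu.
apply: (@le_trans _ _ (\int[m]_(t in I01) `|u t|)%:E).
  by rewrite lee_fin; apply: le_normr_Rintegral; [exact: mI01|exact: iu].
rewrite /Rintegral fineK//.
by rewrite ge0_fin_numE//; apply: integral_ge0 => t _; rewrite lee_fin.
Qed.

(** The integral over [0, 1] is a bounded functional, as the space is contained
    in L1. *)
Lemma weakly_null_mean (x : nat -> R -> R) : weakly_null N x ->
  (fun n => \int[m]_(t in I01) x n t) @ \oo --> (0 : R).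
Proof.
move=> [fx wx]; apply: (wx (fun u => \int[m]_(t in I01) u t)); split=> [a u v fu fv|].
  have iau : m.-integrable I01 (EFin \o (fun t => a * u t)).
    rewrite (_ : _ \o _ = (fun t => a%:E * (EFin \o u) t)%E).
      by apply: integrableZl; [exact: mI01|exact: fsp_integrable].
    by apply/funext => t /=; rewrite EFinM.
  rewrite RintegralD//; last exact: fsp_integrable.
  by rewrite RintegralZl//; exact: fsp_integrable.
by exists (psi 1)^-1 => u fu; exact: mean_le_norm.
Qed.

Lemma dominated_tails (x : nat -> R -> R) :
  (forall K : R, exists ka : R, 0 < ka /\ forall t, 0 < t -> t <= ka -> K * t <= psi t) ->
  weakly_null N x ->
  exists f (C : R), [/\ {homo f : i j / (i < j)%N}, 0 <= C,
    forall k, `|\int[m]_(t in I01) x (f k) t| <= 2^-1 ^+ k &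
    forall K, exists2 g : nat -> R,
      (forall k, (k < K)%N -> forall i, psi (tail (x (f k)) i%:R) <= g i) &
      forall J, \sum_(i < J) g i <= C].
Proof.
move=> ratio wx; have [fx _] := wx; have [M xM] := weakly_null_bounded wx.
pose a n i := psi (tail (x n) i%:R).
have a01 n i : 0 <= tail (x n) i%:R <= 1 by apply: tail01; exact: fsp_measurable (fx n).
have a0 n i : 0 <= a n i by apply: psi_ge0.
have aM n J : \sum_(i < J) a n i <= psi 1 + M.
  case: J => [|J].
    rewrite big_ord0 addr_ge0 ?(ltW (psi1_gt0 psi))//.
    apply: (le_trans _ (xM 0%N)); apply: fine_ge0; exact: norm_ge0.
  rewrite big_ord_recl; apply: lerD.
    exact: psi_le1.
  exact: le_trans (tail_sums_le J (fx n)) (xM n).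
have tails (e : R) : 0 < e -> exists T, forall n J, \sum_(i < J) a n (T + i)%N <= e.
  move=> e0; apply: contrapT => no.
  apply: (heavy_tails_not_weakly_null fx e0 xM _ ratio wx) => T.
  apply: contrapT => no2; apply: no; exists T => n J; rewrite leNgt.
  by apply/negP => h; apply: no2; exists n, J.
pose P k n := `|\int[m]_(t in I01) x n t| <= (2^-1 : R) ^+ k.
have evP k : exists N0, forall n, (N0 <= n)%N -> P k n.
  have e0 : 0 < (2^-1 : R) ^+ k by rewrite exprn_gt0// invr_gt0.
  have /cvgrPdist_le/(_ _ e0)[N0 _ hN] := weakly_null_mean wx.
  by exists N0 => n Nn; have := hN n Nn; rewrite sub0r normrN.
have [f hf [fP hK]] := dominated_subsequence a0 aM tails evP.
exists f, (psi 1 + M + 3); split=> //.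
by apply: (le_trans _ (le_trans (aM 0%N 0%N) _)); rewrite ?big_ord0 ?lerDl.
Qed.

End extraction_tails.

(** * Cutting sums into layers *)

Section layers.
Context {R : realType}.

Lemma indic_sum_le (w : R) n : 0 <= w -> \sum_(i < n) (i%:R < w)%R%:R <= w + 1.
Proof.
move=> w0; elim: n => [|n IH]; first by rewrite big_ord0 addr_ge0.
have [h|h] := leP w n%:R; first by rewrite big_ord_recr/= ltNge h addr0.
apply: (@le_trans _ _ (n.+1)%:R).
  rewrite -[in leRHS](card_ord n.+1) -sumr_const; apply: ler_sum => i _.
  by case: (_ < _).
by rewrite -natr1 lerD2r ltW.
Qed.

(** Rounding v up, away from 0, to a multiple of 1 / j and truncating it at T, by
    counting the grid points below |v|. *)
Lemma layers_approx (v : R) (j T : nat) : (0 < j)%N ->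
  `|v - (j%:R^-1 * \sum_(i < T * j) (i%:R / j%:R < v)%R%:R -
         j%:R^-1 * \sum_(i < T * j) (i%:R / j%:R < - v)%R%:R)|
    <= j%:R^-1 + Num.max 0 (`|v| - T%:R).
Proof.
move=> j0; have jR : 0 < j%:R :> R by rewrite ltr0n.
have dR : 0 < j%:R^-1 :> R by rewrite invr_gt0.
pose L (w : R) : R := j%:R^-1 * \sum_(i < T * j) (i%:R / j%:R < w)%R%:R.
rewrite -/(L v) -/(L (- v)).
have neg w : w <= 0 -> L w = 0.
  move=> w0; rewrite /L big1 ?mulr0// => i _; case: ltP => // h.
  have : 0 <= i%:R / j%:R :> R by rewrite divr_ge0.
  by move=> h2; have := lt_le_trans (le_lt_trans h2 h) w0; rewrite ltxx.
have LE w : L w = j%:R^-1 * \sum_(i < T * j) (i%:R < w * j%:R)%R%:R.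
  by rewrite /L; congr (_ * _); apply: eq_bigr => i _; rewrite ltr_pdivrMr.
have up w : 0 <= w -> L w <= w + j%:R^-1.
  move=> w0; rewrite LE ler_pdivrMl// mulrDr divff ?gt_eqF// [in leRHS]mulrC.
  by apply: indic_sum_le; rewrite mulr_ge0// ltW.
have lo w : 0 <= w -> w - Num.max 0 (w - T%:R) <= L w.
  move=> w0; have -> : w - Num.max 0 (w - T%:R) = Num.min w T%:R.
    by case: (leP w T%:R) => h; [rewrite max_l|rewrite max_r]; lra.
  rewrite LE ler_pdivlMl//.
  apply: (@le_trans _ _ (\sum_(i < T * j) (i%:R < Num.min w T%:R * j%:R)%R%:R)).
    rewrite mulrC; apply: indic_sum_ge.
    by rewrite natrM ler_wpM2r ?(ltW jR)// ge_min lexx orbT.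
  apply: ler_sum => i _; case: ltP => h; last by case: (_ < _).
  rewrite (lt_le_trans h)//.
  by rewrite ler_wpM2r ?(ltW jR)// ge_min lexx.
have mx0 w : 0 <= Num.max 0 w :> R by rewrite le_max lexx.
have [v0|v0] := leP 0 v.
  have h3 := mx0 (v - T%:R); have h1 := up v v0; have h2 := lo v v0; rewrite (neg (- v)); last by lra.
  by rewrite (ger0_norm v0) ler_norml; apply/andP; split; lra.
have nv : 0 <= - v by lra.
have h3 := mx0 (- v - T%:R); have h1 := up _ nv; have h2 := lo _ nv; rewrite (neg v); last by lra.
by rewrite (ltr0_norm v0) ler_norml; apply/andP; split; lra.
Qed.

Lemma sum_divn (g : nat -> R) (j T : nat) : (0 < j)%N ->
  \sum_(i < T * j) g (i %/ j)%N = j%:R * \sum_(i < T) g i.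
Proof.
move=> j0; elim: T => [|T IH]; first by rewrite mul0n !big_ord0 mulr0.
rewrite mulSnr big_split_ord/= IH big_ord_recr/= mulrDr; congr (_ + _).
rewrite (eq_bigr (fun=> g T)); last first.
  by move=> i _; rewrite divnMDl// divn_small// addn0.
by rewrite sumr_const card_ord mulr_natl.
Qed.

End layers.

Section layered_norm.
Context {R : realType} (psi : Psi R).
Local Notation I01 := (`[0%R, 1%R]%classic : set R).
Local Notation m := (@lebesgue_measure R).
Local Notation N := (Lorentz_norm psi).

Lemma Rint_sum n (f : 'I_n -> R -> R) (b : R) :
  (forall i, measurable_fun I01 (f i)) -> (forall i t, `|f i t| <= b) ->
  \int[m]_(t in I01) (\sum_(i < n) f i t) = \sum_(i < n) \int[m]_(t in I01) f i t.
Proof.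
elim: n f => [|n IH] f mf fb.
  rewrite big_ord0; transitivity (\int[m]_(t in I01) (0 : R)).
    by apply: eq_Rintegral => t _; rewrite big_ord0.
  by rewrite /Rintegral integral0.
transitivity (\int[m]_(t in I01) (f ord0 t + \sum_(i < n) f (lift ord0 i) t)).
  by apply: eq_Rintegral => t _; rewrite big_ord_recl.
rewrite RintegralD ?IH ?big_ord_recl//.
- exact: bounded_integrable (mf _) (fb _).
apply: (@bounded_integrable _ _ (n%:R * b)).
  exact: measurable_sum_fun (fun i => mf (lift ord0 i)).
move=> t; apply: (le_trans (ler_norm_sum _ _ _)).
rewrite mulr_natl -[n in leRHS](card_ord n) -sumr_const.
exact: ler_sum.
Qed.

Lemma independent_preimages (y : nat -> R -> R) (B : set R) :
  (forall k, measurable_fun I01 (y k)) -> independent y -> measurable B ->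
  independent_events (fun k => y k @^-1` B).
Proof.
move=> my iy mB; have mA k : measurable (I01 `&` y k @^-1` B) by exact: my mI01 B mB.
split=> // s us; have := iy s (fun=> B) us (fun=> mB).
rewrite /pr => ->; rewrite (eq_bigr (fun i => (pr (y i @^-1` B))%:E)); last first.
  by move=> i _; rewrite prE.
by rewrite prodEFin.
Qed.

(** Each y k is a combination of indicators, of layers of thickness 1 / j, up to
    an error h k of norm at most (psi 1 + 1) / j; the j errors together stay
    bounded, and so do the means of the combinations, since those of the y k
    are summable. In each layer there remains a centred sum of j independent
    events, whose probabilities are controlled by the majorant g at the integer
    part of the level. *)
Lemma layered_norm (y : nat -> R -> R) (j : nat) (g : nat -> R) (C D : R) :
  (0 < j)%N -> (forall k, function_space N (y k)) ->
  (forall B, measurable B -> independent_events (fun k => y k @^-1` B)) ->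
  (forall k, `|\int[m]_(t in I01) y k t| <= 2^-1 ^+ k) ->
  (forall k, (k < j)%N -> forall i, psi (tail (y k) i%:R) <= g i) ->
  (forall J, \sum_(i < J) g i <= C) -> 0 <= D ->
  (forall A t, independent_events A -> 0 <= t <= 1 ->
     (forall i, (i < j)%N -> pr (A i) <= t) -> (N (centred A j) <= (D * psi t)%:E)%E) ->
  (N (fun t => (\sum_(k < j) y k t)%R) <= (4 * psi 1 + 2 + 2 * (D * C))%:E)%E.
Proof.
move=> j0 fy iy my0 yg gC D0 hD.
have my k := fsp_measurable (fy k).
have jR : 0 < j%:R :> R by rewrite ltr0n.
have dR : 0 < j%:R^-1 :> R by rewrite invr_gt0.
have p1 := psi1_gt0 psi.
have [T hT] : exists T, forall k, (k < j)%N -> forall J,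
    \sum_(i < J) psi (tail (y k) (T + i)%:R) <= j%:R^-1.
  have /choice[T0 hT0] : forall k, exists T0 : nat, forall T : nat, (T0 <= T)%N ->
      forall J, \sum_(i < J) psi (tail (y k) (T + i)%:R) <= j%:R^-1.
    by move=> k; exact: tails_small.
  exists (\max_(k < j) T0 k)%N => k kj; apply: hT0.
  exact: (leq_bigmax (Ordinal kj)).
(* the layers of the positive parts and of the negative parts *)
pose sg (b : bool) : R := (-1) ^+ b.
pose A b i k := [set t : R | i%:R / j%:R < sg b * y k t].
have AE b i k t : \1_(A b i k) t = (i%:R / j%:R < sg b * y k t)%R%:R :> R.
  by rewrite indicE; congr (_%:R); congr nat_of_bool; apply/idP/idP; rewrite inE.
have indA b i : independent_events (A b i).
  have := iy [set v | i%:R / j%:R < sg b * v]; apply.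
  rewrite -[X in measurable X]setTI.
  have ms : measurable_fun setT (fun v : R => sg b * v) by exact: measurable_funM.
  have := ms measurableT `]i%:R / j%:R, +oo[%classic (measurable_itv _).
  by congr (measurable (_ `&` _)); apply/seteqP; split=> v /=; rewrite in_itv/= andbT.
have mA b i k : measurable (I01 `&` A b i k) by case: (indA b i).
pose L b k t : R := j%:R^-1 * \sum_(i < T * j) \1_(A b i k) t.
pose E b k : R := j%:R^-1 * \sum_(i < T * j) pr (A b i k).
have mL b k : measurable_fun I01 (L b k).
  apply: measurable_funM => //; apply: measurable_sum_fun => i.
  exact: measurable_indicI.
have L1 b k t : `|L b k t| <= j%:R^-1 * (T * j)%:R.
  rewrite ger0_norm; last by rewrite mulr_ge0 ?(ltW dR)// sumr_ge0.
  rewrite ler_wpM2l ?(ltW dR)// -[in leRHS](card_ord (T * j)) -sumr_const.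
  by apply: ler_sum => i _; rewrite AE; case: (_ < _).
have fL b k : function_space N (L b k) by apply: fsp_bounded (mL b k) (fun t _ => L1 b k t).
have intL b k : \int[m]_(t in I01) L b k t = E b k.
  rewrite RintegralZl//; last first.
    apply: (@bounded_integrable _ _ (T * j)%:R).
      by apply: measurable_sum_fun => i; exact: measurable_indicI.
    move=> t; rewrite ger0_norm ?sumr_ge0// -[in leRHS](card_ord (T * j)) -sumr_const.
    by apply: ler_sum => i _; rewrite AE; case: (_ < _).
  congr (_ * _).
  rewrite (@Rint_sum _ (fun (i : 'I_(T * j)) t => \1_(A b i k) t) 1).
  - by apply: eq_bigr => i _; exact: Rint_indic.
  - by move=> i; exact: measurable_indicI.
  by move=> i t; rewrite AE; case: (_ < _); rewrite ?normr1 ?normr0.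
pose h k t : R := (-1) * (L false k t - L true k t) + y k t.
have fLL k : function_space N (fun t => L false k t - L true k t).
  rewrite (_ : (fun t => _) = (fun t => (-1) * L true k t + L false k t)).
    exact: fsp_lin.
  by apply/funext => t; rewrite mulN1r addrC.
have fh k : function_space N (h k) by exact: fsp_lin.
have Nh k : (k < j)%N -> (N (h k) <= (j%:R^-1 * psi 1 + j%:R^-1)%:E)%E.
  move=> kj.
  apply: (@le_trans _ _ (N (fun=> (j%:R^-1)%R) + N (excess (y k) (T%:R)%R))%E).
    apply: norm_triangle; [exact: fsp_measurable (fh k)|exact: measurable_cst| |].
      exact: excess_measurable.
    move=> t _; rewrite (ger0_norm (ltW dR)) (ger0_norm (excess_ge0 _ _ _)).
    have := layers_approx (y k t) T j0; rewrite /excess; apply: le_trans.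
    rewrite /h mulN1r addrC le_eqVlt; apply/orP; left; apply/eqP.
    congr `|_ - (_ * _ - _ * _)|; apply: eq_bigr => i _; rewrite AE /sg.
      by rewrite expr0 mul1r.
    by rewrite expr1 mulN1r.
  rewrite EFinD; apply: leeD; last by apply: norm_excess => //; exact: hT.
  by apply: (le_trans (norm_cst psi _)); rewrite (ger0_norm (ltW dR)).
have hE k : (k < j)%N -> `|E false k - E true k| <= 2^-1 ^+ k + (j%:R^-1 + j%:R^-1 / psi 1).
  move=> kj.
  have inth : \int[m]_(t in I01) h k t = \int[m]_(t in I01) y k t - (E false k - E true k).
    transitivity (\int[m]_(t in I01) (y k t - (L false k t - L true k t))).
      by apply: eq_Rintegral => t _; rewrite /h mulN1r addrC.
    rewrite RintegralB; first last.
    - exact: fsp_integrable (fLL k).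
    - exact: fsp_integrable (fy k).
    - exact: mI01.
    congr (_ - _); rewrite RintegralB; first last.
    - exact: fsp_integrable (fL true k).
    - exact: fsp_integrable (fL false k).
    - exact: mI01.
    by rewrite !intL.
  have h1 : `|\int[m]_(t in I01) h k t| <= j%:R^-1 + j%:R^-1 / psi 1.
    rewrite -lee_fin; apply: (le_trans (mean_le_norm (fh k))).
    apply: (@le_trans _ _ ((psi 1)^-1%:E * (j%:R^-1 * psi 1 + j%:R^-1)%:E)%E).
      by apply: lee_wpmul2l; [rewrite lee_fin invr_ge0 ltW|exact: Nh].
    rewrite -EFinM lee_fin mulrDr mulrCA mulVf ?gt_eqF// mulr1 [_^-1 * _^-1]mulrC.
    exact: lexx.
  have h2 := my0 k; rewrite inth in h1.
  have : E false k - E true k = \int[m]_(t in I01) y k t -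
    (\int[m]_(t in I01) y k t - (E false k - E true k)) by lra.
  move=> ->; apply: (le_trans (ler_normB _ _)); exact: lerD.
pose Z b (i : nat) t : R := j%:R^-1 * centred (A b i) j t.
have mZ b i : measurable_fun I01 (Z b i).
  by apply: measurable_funM => //; apply: centred_measurable; exact: mA.
have ZE b t : \sum_(k < j) L b k t - \sum_(k < j) E b k = \sum_(i < T * j) Z b i t.
  rewrite -2!mulr_sumr exchange_big/= [X in _ - _ * X]exchange_big/= -mulrBr -sumrB mulr_sumr.
  by apply: eq_bigr.
pose S b t : R := \sum_(i < T * j) `|Z b i t|.
have mS b : measurable_fun I01 (S b).
  apply: (measurable_sum_fun (f := fun (i : 'I_(T * j)) t => `|Z b i t|)) => i.
  exact: (measurable_abs (mZ b i)).
have S0 b t : 0 <= S b t by exact: sumr_ge0.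
have NS b : (N (S b) <= (D * C)%:E)%E.
  apply: (@le_trans _ _ (\sum_(i < T * j) N (Z b i))%E).
    apply: norm_le_sum; [exact: mS|by move=> i; exact: mZ|move=> t _].
    by rewrite ger0_norm.
  apply: (@le_trans _ _ (\sum_(i < T * j) (j%:R^-1 * (D * g (i %/ j)%N))%:E)%E).
    apply: lee_sum => i _.
    have [t [t01 At tg]] : exists t, [/\ 0 <= t <= 1,
        forall k, (k < j)%N -> pr (A b i k) <= t & psi t <= g (i %/ j)%N].
      pose k0 := [arg max_(k > Ordinal j0) pr (A b i k)]%O.
      exists (pr (A b i k0)); split; first exact: pr01.
        by move=> k kj; rewrite /k0; case: arg_maxP => // i0 _ /(_ (Ordinal kj)); exact.
      apply: le_trans (yg k0 (ltn_ord k0) (i %/ j)%N).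
      apply: psi_mono; [exact: pr_ge0| |by case/andP: (tail01 (i %/ j)%:R (my k0))].
      apply: le_pr; [exact: mA|exact: mtail|move=> t [It /= h1]; split=> //=].
      apply: (@le_lt_trans _ _ (i%:R / j%:R)).
        by rewrite ler_pdivlMr// -natrM ler_nat leq_trunc_div.
      apply: (lt_le_trans h1); apply: (le_trans (ler_norm _)).
      by rewrite normrM /sg normrX normrN1 expr1n mul1r.
    apply: (le_trans (norm_scale psi _ (centred_measurable j (mA b i)))).
    rewrite (ger0_norm (ltW dR)) EFinM; apply: lee_wpmul2l; first by rewrite lee_fin ltW.
    apply: (le_trans (hD _ _ (indA b i) t01 At)); rewrite lee_fin.
    by rewrite ler_wpM2l.
  rewrite sumEFin lee_fin -mulr_sumr -mulr_sumr.
  rewrite (sum_divn g T j0) mulrCA mulKf ?gt_eqF//.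
  by rewrite ler_wpM2l.
pose c := 3 + (psi 1)^-1.
have c0 : 0 <= c by rewrite addr_ge0// invr_ge0 ltW.
have sumE : \sum_(k < j) `|E false k - E true k| <= c.
  apply: (@le_trans _ _ (\sum_(k < j) (2^-1 ^+ k + (j%:R^-1 + j%:R^-1 / psi 1)))).
    by apply: ler_sum => k _; exact: hE.
  rewrite big_split/= /c sumr_const card_ord.
  have -> : (j%:R^-1 + j%:R^-1 / psi 1) *+ j = 1 + (psi 1)^-1.
    by rewrite -[LHS]mulr_natl mulrDr mulrA divff ?gt_eqF// mul1r.
  rewrite addrA lerD2r.
  by have := geo2_le 0 j (R := R); rewrite big_mkord expr0; lra.
pose H t : R := \sum_(k < j) `|h k t|.
have mH : measurable_fun I01 H.
  apply: (measurable_sum_fun (f := fun (k : 'I_j) t => `|h k t|)) => k.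
  exact: (measurable_abs (fsp_measurable (fh k))).
have H0 t : 0 <= H t by exact: sumr_ge0.
have NH : (N H <= (psi 1 + 1)%:E)%E.
  apply: (@le_trans _ _ (\sum_(k < j) N (h k))%E).
    apply: norm_le_sum => //; first by move=> k; exact: fsp_measurable (fh k).
    by move=> t _; rewrite ger0_norm.
  apply: (@le_trans _ _ (\sum_(k < j) (j%:R^-1 * psi 1 + j%:R^-1)%:E)%E).
    by apply: lee_sum => k _; exact: Nh.
  rewrite sumEFin lee_fin sumr_const card_ord -[leLHS]mulr_natl mulrDr mulrA divff ?gt_eqF//.
  by rewrite mul1r.
have mc : measurable_fun I01 (fun t => c + H t) by exact: measurable_funD.
have mSS : measurable_fun I01 (fun t => S false t + S true t) by exact: measurable_funD.
have mY : measurable_fun I01 (fun t => \sum_(k < j) y k t).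
  exact: (measurable_sum_fun (f := fun (k : 'I_j) t => y k t)).
have -> : 4 * psi 1 + 2 + 2 * (D * C) = (c * psi 1 + (psi 1 + 1)) + (D * C + D * C).
  have e : (psi 1)^-1 * psi 1 = 1 by rewrite mulVf ?gt_eqF.
  by rewrite /c [(3 + _) * _]mulrDl e; lra.
apply: (@le_trans _ _ (N (fun t => (c + H t)%R) + N (fun t => (S false t + S true t)%R))%E).
  apply: norm_triangle => // t _.
  rewrite (ger0_norm (addr_ge0 c0 (H0 t))) (ger0_norm (addr_ge0 (S0 _ t) (S0 _ t))).
  have -> : \sum_(k < j) y k t = \sum_(k < j) h k t + \sum_(k < j) (E false k - E true k) +
      (\sum_(i < T * j) Z false i t - \sum_(i < T * j) Z true i t).
    by rewrite -!ZE /h big_split/= -mulr_sumr !sumrB; ring.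
  have h1 : `|\sum_(k < j) h k t| <= H t by exact: ler_norm_sum.
  have h2 : `|\sum_(k < j) (E false k - E true k)| <= c.
    exact: le_trans (ler_norm_sum _ _ _) sumE.
  have h3 b : `|\sum_(i < T * j) Z b i t| <= S b t by exact: ler_norm_sum.
  apply: (le_trans (ler_normD _ _)); apply: lerD.
    by apply: (le_trans (ler_normD _ _)); rewrite addrC; exact: lerD.
  by apply: (le_trans (ler_normB _ _)); exact: lerD.
rewrite EFinD; apply: leeD.
  apply: (@le_trans _ _ (N (fun=> c) + N H)%E).
    apply: norm_triangle => // t _; exact: ler_normD.
  rewrite EFinD; apply: leeD NH.
  by apply: (le_trans (norm_cst psi c)); rewrite (ger0_norm c0).
apply: (@le_trans _ _ (N (S false) + N (S true))%E).
  by apply: norm_triangle => // t _; exact: ler_normD.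
by rewrite EFinD; exact: leeD (NS _) (NS _).
Qed.

End layered_norm.

(** * Sufficiency and conclusion *)

Section sufficiency.
Context {R : realType} (psi : Psi R).
Local Notation I01 := (`[0%R, 1%R]%classic : set R).
Local Notation N := (Lorentz_norm psi).

(** The exponent p is read off from q * B <= B ^ (1 / p). *)
Lemma geometric_growth (B : nat) (q : R) : (2 <= B)%N -> 0 < q < 1 ->
  exists2 p : R, 1 < p & forall n j : nat, (B ^ n <= j)%N ->
    (q * B%:R) ^+ n.+1 <= B%:R * j%:R `^ p^-1.
Proof.
move=> B2 /andP[q0 q1]; have B1 : 1 < B%:R :> R by rewrite ltr1n.
have B0 : 0 < B%:R :> R by rewrite (lt_trans _ B1).
have lB : 0 < ln (B%:R : R) by rewrite ln_gt0.
have lq : ln q < 0 by rewrite ln_lt0// q0.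
pose s := Num.max (1 / 2) (1 + ln q / ln B%:R).
have s0 : 0 < s by rewrite lt_max; apply/orP; left; lra.
have s1 : s < 1.
  rewrite gt_max; apply/andP; split; first lra.
  have : ln q / ln B%:R < 0 by rewrite pmulr_llt0// invr_gt0.
  lra.
exists s^-1; first by rewrite invf_gt1.
move=> n j Bj; rewrite invrK.
have qB : q * B%:R <= B%:R `^ s.
  apply: (@le_trans _ _ (B%:R `^ (1 + ln q / ln B%:R))).
    rewrite /powR gt_eqF// mulrDl mul1r divfK ?gt_eqF// expRD !lnK ?posrE// mulrC.
    exact: lexx.
  by apply: ler_powR; [exact: ltW|rewrite le_max lexx orbT].
have qB0 : 0 <= q * B%:R by rewrite mulr_ge0 ?ltW.
apply: (@le_trans _ _ ((B%:R `^ s) ^+ n.+1)); first by rewrite lerXn2r ?nnegrE ?powR_ge0.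
rewrite exprS; apply: ler_pM; rewrite ?exprn_ge0 ?powR_ge0//.
  by rewrite -[leRHS]powRr1 ?(ltW B0)//; apply: ler_powR; apply: ltW.
rewrite -powR_mulrn ?powR_ge0// -powRrM mulrC powRrM powR_mulrn ?(ltW B0)//.
rewrite -natrX; apply: ge0_ler_powR; rewrite ?nnegrE ?(ltW s0)//.
by rewrite ler_nat.
Qed.

(** A number j of terms lies between B ^ n and B ^ (n + 1), and
    block_estimate is used with the exponent n + 1. *)
Lemma exists_exponent (k l : nat) (r u0 : R) : (2 <= k)%N -> (2 <= l)%N ->
  upper_indices psi k l r u0 -> exists2 p : R, 1 < p & Gamma_i N p.
Proof.
move=> k2 l2 ui.
have [B [q [C [B2 q01 C0 est]]]] := block_estimate k2 l2 ui.
have [p p1 growth] := geometric_growth B2 q01.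
have q0 : 0 < q by case/andP: q01.
have ps := psi1_gt0 psi; have p0 : 0 < p by apply: lt_trans p1.
exists p => //; split; first exact: ltW.
move=> x wx ix; have [fx _] := wx.
have [f [Cg [f_incr Cg0 mean hg]]] := dominated_tails (psi_ratio_unbounded k2 ui) wx.
have [M xM] := weakly_null_bounded wx.
exists (x \o f); first by exists f.
apply: (@BS_of_bound _ psi p (4 * psi 1 + 2 + 2 * (C * B%:R * Cg)) M).
- by move=> n; exact: fx.
- by move=> n; exact: xM.
move=> s s_incr j j0.
have [g yg gC] := hg (s j).
pose n := trunc_log B j.
have /andP[nj jn] := trunc_log_bounds B2 j0; rewrite -/n in nj jn.
have D0 : 0 <= C * (q * B%:R) ^+ n.+1.
  by rewrite mulr_ge0// exprn_ge0// mulr_ge0// ltW.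
have s_inj : injective (f \o s).
  by apply: increasing_inj => i i' /s_incr/f_incr.
have iy (E : set R) : measurable E -> independent_events (fun k => x (f (s k)) @^-1` E).
  move=> mE; apply: (@independent_events_sub _ (fun k => x k @^-1` E) _ s_inj).
  by apply: independent_preimages => // i; exact: fsp_measurable (fx i).
have mean2 k' : `|\int[@lebesgue_measure R]_(t in I01) x (f (s k')) t| <= 2^-1 ^+ k'.
  apply: (le_trans (mean _)); apply: ler_wiXn2l; [lra|lra|exact: increasing_geq].
have yg2 k' : (k' < j)%N -> forall i, psi (tail (x (f (s k'))) i%:R) <= g i.
  by move=> k'j; apply: yg; exact: s_incr.
have estj A t : independent_events A -> 0 <= t <= 1 ->
    (forall i, (i < j)%N -> pr (A i) <= t) ->
    (N (centred A j) <= (C * (q * B%:R) ^+ n.+1 * psi t)%:E)%E.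
  by move=> iA t01 At; apply: est => //; exact: ltnW.
have bound := @layered_norm R psi (fun k => x (f (s k))) j g Cg _ j0 (fun k => fx _) iy
  mean2 yg2 gC D0 estj.
apply: (le_trans bound); rewrite lee_fin [leRHS]mulrDl; apply: lerD.
  rewrite -[leLHS]mulr1; apply: ler_wpM2l; first by rewrite addr_ge0// mulr_ge0// ltW.
  rewrite -[leLHS](powRr0 j%:R); apply: ler_powR; first by rewrite ler1n.
  by rewrite invr_ge0 ltW.
rewrite -[leRHS]mulrA; apply: ler_wpM2l => //.
rewrite [leRHS]mulrAC -[C * B%:R * _]mulrA; apply: ler_wpM2r => //.
by apply: ler_wpM2l => //; exact: growth.
Qed.

End sufficiency.

Theorem corollary22 (R : realType) (psi : Psi R) :
  Gamma_i (Lorentz_norm psi) <> [set 1] <->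
  exists k l : nat,
    [/\ (2 <= k)%N, (2 <= l)%N,
        (limf_esup (fun u : R => (psi (k%:R * u) / psi u)%:E) 0^'+
           < k%:R%:E)%E &
        (limf_esup (fun u : R => (psi (u ^+ l) / psi u)%:E) 0^'+ < 1%:E)%E].
Proof.
split=> [nG|[k [l [k2 l2 hk hl]]]]; last first.
  have [r [u0 ui]] := upper_indices_of_limsup k2 hk hl.
  have [p p1 Gp] := exists_exponent k2 l2 ui.
  by move=> e; move: Gp; rewrite e => /= pE; rewrite pE ltxx in p1.
have [p [p1 Gp]] : exists p, 1 < p /\ Gamma_i (Lorentz_norm psi) p.
  apply: contrapT => no; apply: nG; apply/seteqP; split=> p /=; last first.
    by move=> ->; exact: Gamma_i_1.
  move=> Gp; apply/eqP; rewrite eq_le; case: (Gp) => -> _; rewrite andbT leNgt.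
  by apply/negP => p1; apply: no; exists p.
apply: contrapT => no.
have [[k [k2 hk]]|nk] := pselect (exists k : nat, (2 <= k)%N /\
  (limf_esup (fun u : R => (psi (k%:R * u) / psi u)%:E) 0^'+ < k%:R%:E)%E); last first.
  apply: (saturated_notin_Gamma p1 _ Gp); apply: saturated_of_dilation => k k2 hk.
  by apply: nk; exists k.
apply: (saturated_notin_Gamma p1 _ Gp); apply: saturated_of_power => l l2 hl.
by apply: no; exists k, l.
Qed.
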